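(* Let $\Omega\subset\mathbb{R}^n$ be a domain and let $\delta_0>0$ be such that $\Omega_{\delta_0}\ne\emptyset$. Let $\kappa:[0,l]\to\mathbb{R}^+$ be a modulus of continuity such that $$\exists A>0,\qquad \limsup_{t\to0^+}\frac{2n\,\kappa(At)}{A\,\kappa(t)}<1 ,$$ and let $u:\bar\Omega\to\mathbb{R}$ be a bounded function which is subharmonic on $\Omega$ and $\kappa$-continuous near the boundary $\partial\Omega$. Then the following properties are equivalent: (1) there exist constants $L_1>0$ and $0<\delta_1<\delta_0$ such that for $0<\delta<\delta_1$, $\ \mathcal{M}_\delta u(x)-u(x)\le L_1\,\kappa(\delta)$ for all $x\in\Omega_\delta$; (2) there exist constants $L_2>0$ and $0<\delta_2<\delta_0$ such that for $0<\delta<\delta_2$, $\ \mathcal{R}_\delta u(x)-u(x)\le L_2\,\kappa(\delta)$ for all $x\in\Omega_\delta$; (3) there exist constants $B>1$, $L_3>0$ and $0<\delta_3<\delta_0$ such that for $0<\delta<\delta_3$, $\ \mathcal{O}_\delta u(x)\le L_3\,\kappa(\delta)$ for all $x\in\Omega_{B\delta}$; (4) $u$ is $\kappa$-continuous on $\bar\Omega$, i.e. there exist constants $L_4>0$ and $0<\delta_4<\delta_0$ such that for all $x,y\in\bar\Omega$ with $|x-y|\le\delta_4$, $\ |u(x)-u(y)|\le L_4\,\kappa(|x-y|)$.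
   Context: A modulus of continuity is a continuous increasing subadditive function $\kappa:[0,l]\to\mathbb{R}^+$ ($l>0$) with $\kappa(0)=0$; the $\delta$'s are understood to be small enough that $\kappa$ is evaluated in $[0,l]$. For $\delta>0$, $\Omega_\delta:=\{x\in\Omega:\operatorname{dist}(x,\partial\Omega)>\delta\}$. A function $u:\bar\Omega\to\mathbb{R}$ is $\kappa$-continuous near the boundary $\partial\Omega$ if there exists $\varepsilon_0>0$ small enough such that for any $\zeta\in\partial\Omega$ and $z\in\Omega$ with $|z-\zeta|\le\varepsilon_0$ one has $|u(z)-u(\zeta)|\le\kappa(|z-\zeta|)$. Let $\mathbb{B}\subset\mathbb{R}^n$ be the Euclidean unit ball and $\lambda_n$ Lebesgue measure. Fix a radial bounded Borel function $\rho\ge0$ with compact support in the unit ball and $\int_{\mathbb{B}}\rho\,d\lambda_n=1$ (the normalized indicator $\rho=\lambda_n(\mathbb{B})^{-1}\mathbf{1}_{\mathbb{B}}$ being allowed). For $x\in\Omega_\delta$, $$\mathcal{M}_\delta u(x):=\max_{\bar B(x,\delta)}u,\qquad \mathcal{R}_\delta u(x):=\int_{\mathbb{B}}u(x+\delta\xi)\rho(\xi)\,d\lambda_n(\xi),$$ $$\mathcal{O}_\delta u(x):=\operatorname{osc}_{B(x,\delta)}u=\sup\{|u(y_1)-u(y_2)|:y_1,y_2\in B(x,\delta)\}.$$ *)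

(* Defs.v *)
From HB Require Import structures.
From mathcomp Require Import all_boot all_order all_algebra.
From mathcomp Require Import all_classical all_reals all_analysis.
From mathcomp Require Import measurable_realfun.
Set Implicit Arguments.
Unset Strict Implicit.
Unset Printing Implicit Defensive.
Import Order.TTheory GRing.Theory Num.Theory.
Import numFieldNormedType.Exports.
Local Open Scope classical_set_scope.
Local Open Scope ring_scope.

Section borel_rV.
Context {R : realType}.

HB.instance Definition _ (n : nat) :=
  Measurable.copy 'rV[R]_n (g_sigma_algebraType (@open 'rV[R]_n)).

Lemma open_measurable_rV n (U : set 'rV[R]_n) : open U -> measurable U.
Proof. exact: sub_sigma_algebra. Qed.

Definition rat_box n (c : 'rV[rat]_n * nat) : set 'rV[R]_n :=
  [set x | forall j, `|x 0 j - ratr (c.1 0 j)| < c.2.+1%:R^-1].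

Lemma open_rat_box n (U : set 'rV[R]_n) : open U ->
  U = \bigcup_(c in [set c | rat_box c `<=` U]) rat_box c.
Proof.
move=> oU; apply/seteqP; split => [x Ux|x [c /= cU xc]]; last exact: cU.
have /nbhs_ballP[e /= e0 eU] : nbhs x U by exact: open_nbhs_nbhs.
have [k ke] : exists k : nat, k.+1%:R^-1 < e / 2.
  have e20 : 0 < e / 2 by rewrite divr_gt0.
  have := near_infty_natSinv_lt (PosNum e20) => -[k _ /(_ k)] /=.
  by move=> /(_ (leqnn _)) ?; exists k.
have /choice[q qP] (j : 'I_n) : exists q : rat,
      `|x 0 j - ratr q| < k.+1%:R^-1.
    have /rat_in_itvoo[q] : x 0 j - k.+1%:R^-1 < x 0 j + k.+1%:R^-1.
      by rewrite ltrBlDr -addrA ltrDl addr_gt0// invr_gt0.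
    by rewrite in_itv/= => qx; exists q; rewrite distrC ltr_distl.
  exists (\row_j q j, k) => /=; last by move=> j /=; rewrite mxE.
move=> y /= yc; apply: eU; split => // i j.
rewrite (ord1 i) /ball/= (splitr e).
have := yc j; rewrite mxE => yqj.
rewrite (le_lt_trans (ler_distD (ratr (q j)) _ _))// ltrD//.
  exact: lt_trans (qP j) ke.
by rewrite distrC (lt_trans yqj).
Qed.

Lemma measurable_fun_rV d (T : measurableType d) n (f : T -> 'rV[R]_n) :
  (forall j, measurable_fun setT (fun t => f t 0 j)) -> measurable_fun setT f.
Proof.
move=> mf; apply: (measurability (@open 'rV[R]_n)) => // _ [U oU <-].
rewrite setTI (open_rat_box oU) preimage_bigcup bigcup_mkcond.
apply: countable_bigcupT_measurable; first exact: countableP.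
  move=> c; case: ifPn => // _.
rewrite (_ : _ @^-1` _ = \bigcap_(j in [set: 'I_n])
    ((fun t => f t 0 j) @^-1` ball (ratr (c.1 0 j) : R) c.2.+1%:R^-1)).
  apply: fin_bigcap_measurable => // j _; rewrite -[X in measurable X]setTI.
  by apply: mf => //; apply: open_measurable; exact: ball_open.
apply/seteqP; split => t /= H.
  by move=> j _; rewrite /ball/= distrC; exact: H.
by move=> j; have := H j I; rewrite /ball/= distrC.
Qed.

Lemma measurable_coord_rV n (j : 'I_n) :
  measurable_fun setT (fun x : 'rV[R]_n => x 0 j).
Proof.
apply: (measurability (@RGenOpens.G R)); first exact: RGenOpens.measurableE.
move=> _ [_ [a [b ->]] <-]; rewrite setTI; apply: open_measurable_rV.
by apply: open_comp; [move=> x _; exact: coord_continuous|exact: interval_open].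
Qed.

End borel_rV.

Section lebesgue_rV.
Context {R : realType}.

Definition rV_rcons n (p : 'rV[R]_n * measurableTypeR R) : 'rV[R]_n.+1 :=
  \row_i oapp (p.1 0) p.2 (unlift ord_max i).

Lemma measurable_rV_rcons n : measurable_fun setT (@rV_rcons n).
Proof.
apply: measurable_fun_rV => j.
case: (unliftP ord_max j) => [i|] ->.
  rewrite (_ : (fun _ => _) = (fun x : 'rV[R]_n => x 0 i) \o fst).
    by apply: measurableT_comp; [exact: measurable_coord_rV|exact: measurable_fst].
  by apply/funext => p; rewrite mxE liftK.
rewrite (_ : (fun _ => _) = snd); first exact: measurable_snd.
by apply/funext => p; rewrite mxE unlift_none.
Qed.

Section rcons_measure.
Variables (n : nat) (m : {measure set 'rV[R]_n -> \bar R}).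

Definition rcons_measure : set 'rV[R]_n.+1 -> \bar R :=
  pushforward (m \x @lebesgue_measure R)%E (@rV_rcons n).

Let mf := @measurable_rV_rcons n.

Let rcons0 : rcons_measure set0 = 0%E.
Proof. exact: measure0. Qed.

Let rcons_ge0 A : (0 <= rcons_measure A)%E.
Proof. exact: measure_ge0. Qed.

Let rcons_sigma_additive : semi_sigma_additive rcons_measure.
Proof. exact: measure_semi_sigma_additive. Qed.

HB.instance Definition _ := isMeasure.Build _ _ _ rcons_measure
  rcons0 rcons_ge0 rcons_sigma_additive.

End rcons_measure.

Fixpoint lebesgue_rV (n : nat) : {measure set 'rV[R]_n -> \bar R} :=
  if n is n'.+1 then rcons_measure (lebesgue_rV n') else \d_(0 : 'rV[R]_0).

Lemma lebesgue_rV_prod n (A : 'I_n -> set R) : (forall i, measurable (A i)) ->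
  lebesgue_rV n [set x | forall i, A i (x 0 i)] =
  (\prod_(i < n) lebesgue_measure (A i))%E.
Proof.
elim: n A => [|n IHn] A mA.
  by rewrite big_ord0 /= diracE mem_set//= => -[].
rewrite big_ord_recr/= -IHn; last by move=> i; exact: mA.
have mB : measurable
    [set x : 'rV[R]_n | forall i, A (widen_ord (leqnSn n) i) (x 0 i)].
  rewrite (_ : [set _ | _] = \bigcap_(i in [set: 'I_n])
      ((fun x : 'rV[R]_n => x 0 i) @^-1` A (widen_ord (leqnSn n) i))).
    apply: fin_bigcap_measurable => // i _; rewrite -[X in measurable X]setTI.
    exact: measurable_coord_rV.
  by apply/seteqP; split => x /= H i; [move=> _; exact: H|exact: (H i Logic.I)].
rewrite /rcons_measure /pushforward.
transitivity ((lebesgue_rV n \x @lebesgue_measure R)%E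
    ([set x : 'rV[R]_n | forall i, A (widen_ord (leqnSn n) i) (x 0 i)] `*`
     (A ord_max : set (measurableTypeR R))));
  last by rewrite product_measure1E//; exact: mA.
congr (_ _); apply/seteqP; split => -[x t] /=.
  move=> H; split => /= [i|].
    have := H (lift ord_max i); rewrite mxE liftK/=.
    by rewrite (_ : lift _ _ = widen_ord (leqnSn n) i)//; exact/val_inj/lift_max.
  by have := H ord_max; rewrite mxE unlift_none.
move=> [/= Hx Ht] i; rewrite mxE; case: (unliftP ord_max i) => [j|] -> //=.
by rewrite (_ : lift _ _ = widen_ord (leqnSn n) j)//; exact/val_inj/lift_max.
Qed.

End lebesgue_rV.

Section euclidean.
Context {R : realType} {n : nat}.
Implicit Types (x y z : 'rV[R]_n) (A : set 'rV[R]_n).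

(* The library norm on row vectors is the sup norm; it induces the same
   topology, but balls, distances and radial functions need the Euclidean
   one. *)
Definition enorm x : R := Num.sqrt (\sum_(i < n) x 0 i ^+ 2).

Definition eball x (r : R) : set 'rV[R]_n := [set y | enorm (y - x) < r].

Definition ecball x (r : R) : set 'rV[R]_n := [set y | enorm (y - x) <= r].

Definition boundary A : set 'rV[R]_n := closure A `\` A^°.

(* Equals +oo when A is empty. *)
Definition edist x A : \bar R := ereal_inf [set (enorm (x - z))%:E | z in A].

Definition domain A := [/\ A !=set0, open A & connected A].

Definition inner A (delta : R) : set 'rV[R]_n :=
  [set x | A x /\ (delta%:E < edist x (boundary A))%E].

End euclidean.

Section modulus.
Context {R : realType}.

(* Only the values of kappa on [0, l] are constrained. Monotonicity is weak;
   positivity on ]0, l] rules out kappa = 0, for which quotients by kappa t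
   are meaningless. *)
Definition modulus_of_continuity (l : R) (kappa : R -> R) :=
  [/\ 0 < l,
      {within `[0, l], continuous kappa} /\ kappa 0 = 0,
      {in `[0, l] &, {homo kappa : s t / s <= t}},
      (forall t, 0 < t <= l -> 0 < kappa t) &
      (forall s t, 0 <= s -> 0 <= t -> s + t <= l ->
        kappa (s + t) <= kappa s + kappa t)].

Definition continuous_near_boundary n (Omega : set 'rV[R]_n) (l : R)
    (kappa : R -> R) (u : 'rV[R]_n -> R) :=
  exists eps0 : R, 0 < eps0 <= l /\
    forall zeta z, boundary Omega zeta -> Omega z -> enorm (z - zeta) <= eps0 ->
      `|u z - u zeta| <= kappa (enorm (z - zeta)).

End modulus.

Section subharmonic.
Context {R : realType} {n : nat}.
Implicit Types (Omega : set 'rV[R]_n) (u rho : 'rV[R]_n -> R).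

Definition upper_semicontinuous_on Omega u :=
  forall x, Omega x -> forall a, u x < a -> \forall y \near x, Omega y -> u y < a.

(* The mean value inequality over solid balls, multiplied by the volume of the
   ball. *)
Definition subharmonic Omega u :=
  upper_semicontinuous_on Omega u /\
  forall x (r : R), 0 < r -> ecball x r `<=` Omega ->
    ((u x)%:E * lebesgue_rV n (eball x r) <=
      \int[lebesgue_rV n]_(y in eball x r) (u y)%:E)%E.

Definition radial_kernel rho :=
  [/\ measurable_fun setT rho /\ (forall xi, 0 <= rho xi),
      (exists C : R, forall xi, rho xi <= C),
      (forall xi eta, enorm xi = enorm eta -> rho xi = rho eta),
      (compact (closure [set xi | rho xi != 0]) /\
       closure [set xi | rho xi != 0] `<=` ecball 0 1) &
      \int[lebesgue_rV n]_(xi in eball 0 1) rho xi = 1].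

(* sup is the real-valued supremum; it is only used for u bounded on the set
   in question. *)
Definition max_op u (delta : R) x : R := sup [set u y | y in ecball x delta].

Definition mean_op rho u (delta : R) x : R :=
  \int[lebesgue_rV n]_(xi in eball 0 1) (u (x + delta *: xi) * rho xi).

Definition osc_op u (delta : R) x : R :=
  sup [set `|u y.1 - u y.2| | y in eball x delta `*` eball x delta].

End subharmonic.

(* Main.v *)
Require Import Defs.
From HB Require Import structures.
From mathcomp Require Import all_boot all_order all_algebra.
From mathcomp Require Import all_classical all_reals all_analysis.
From mathcomp Require Import measurable_realfun perm ring lra.
Set Implicit Arguments.
Unset Strict Implicit.
Unset Printing Implicit Defensive.
Import Order.TTheory GRing.Theory Num.Theory.
Import numFieldNormedType.Exports.
Local Open Scope classical_set_scope.
Local Open Scope ring_scope.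

(** Three of the four implications are elementary. Continuity bounds the maximum
over a closed ball (4 => 1), an average of [u] against a probability density is
at most its maximum (1 => 2), and a bound on the oscillation over balls that stay
away from the boundary becomes global continuity because [u] is controlled near
the boundary (3 => 4, [osc_continuous]). The content is 2 => 3: control of the
averages [mean_op rho u] forces control of the oscillation.

The first ingredient removes the kernel. For a subharmonic function the average
over a sphere increases with the radius, so a radial kernel sees at least a fixed
proportion of the excess of a solid mean over a small concentric ball:
for some [s] depending on [rho] only, [solid_mean u (d * s) x - u x] is at most
[2 * (mean_op rho u d x - u x)] ([mean_op_solid_mean_le]). As subharmonicity
is the mean value inequality over solid balls, the monotonicity of the spherical
averages has to be recovered in a weak form. Convolving the inequality with a
radial test function [Phi (enorm z ^+ 2)] and expanding to second order shows
that a subharmonic function has a nonnegative integral against the Laplacian of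
every nonnegative, compactly supported test function ([laplacian_test]).
In the volume coordinate [v = enorm z ^+ n] the Laplacian of a suitable test
function is any prescribed profile [- g v] (up to the factor [2 * n]) that,
together with a nonnegative primitive, is supported in a compact subset of the
interval (0, 1) ([radial_potential_test]). Trapezoidal profiles give the
comparison of the averages over two disjoint annuli ([annulus_mean_le]), hence
the comparison of the radial distribution of the mass of [w] with a uniform one
([mean_ball_radial_le]) and the bound for bounded radial kernels
([radial_average_ge]).

The second ingredient is the inclusion of the ball of centre [x] and radius [r]
in the ball of centre [y] and radius [r + d] when [y] is within [d] of [x].
Comparing the integrals of [c - u] over both, where [c] bounds [u] from above
nearby, yields [u y - u x <= n * d / r * (c - u x) + (solid_mean u r x - u x)]
([subharmonic_gap_le]). With [r = T * d * s] and [c] given by the same problem at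
scale [T * d], a bound [H * kappa (T * d)] at the coarse scale becomes
[n / (s * T) * H * kappa (T * d) + O (kappa d)] at the fine one. The growth
condition provides a [T] for which the first term is at most
[H / 2 * kappa d] ([modulus_growth]), so the constant [H] reproduces itself
([upper_osc_step]), and descending through the scales from one where
boundedness of [u] suffices gives [u y - u x <= H * kappa d] at all small scales
([mean_upper_osc]). Points too close to the boundary for the coarse ball are
handled by the continuity near the boundary ([not_inner_le]). *)

(** * The Euclidean norm *)
Section euclidean_norm.
Context {R : realType} {n : nat}.
Implicit Types x y z : 'rV[R]_n.

Definition dot x y : R := \sum_(i < n) x 0 i * y 0 i.

Lemma sumsq_ge0 x : 0 <= \sum_(i < n) x 0 i ^+ 2.
Proof. by apply: sumr_ge0 => i _; rewrite sqr_ge0. Qed.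

Lemma enorm_ge0 x : 0 <= enorm x.
Proof. exact: sqrtr_ge0. Qed.

Lemma enorm_sqr x : enorm x ^+ 2 = \sum_(i < n) x 0 i ^+ 2.
Proof. by rewrite sqr_sqrtr// sumsq_ge0. Qed.

Lemma enorm0 : enorm (0 : 'rV[R]_n) = 0.
Proof. by rewrite /enorm big1 ?sqrtr0// => i _; rewrite mxE expr0n. Qed.

Lemma enormZ a x : enorm (a *: x) = `|a| * enorm x.
Proof.
rewrite /enorm (eq_bigr (fun i => a ^+ 2 * x 0 i ^+ 2)); last first.
  by move=> i _; rewrite mxE exprMn.
by rewrite -mulr_sumr sqrtrM ?sqr_ge0// sqrtr_sqr.
Qed.

Lemma enormN x : enorm (- x) = enorm x.
Proof. by rewrite -scaleN1r enormZ normrN1 mul1r. Qed.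

Lemma enormB x y : enorm (x - y) = enorm (y - x).
Proof. by rewrite -enormN opprB. Qed.

Lemma enormD_sqr x y :
  enorm (x + y) ^+ 2 = enorm x ^+ 2 + 2 * dot x y + enorm y ^+ 2.
Proof.
rewrite !enorm_sqr /dot mulr_sumr -!big_split/=; apply: eq_bigr => i _.
by rewrite mxE; ring.
Qed.

Lemma dotZl a x y : dot (a *: x) y = a * dot x y.
Proof. by rewrite /dot mulr_sumr; apply: eq_bigr => i _; rewrite mxE mulrA. Qed.

Lemma dotZr a x y : dot x (a *: y) = a * dot x y.
Proof. by rewrite /dot mulr_sumr; apply: eq_bigr => i _; rewrite mxE; ring. Qed.

Lemma le_coord_enorm x i : `|x 0 i| <= enorm x.
Proof.
rewrite -sqrtr_sqr ler_wsqrtr// (bigD1 i)//= lerDl sumr_ge0// => j _.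
exact: sqr_ge0.
Qed.

Lemma enorm_eq0 x : enorm x = 0 -> x = 0.
Proof.
move=> x0; apply/rowP => i; rewrite mxE; apply/eqP; rewrite -normr_le0 -x0.
exact: le_coord_enorm.
Qed.

(** Cauchy-Schwarz, from the square of the norm of the combination
[enorm y *: x - enorm x *: y]. *)
Lemma dot_le x y : dot x y <= enorm x * enorm y.
Proof.
have [/enorm_eq0 ->|x0] := eqVneq (enorm x) 0.
  by rewrite /dot big1 ?mulr_ge0 ?enorm_ge0// => i _; rewrite mxE mul0r.
have [/enorm_eq0 ->|y0] := eqVneq (enorm y) 0.
  by rewrite /dot big1 ?mulr_ge0 ?enorm_ge0// => i _; rewrite mxE mulr0.
have p : 0 < enorm x * enorm y by rewrite mulr_gt0// lt_neqAle eq_sym ?x0 ?y0 enorm_ge0.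
have := sqr_ge0 (enorm (enorm y *: x + (- enorm x) *: y)).
rewrite enormD_sqr !enormZ dotZl dotZr normrN !ger0_norm ?enorm_ge0//.
move=> h; rewrite -(ler_pM2l p).
nra.
Qed.

Lemma enormD x y : enorm (x + y) <= enorm x + enorm y.
Proof.
rewrite -(ler_pXn2r (ltn0Sn 1)) ?nnegrE ?addr_ge0 ?enorm_ge0//.
rewrite enormD_sqr; have := dot_le x y; nra.
Qed.

Lemma enorm_dist x y z : enorm (x - z) <= enorm (x - y) + enorm (y - z).
Proof. by rewrite (le_trans _ (enormD _ _))// addrA subrK. Qed.

Lemma dot_abs_le x y : `|dot x y| <= enorm x * enorm y.
Proof.
rewrite ler_norml dot_le andbT lerNl -mulN1r -dotZl scaleN1r.
by rewrite (le_trans (dot_le _ _))// enormN.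
Qed.

Lemma continuous_enorm_sub y : continuous (fun x : 'rV[R]_n => enorm (x - y)).
Proof.
move=> x; rewrite /enorm.
apply: (@continuous_comp _ _ _ (fun x : 'rV[R]_n => \sum_(i < n) (x - y) 0 i ^+ 2) (@Num.sqrt R)); last exact: sqrt_continuous.
apply: continuous_big => [|i _ {}x]; first exact: add_continuous.
under eq_fun do rewrite !mxE.
apply: (@continuous_comp _ _ _ (fun x : 'rV[R]_n => x 0 i - y 0 i) (fun t : R => t ^+ 2)); last exact: exprn_continuous.
by apply: continuousB; [exact: (@coord_continuous R 1 n 0 i x)|exact: cst_continuous].
Qed.

Lemma continuous_enorm : continuous (@enorm R n).
Proof.
have := @continuous_enorm_sub 0.
by under eq_fun do rewrite subr0.
Qed.

Lemma open_eball x r : open (eball x r).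
Proof.
rewrite (_ : eball x r = (fun y => enorm (y - x)) @^-1` [set t | t < r])//.
apply: open_comp; last exact: open_lt.
by move=> y _; exact: continuous_enorm_sub.
Qed.

End euclidean_norm.

Section measurable_rV.
Context {R : realType} {n : nat}.
Implicit Types x y z : 'rV[R]_n.

Lemma measurable_eball x r : measurable (eball x r).
Proof. apply: open_measurable_rV; exact: open_eball. Qed.

Lemma measurable_affine y (a : R) : measurable_fun setT (fun x => y + a *: x).
Proof.
apply: measurable_fun_rV => j; under eq_fun do rewrite !mxE.
apply: measurable_funD; first exact: measurable_cst.
apply: measurable_funM; first exact: measurable_cst.
exact: measurable_coord_rV.
Qed.

Lemma measurable_continuous_rV (f : 'rV[R]_n -> R) : continuous f ->
  measurable_fun setT f.
Proof.
move=> cf; apply: (measurability (@RGenOpens.G R)); first exact: RGenOpens.measurableE.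
move=> _ [_ [a [b ->]] <-]; rewrite setTI; apply: open_measurable_rV.
by apply: open_comp; [move=> x _; exact: cf|exact: interval_open].
Qed.

Lemma measurable_enorm : measurable_fun setT (@enorm R n).
Proof. by apply: measurable_continuous_rV; exact: continuous_enorm. Qed.

End measurable_rV.

(** * Lebesgue measure: uniqueness and changes of variables *)
Section lebesgue_rV_invariance.
Context {R : realType} {n : nat}.
Implicit Types (x y : 'rV[R]_n) (a b : 'I_n -> R).

Definition obox a b : set 'rV[R]_n :=
  [set x | forall i, `]a i, b i[%classic (x 0 i)].

Lemma lebesgue_rV_obox a b :
  lebesgue_rV n (obox a b) = (\prod_(i < n) lebesgue_measure `]a i, b i[%classic)%E.
Proof. by rewrite -lebesgue_rV_prod. Qed.

Lemma open_obox a b : open (obox a b).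
Proof.
rewrite openE => x Hx; have H i : nbhs x [set y : 'rV[R]_n | `]a i, b i[%classic (y 0 i)].
  have /(_ x) := @coord_continuous R 1 n 0 i; apply.
  exact: (open_nbhs_nbhs (conj (interval_open _ _) (Hx i))).
exact: (@filter_forall _ _ _ (nbhs x) (nbhs_filter x) H).
Qed.

Lemma measurable_obox :
  @measurable _ 'rV[R]_n = <<s [set B | exists a b, B = obox a b] >>.
Proof.
rewrite eqEsubset; split; last first.
  apply: smallest_sub; first exact: sigma_algebra_measurable.
  by move=> _ [a [b ->]]; apply: open_measurable_rV; exact: open_obox.
apply: smallest_sub; first exact: smallest_sigma_algebra.
move=> U oU; rewrite (open_rat_box oU) bigcup_mkcond.
pose GT := g_sigma_algebraType [set B | exists a b, B = obox a b].
suff: @measurable _ GT (\bigcup_c if c \in [set c | rat_box c `<=` U] then rat_box c else set0) by [].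
apply: countable_bigcupT_measurable => [|c]; first exact: countableP.
case: ifPn => // _; apply: sub_sigma_algebra.
exists (fun i => ratr (c.1 0 i) - c.2.+1%:R^-1), (fun i => ratr (c.1 0 i) + c.2.+1%:R^-1).
by apply/seteqP; split => x /= H i; have := H i; rewrite /= in_itv/= ltr_distl.
Qed.

(** Open boxes form a pi-system that generates the Borel sets and exhausts the
space by sets of finite measure. *)
Lemma lebesgue_rV_unique (m : {measure set 'rV[R]_n -> \bar R}) :
  (forall a b, m (obox a b) = lebesgue_rV n (obox a b)) ->
  forall A, measurable A -> m A = lebesgue_rV n A.
Proof.
move=> mE A mA; symmetry.
apply: (measure_unique [set B | exists a b, B = obox a b]
  (fun k => obox (fun=> - k%:R) (fun=> k%:R))) => //.
- exact: measurable_obox.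
- move=> _ _ [a [b ->]] [a' [b' ->]].
  exists (fun i => Order.max (a i) (a' i)), (fun i => Order.min (b i) (b' i)).
  apply/seteqP; split => x /=.
    move=> [H H'] i; have := H i; have := H' i; rewrite /= !in_itv/= gt_max lt_min.
    by move=> /andP[-> ->] /andP[-> ->].
  by move=> H; split => i; have := H i; rewrite /= !in_itv/= gt_max lt_min => /andP[/andP[? ?] /andP[? ?]]; apply/andP.
- by move=> k; exists (fun=> - k%:R), (fun=> k%:R).
- rewrite -subTset => x _; exists (Num.truncn (enorm x)).+1 => // i /=.
  by rewrite in_itv/= -ltr_norml (le_lt_trans (le_coord_enorm _ _))// truncnS_gt.
- by move=> _ [a [b ->]].
- move=> k; rewrite lebesgue_rV_obox; under eq_bigr do rewrite lebesgue_measure_itv/=.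
  rewrite ltey_eq; apply/orP; left; elim/big_ind : _ => //= [r s|i _].
    exact: fin_numM.
  by case: ifP.
Qed.

End lebesgue_rV_invariance.

Section lebesgue_rV_change_of_variables.
Context {R : realType} {n : nat}.
Implicit Types (x y : 'rV[R]_n) (a b : 'I_n -> R).
Local Notation lam := (@lebesgue_rV R n).

Section transfer.
Variables (phi : 'rV[R]_n -> 'rV[R]_n) (k : {nonneg R}).
Hypothesis mphi : measurable_fun setT phi.
Hypothesis phiE : forall a b,
  (k%:num%:E * lam (phi @^-1` obox a b) = lam (obox a b))%E.

(** A change of variables with constant Jacobian only has to be checked on
boxes. The measure [m1] is a name for the pushforward that hides its dependence
on the measurability proof. *)
Lemma lebesgue_rV_transfer A : measurable A ->
  (k%:num%:E * lam (phi @^-1` A) = lam A)%E.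
Proof.
move=> mA.
have [m1 m1E] : exists m1 : {measure set 'rV[R]_n -> \bar R},
  m1 = pushforward lam phi :> (_ -> _)
  by pose m0 : {measure set 'rV[R]_n -> \bar R} := pushforward lam phi; exists (m0 mphi).
by rewrite -[lam (_ @^-1` _)]/(pushforward lam phi A) -m1E -[LHS]/(mscale k m1 A);
  apply: lebesgue_rV_unique => // a b; rewrite -phiE -[RHS]/(_ * pushforward lam phi (obox a b))%E -m1E.
Qed.

Lemma ge0_integral_transfer (f : 'rV[R]_n -> \bar R) D : measurable D ->
  measurable_fun D f -> (forall x, D x -> 0 <= f x)%E ->
  (\int[lam]_(x in D) f x = k%:num%:E * \int[lam]_(x in phi @^-1` D) f (phi x))%E.
Proof.
move=> mD mf f0.
have [m1 m1E] : exists m1 : {measure set 'rV[R]_n -> \bar R},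
  m1 = pushforward lam phi :> (_ -> _)
  by pose m0 : {measure set 'rV[R]_n -> \bar R} := pushforward lam phi; exists (m0 mphi).
rewrite -(@ge0_integral_pushforward _ _ _ _ _ _ mphi lam D f)//; last first.
  by move=> x; rewrite inE; exact: f0.
rewrite -m1E -(@ge0_integral_mscale _ _ _ m1)//.
by apply: eq_measure_integral => A mA _; symmetry; apply: lebesgue_rV_unique => // a b; rewrite -phiE -[RHS]/(_ * pushforward lam phi (obox a b))%E -m1E.
Qed.

End transfer.

Lemma prod_lebesgue_itv (k : R) (m : 'I_n -> 'I_n) a b a' b' : 0 <= k ->
  bijective m ->
  (forall i, Order.max 0 (b (m i) - a (m i)) = k * Order.max 0 (b' i - a' i)) ->
  lam (obox a b) = ((k ^+ n)%:E * lam (obox a' b'))%E.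
Proof.
move=> k0 bm ab; rewrite !lebesgue_rV_obox.
have E (c d : R) : lebesgue_measure `]c, d[%classic = (Order.max 0 (d - c))%:E.
  rewrite lebesgue_measure_itv/= lte_fin -EFinB.
  case: ltP => cd; last by rewrite max_l// subr_le0.
  by rewrite max_r// subr_ge0 ltW.
under eq_bigr do rewrite E; under [in RHS]eq_bigr do rewrite E.
rewrite !prodEFin -EFinM; congr (_%:E).
rewrite (reindex m)/=; last exact: onW_bij.
under eq_bigr do rewrite ab.
by rewrite big_split/= prodr_const card_ord.
Qed.

Lemma obox_affine y (d : R) a b : 0 < d ->
  ((d ^+ n)%:E * lam ((fun x => y + d *: x)%R @^-1` obox a b) = lam (obox a b))%E.
Proof.
move=> d0; pose f (c : R) i := (c - y 0 i) / d.
rewrite (_ : _ @^-1` _ = obox (fun i => f (a i) i) (fun i => f (b i) i)).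
  symmetry; apply: (@prod_lebesgue_itv d id); [exact: ltW|by exists id|] => i /=.
  rewrite maxr_pMr ?ltW// mulr0 /f; congr Order.max; field.
  by rewrite gt_eqF.
apply/seteqP; split => x /= H i; have := H i; rewrite /= !in_itv/= !mxE /f.
  by rewrite ltr_pdivrMr// ltr_pdivlMr// ltrBlDl ltrBrDl [x 0 i * d]mulrC.
by rewrite ltr_pdivrMr// ltr_pdivlMr// ltrBlDl ltrBrDl [x 0 i * d]mulrC.
Qed.

Lemma lebesgue_rV_affine y (d : R) A : 0 < d -> measurable A ->
  lam A = ((d ^+ n)%:E * lam [set x | A (y + d *: x)%R])%E.
Proof.
move=> d0 mA; have dn0 : 0 <= d ^+ n by rewrite exprn_ge0// ltW.
rewrite -(@lebesgue_rV_transfer (fun x => y + d *: x) (NngNum dn0))//.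
  exact: measurable_affine.
by move=> a b; exact: obox_affine.
Qed.

Lemma ge0_integral_affine y (d : R) (f : 'rV[R]_n -> \bar R) D : 0 < d ->
  measurable D -> measurable_fun D f -> (forall x, D x -> 0 <= f x)%E ->
  (\int[lam]_(x in D) f x =
   (d ^+ n)%:E * \int[lam]_(x in [set x | D (y + d *: x)%R]) f (y + d *: x)%R)%E.
Proof.
move=> d0 mD mf f0; have dn0 : 0 <= d ^+ n by rewrite exprn_ge0// ltW.
rewrite (@ge0_integral_transfer (fun x => y + d *: x) (NngNum dn0))//.
  exact: measurable_affine.
by move=> a b; exact: obox_affine.
Qed.

(** Sign changes of one coordinate and exchanges of two coordinates are the only
isometries needed: they already determine the first and second moments of the
ball. *)
Definition flip (i : 'I_n) x : 'rV[R]_n := \row_j (if j == i then - x 0 j else x 0 j).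

Definition swap (i k : 'I_n) x : 'rV[R]_n := \row_j x 0 (tperm i k j).

Lemma enorm_flip i x : enorm (flip i x) = enorm x.
Proof.
congr Num.sqrt; apply: eq_bigr => j _; rewrite mxE.
by case: ifP => // _; rewrite sqrrN.
Qed.

Lemma enorm_swap i k x : enorm (swap i k x) = enorm x.
Proof.
rewrite /enorm [in RHS](reindex (tperm i k))/=; last first.
  by apply: onW_bij; exists (tperm i k); exact: tpermK.
by congr Num.sqrt; apply: eq_bigr => j _; rewrite mxE.
Qed.

Lemma ge0_integral_flip i (f : 'rV[R]_n -> \bar R) D :
  measurable D -> measurable_fun D f -> (forall x, D x -> 0 <= f x)%E ->
  (\int[lam]_(x in D) f x = \int[lam]_(x in flip i @^-1` D) f (flip i x))%E.
Proof.
move=> mD mf f0.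
rewrite (@ge0_integral_transfer (flip i) (NngNum (@ler01 R)))//= ?mul1e//.
  apply: measurable_fun_rV => j; under eq_fun do rewrite mxE.
  case: (j == i); last exact: measurable_coord_rV.
  by apply: measurable_funN; exact: measurable_coord_rV.
move=> a b; rewrite mul1e; symmetry.
rewrite (_ : _ @^-1` _ = obox (fun j => if j == i then - b j else a j)
    (fun j => if j == i then - a j else b j)).
  rewrite -[RHS]mul1e -[in RHS](expr1n _ n); apply: (@prod_lebesgue_itv _ id) => [//||j]; first by exists id.
  by rewrite mul1r; case: ifP => // _; rewrite opprK addrC.
apply/seteqP; split => x /= H j; have := H j; rewrite /= !in_itv/= !mxE.
  by case: ifP => // _; rewrite ltrNl ltrNr andbC.
by case: ifP => // _; rewrite ltrNl ltrNr andbC.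
Qed.

Lemma ge0_integral_swap i k (f : 'rV[R]_n -> \bar R) D :
  measurable D -> measurable_fun D f -> (forall x, D x -> 0 <= f x)%E ->
  (\int[lam]_(x in D) f x = \int[lam]_(x in swap i k @^-1` D) f (swap i k x))%E.
Proof.
move=> mD mf f0.
rewrite (@ge0_integral_transfer (swap i k) (NngNum (@ler01 R)))//= ?mul1e//.
  apply: measurable_fun_rV => j; under eq_fun do rewrite mxE.
  exact: measurable_coord_rV.
move=> a b; rewrite mul1e; symmetry.
rewrite (_ : _ @^-1` _ = obox (a \o tperm i k) (b \o tperm i k)).
  rewrite -[RHS]mul1e -[in RHS](expr1n _ n); apply: (@prod_lebesgue_itv _ (tperm i k)) => [//||j].
    by exists (tperm i k); exact: tpermK.
  by rewrite mul1r.
apply/seteqP; split => x /= H j; have := H (tperm i k j); rewrite /= !mxE ?tpermK //.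
Qed.

(** An alias on which the sigma-finite structure is declared, so that Tonelli's
theorem applies. *)
Definition lebesgue_rV_sfin : set 'rV[R]_n -> \bar R := lam.
HB.instance Definition _ := Measure.on lebesgue_rV_sfin.

Lemma lebesgue_rV_obox_lty a b : (lam (obox a b) < +oo)%E.
Proof.
rewrite lebesgue_rV_obox; under eq_bigr do rewrite lebesgue_measure_itv/=.
rewrite ltey_eq; apply/orP; left; elim/big_ind : _ => //= [r s|i _].
  exact: fin_numM.
by case: ifP.
Qed.

Lemma lebesgue_rV_sfin_sigma_finite : sigma_finite setT lebesgue_rV_sfin.
Proof.
exists (fun k : nat => obox (fun=> - k%:R) (fun=> k%:R)).
  symmetry; rewrite -subTset => x _; exists (Num.truncn (enorm x)).+1 => // i /=.
  by rewrite in_itv/= -ltr_norml (le_lt_trans (le_coord_enorm _ _))// truncnS_gt.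
move=> k; split; first by apply: open_measurable_rV; exact: open_obox.
exact: lebesgue_rV_obox_lty.
Qed.

HB.instance Definition _ := Measure_isSigmaFinite.Build _ _ _ lebesgue_rV_sfin lebesgue_rV_sfin_sigma_finite.

Lemma lebesgue_eball_lty y r : (lam (eball y r) < +oo)%E.
Proof.
apply: le_lt_trans (lebesgue_rV_obox_lty (fun i => y 0 i - r) (fun i => y 0 i + r)).
apply: le_measure; rewrite ?inE.
- exact: measurable_eball.
- by apply: open_measurable_rV; exact: open_obox.
- move=> x xr i /=; rewrite in_itv/= -ltr_distl.
  by have := le_lt_trans (le_coord_enorm (x - y) i) xr; rewrite !mxE.
Qed.

Definition omega : R := fine (lam (eball 0 1)).

Lemma omegaE : lam (eball 0 1) = omega%:E.
Proof. by rewrite fineK// ge0_fin_numE// lebesgue_eball_lty. Qed.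

Lemma lebesgue_eball y r : 0 < r -> lam (eball y r) = (omega * r ^+ n)%:E.
Proof.
move=> r0; rewrite (@lebesgue_rV_affine y r)//; last exact: measurable_eball.
rewrite mulrC EFinM -omegaE; congr (_ * lam _)%E.
apply/seteqP; split => x /=; rewrite /eball/= [y + _]addrC addrK subr0 enormZ gtr0_norm//.
  by rewrite gtr_pMr.
by rewrite gtr_pMr.
Qed.

(** The ball contains the open cube of side [1 / n] with a corner at the
origin. *)
Lemma omega_gt0 : (0 < n)%N -> 0 < omega.
Proof.
move=> n0; pose e : R := (n%:R)^-1.
have e0 : 0 < e by rewrite invr_gt0 ltr0n.
rewrite -lte_fin -omegaE.
apply: (@lt_le_trans _ _ (lam (obox (fun=> 0) (fun=> e)))).
  rewrite lebesgue_rV_obox; under eq_bigr do rewrite lebesgue_measure_itv/= lte_fin e0 sube0.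
  by rewrite prodEFin lte_fin prodr_gt0.
apply: le_measure; rewrite ?inE.
- by apply: open_measurable_rV; exact: open_obox.
- exact: measurable_eball.
move=> x H; rewrite /eball/= subr0 -[ltRHS]sqrtr1 ltr_sqrt//.
have E : 1 = \sum_(i < n) e by rewrite sumr_const card_ord -mulr_natr mulVf// pnatr_eq0 -lt0n.
rewrite E; apply: ltr_sum => [|i _]; first by apply/hasP; exists (Ordinal n0); rewrite ?mem_index_enum.
have := H i; rewrite /= in_itv/= => /andP[x0 xe].
have e1 : e <= 1 by rewrite invf_le1 ?ltr0n// ler1n.
rewrite expr2; nra.
Qed.

End lebesgue_rV_change_of_variables.

(** * One-variable calculus *)
Section calculus.
Context {R : realType}.
Implicit Types (f g df : R -> R) (a b t h x y d e c k : R).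

Lemma scaleRE (a b : R) : a *: (b : R^o) = a * b.
Proof. by []. Qed.

Lemma is_derive_continuous f x d : is_derive x 1 f d -> {for x, continuous f}.
Proof. by move=> [df _]; apply/differentiable_continuous/derivable1_diffP. Qed.

Lemma continuous_primitive f a b : a < b -> continuous f ->
  exists F : R -> R, forall x, a < x < b -> is_derive x 1 F (f x).
Proof.
move=> ab cf; exists (fun x => \int[lebesgue_measure]_(t in [set` `[a, x]]) (f t)) => x /andP[ax xb].
have [] := @continuous_FTC1_closed R f a x b xb _ ax (cf x).
  apply: continuous_compact_integrable; first exact: segment_compact.
  by apply: continuous_subspaceT => y; exact: cf.
by move=> dF FE; split; [exact: dF|rewrite -derive1E; exact: FE].
Qed.

Lemma mvt_open f df a b x y : (forall z, a < z < b -> is_derive z 1 f (df z)) ->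
  a < x < b -> a < y < b ->
  exists2 c, Order.min x y <= c <= Order.max x y & f y - f x = df c * (y - x).
Proof.
move=> fdf xab yab.
have H u v : a < u < b -> a < v < b -> u <= v ->
    exists2 c, u <= c <= v & f v - f u = df c * (v - u).
  move=> /andP[au ub] /andP[av vb] uv.
  have [||c] := @MVT_segment R f df u v uv.
  - move=> z; rewrite in_itv/= => /andP[uz zv]; apply: fdf.
    by rewrite (lt_trans au uz) (lt_trans zv vb).
  - apply: derivable_within_continuous => z; rewrite in_itv/= => /andP[uz zv].
    apply: ex_derive; apply: fdf.
    by rewrite (lt_le_trans au uz) (le_lt_trans zv vb).
  - by rewrite in_itv/= => cuv E; exists c.
have [xy|yx] := leP x y; first exact: H.
have [c cxy E] := H y x yab xab (ltW yx).
by exists c => //; rewrite -opprB E; ring.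
Qed.

(** The error is measured by the oscillation of the second derivative around the
base point, which uniform continuity makes small. *)
Lemma taylor2 (Phi Phi1 Phi2 : R -> R) a b t h e :
  (forall z, a < z < b -> is_derive z 1 Phi (Phi1 z)) ->
  (forall z, a < z < b -> is_derive z 1 Phi1 (Phi2 z)) ->
  a < t < b -> a < t + h < b ->
  (forall k, `|k| <= `|h| -> `|Phi2 (t + k) - Phi2 t| <= e) ->
  `|Phi (t + h) - Phi t - Phi1 t * h - 2^-1 * Phi2 t * h ^+ 2| <= e * h ^+ 2.
Proof.
move=> d1 d2 tab thab H.
have bet (x y c : R) : Order.min x y <= c <= Order.max x y ->
   a < x < b -> a < y < b -> a < c < b.
  move=> /andP[c1 c2] /andP[ax xb] /andP[ay yb].
  rewrite (lt_le_trans _ c1) ?lt_min ?ax// (le_lt_trans c2)// gt_max.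
  by rewrite xb.
have betk (c k : R) : Order.min 0 k <= c <= Order.max 0 k -> `|c| <= `|k|.
  by case: (leP 0 k) => k0 /andP[c1 c2]; [rewrite !ger0_norm|rewrite !ler0_norm ?lerN2// ltW].
pose g k := Phi (t + k) - Phi t - Phi1 t * k - 2^-1 * Phi2 t * k ^+ 2.
pose dg k := Phi1 (t + k) - Phi1 t - Phi2 t * k.
have addd f d k0 : is_derive (t + k0) 1 f d -> is_derive k0 1 (fun k => f (t + k)) d.
  move=> fd; have E : d = d * 1 by rewrite mulr1.
  rewrite E; apply: (@is_derive1_comp _ f (fun k => t + k)).
  rewrite -[X in is_derive _ _ _ X]add0r; exact: (@is_deriveD _ _ _ (cst t) id).
have gdg k : a - t < k < b - t -> is_derive k 1 g (dg k).
  move=> kab; have tk : a < t + k < b by lra.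
  have := addd _ _ _ (d1 _ tk) => D.
  rewrite /g /dg.
  apply: is_derive_eq.
  by rewrite !scaleRE; field.
have h0 : a - t < 0 < b - t by lra.
have hh : a - t < h < b - t by lra.
have [c c0h E] := mvt_open gdg h0 hh.
have -> : Phi (t + h) - Phi t - Phi1 t * h - 2^-1 * Phi2 t * h ^+ 2 = g h - g 0.
  by rewrite /g addr0 expr0n/=; ring.
have ch := betk _ _ c0h.
have tcab : a < t + c < b.
  have [/andP[c1 c2]] := (c0h); case: (leP 0 h) c1 c2 => ?; lra.
have [c' cc E'] := mvt_open d2 tab tcab.
rewrite E subr0 /dg E' normrM.
have -> : Phi2 c' * (t + c - t) - Phi2 t * c = (Phi2 (t + (c' - t)) - Phi2 t) * c.
  by rewrite addrCA subrr addr0; ring.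
have c'c : `|c' - t| <= `|c|.
  apply: betk; move: cc; have [c0|c0] := leP 0 c.
    by rewrite min_l ?max_r ?lerDl//; lra.
  by rewrite min_r ?max_l ?gerDl; try lra.
have e1 := H _ (le_trans c'c ch).
have e0 : 0 <= e by exact: le_trans e1.
have -> : h ^+ 2 = `|h| * `|h| by rewrite -normrM -expr2 ger0_norm ?sqr_ge0.
rewrite normrM mulrA.
by rewrite ler_wpM2r// ler_pM.
Qed.

(** The increment [t + k] may leave the interval: only the base point is confined
to the compact set. *)
Lemma continuous_uniform_itv f a b e : 0 < e -> continuous f ->
  exists2 d, 0 < d & forall t k, a <= t <= b -> `|k| <= d -> `|f (t + k) - f t| <= e.
Proof.
move=> e0 cf.
have cpt : compact `[a, b]%classic by exact: segment_compact.
move/compact_near_coveringP : cpt.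
move=> /(_ R (0^'+) (fun d t => forall k, `|k| <= d -> `|f (t + k) - f t| <= e)).
move=> /(_ _)[x xab|d0 /= d00 H].
- have e20 : 0 < e / 2 by rewrite divr_gt0.
  have /cvgrPdist_lt/(_ _ e20)/nbhs_ballP[r /= r0 rH] := cf x.
  exists (ball x (r / 2), [set d | d < r / 2]) => /=.
    split; first by apply: nbhsx_ballx; rewrite divr_gt0.
    by apply: nbhs_right_lt; rewrite divr_gt0.
  move=> [y d]/= [xy dr] k kd.
  have H1 : `|f x - f y| < e / 2.
    by apply: rH; apply: le_ball xy; rewrite ler_pdivrMr// ler_pMr// ler1n.
  have H2 : `|f x - f (y + k)| < e / 2.
    apply: rH; rewrite /ball/= opprD addrA (le_lt_trans (ler_normB _ _))//.
    rewrite [ltRHS]splitr ltrD//.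
    exact: le_lt_trans dr.
  rewrite ltW// distrC -(subrK (f x) (f y)) -addrA (le_lt_trans (ler_normD _ _))//.
  by rewrite [ltRHS]splitr ltrD// distrC.
- have d20 : 0 < d0 / 2 by rewrite divr_gt0.
  exists (d0 / 2) => // t k tab; apply: (H (d0 / 2)) => //=.
  by rewrite sub0r normrN gtr0_norm// ltr_pdivrMr// ltr_pMr// ltr1n.
Qed.

Lemma mvt f df x y : (forall z : R, is_derive z 1 f (df z)) ->
  exists2 c, Order.min x y <= c <= Order.max x y & f y - f x = df c * (y - x).
Proof.
move=> fdf; apply: (@mvt_open f df (Order.min x y - 1) (Order.max x y + 1)).
- by have [] := leP x y; lra.
- by have [] := leP x y; lra.
Qed.

(** Primitives on larger and larger intervals agree, once normalised at 0. *)
Lemma continuous_antiderivative f : continuous f ->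
  exists F : R -> R, forall x : R, is_derive x 1 F (f x).
Proof.
move=> cf.
have /choice[F FP] (N : nat) : exists F : R -> R, F 0 = 0 /\
    forall x, - N.+1%:R < x < N.+1%:R -> is_derive x 1 F (f x).
  have [|F HF] := @continuous_primitive f (- N.+1%:R) N.+1%:R _ cf.
    by rewrite gtrN// ltr0n.
  exists (fun x => F x - F 0); split; first by rewrite subrr.
  move=> x /HF dF; rewrite -[X in is_derive _ _ _ X]subr0.
  exact: (@is_deriveB _ _ _ F (cst (F 0))).
have FE N M x : (N <= M)%N -> - N.+1%:R < x < N.+1%:R -> F N x = F M x.
  move=> NM xN; have NM' : N.+1%:R <= M.+1%:R :> R by rewrite ler_nat ltnS.
  have N0 : 0 < N.+1%:R :> R by rewrite ltr0n.
  have /= := @mvt_open (F N \- F M) (cst 0) (- N.+1%:R) N.+1%:R 0 x.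
  case=> [z zN|||c _ /eqP].
  - rewrite -[X in is_derive _ _ _ X](subrr (f z)).
    apply: is_deriveB; first exact: (FP N).2.
    by apply: (FP M).2; lra.
  - by lra.
  - by [].
  by rewrite (FP N).1 (FP M).1 !subr0 mul0r subr_eq0 => /eqP.
pose N x := (Num.truncn `|x|).+1.
exists (fun x => F (N x) x) => x.
have H y : `|y - x| < 1 -> F (N y) y = F (N x).+1 y.
  move=> yx; apply: FE.
    rewrite /N ltnS -ltnS -(ltr_nat R).
    rewrite (@le_lt_trans _ _ `|y|) ?truncn_le//.
    rewrite (@lt_trans _ _ (`|x| + 1))//.
      rewrite -ltrBlDl; exact: le_lt_trans (lerB_dist _ _) yx.
    by rewrite -[_.+2%:R]natr1 ltrD2r truncnS_gt.
  rewrite -ltr_norml (lt_trans (truncnS_gt _))// ltr_nat.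
  by [].
apply: (@near_eq_is_derive _ _ _ (F (N x).+1)).
  exists 1 => //= y; rewrite /ball/= distrC => /H ->.
  by [].
apply: (FP (N x).+1).2; rewrite -ltr_norml (lt_trans (truncnS_gt _))// ltr_nat.
by rewrite /N ltnS.
Qed.

Lemma continuous_bounded_itv f a b : continuous f ->
  exists2 K : R, 0 <= K & forall t, a <= t <= b -> `|f t| <= K.
Proof.
move=> cf; have [ab|ba] := leP a b; last first.
  by exists 0 => // t /andP[at_ tb]; have := le_trans at_ tb; rewrite leNgt ba.
have [|c _ H] := @EVT_max R (fun t => `|f t|) a b ab.
  apply: continuous_subspaceT => x.
  by apply: continuous_comp; [exact: cf|exact: norm_continuous].
by exists `|f c| => // t tab; apply: H; rewrite in_itv.
Qed.

End calculus.

(** * Functions with the sub-mean-value property on the unit ball *)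
Section bounded_integrals.
Context {R : realType} {n : nat}.
Local Notation lam := (@lebesgue_rV R n).
Local Notation B := (@eball R n 0 1).
Implicit Types (f g : 'rV[R]_n -> R).

Lemma bounded_integrable f (D : set 'rV[R]_n) K : measurable D ->
  (lam D < +oo)%E -> measurable_fun D f -> (forall x, D x -> `|f x| <= K) ->
  lam.-integrable D (EFin \o f).
Proof.
move=> mD Dfin mf fK; apply: measurable_bounded_integrable => //.
exists K; split; first exact: num_real.
by move=> k Kk x Dx; exact: le_trans (fK _ Dx) (ltW Kk).
Qed.

Lemma integrable_ball f K : measurable_fun setT f -> (forall x, B x -> `|f x| <= K) ->
  lam.-integrable B (EFin \o f).
Proof.
move=> mf fK; apply: bounded_integrable fK => //.
- exact: measurable_eball.
- exact: lebesgue_eball_lty.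
- exact: measurable_funTS.
Qed.

Lemma RintegralE f (D : set 'rV[R]_n) : measurable D -> lam.-integrable D (EFin \o f) ->
  (\int[lam]_(x in D) (f x)%:E)%E = (\int[lam]_(x in D) f x)%:E.
Proof. by move=> mD fi; rewrite fineK//; exact: integrable_fin_num. Qed.

End bounded_integrals.

Section submean.
Context {R : realType} {n : nat}.
Local Notation lam := (@lebesgue_rV R n).
Local Notation B := (@eball R n 0 1).
Local Notation omega := (@omega R n).
Implicit Types (psi b w : 'rV[R]_n -> R).

(** A subharmonic function on the unit ball made nonnegative by adding a constant
and extended by zero outside: Tonelli's theorem applies, and shifted arguments
may leave the ball. *)
Definition submean_ball w (C : R) := [/\ measurable_fun setT w,
  forall x, 0 <= w x <= C,
  forall x, 1 <= enorm x -> w x = 0 &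
  forall y (s : R), 0 < s -> enorm y + s <= 1 ->
    ((w y * omega)%:E <= \int[lam]_(x in B) (w (y + s *: x))%:E)%E].

(** Integrate the inequality at [y] against the weight [psi y] and exchange the
order of integration: translating by [s *: x] moves the shift from [w] to [psi].
The support condition keeps every ball that is used inside the unit ball. *)
Lemma submean_convolution w C psi (K s : R) b (Kb : R) : submean_ball w C ->
  measurable_fun setT psi -> (forall x, 0 <= psi x <= K) -> 0 < s ->
  (forall x, 1 - s < enorm x -> psi x = 0) ->
  measurable_fun setT b -> (forall x, B x -> `|b x| <= Kb) ->
  (forall z, B z -> \int[lam]_(x in B) psi (z - s *: x) <= b z) ->
  omega * \int[lam]_(z in B) (w z * psi z) <= \int[lam]_(z in B) (w z * b z).
Proof.
move=> [mw wC wout wsub] mpsi psiK s0 psiout mb bK psib.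
have C0 : 0 <= C by have /andP[/le_trans] := wC 0; apply.
have K0 : 0 <= K by have /andP[/le_trans] := psiK 0; apply.
have mB : measurable B by exact: measurable_eball.
have om0 : 0 <= omega by rewrite fine_ge0.
have w0 x : 0 <= w x by have /andP[] := wC x.
have psi0 x : 0 <= psi x by have /andP[] := psiK x.
have msh (c : R) : measurable_fun setT (fun p : 'rV[R]_n * 'rV[R]_n => p.1 + c *: p.2).
  apply: measurable_fun_rV => j; under eq_fun do rewrite !mxE.
  apply: measurable_funD; first by apply: measurableT_comp (measurable_coord_rV j) _.
  apply: measurable_funM; first exact: measurable_cst.
  by apply: measurableT_comp (measurable_coord_rV j) _.
have mind : measurable_fun setT (fun p : 'rV[R]_n * 'rV[R]_n => \1_B p.2 : R).
  by apply: measurableT_comp => //; exact: measurable_indic.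
pose F (p : 'rV[R]_n * 'rV[R]_n) : \bar R := (w (p.1 + s *: p.2) * psi p.1 * \1_B p.2)%:E.
pose G (p : 'rV[R]_n * 'rV[R]_n) : \bar R := (w p.1 * psi (p.1 - s *: p.2) * \1_B p.2)%:E.
have mF : measurable_fun setT F.
  apply/measurable_EFinP; apply: measurable_funM => //; apply: measurable_funM.
    by apply: (measurableT_comp mw); exact: msh.
  by apply: (measurableT_comp mpsi).
have mG : measurable_fun setT G.
  apply/measurable_EFinP; apply: measurable_funM => //; apply: measurable_funM.
    by apply: (measurableT_comp mw).
  by apply: (measurableT_comp mpsi); under eq_fun do rewrite -scaleNr; exact: msh.
have F0 p : (0 <= F p)%E by rewrite lee_fin !mulr_ge0// indicE.
have G0 p : (0 <= G p)%E by rewrite lee_fin !mulr_ge0// indicE.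
have indE (f : 'rV[R]_n -> R) : (\int[lam]_x (f x * \1_B x)%:E = \int[lam]_(x in B) (f x)%:E)%E.
  rewrite [RHS]integral_mkcond; apply: eq_integral => x _.
  by rewrite patchE indicE; case: ifP => _; rewrite ?mulr1 ?mulr0.
pose lS : {sigma_finite_measure set 'rV[R]_n -> \bar R} := @lebesgue_rV_sfin R n.
have tF := @fubini_tonelli _ _ _ _ _ lS lS F mF F0.
have tG := @fubini_tonelli _ _ _ _ _ lS lS G mG G0.
(* translation by [- s *: xi] in the inner integral *)
have FG : (\int[lS]_y \int[lS]_x F (x, y) = \int[lS]_y \int[lS]_x G (x, y))%E.
  apply: eq_integral => xi _.
  change (\int[lam]_x F (x, xi) = \int[lam]_x G (x, xi))%E.
  have mFxi : measurable_fun setT (fun x => F (x, xi)) by exact: (measurableT_comp mF).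
  have aff (f : 'rV[R]_n -> \bar R) : measurable_fun setT f -> (forall x, 0 <= f x)%E ->
     (\int[lam]_x f x = \int[lam]_x f ((- s *: xi) + 1 *: x)%R)%E.
    move=> mf f0; have := @ge0_integral_affine R n (- s *: xi) 1 f setT ltr01 measurableT mf.
    by rewrite expr1n mul1e; apply.
  have e1 := aff _ mFxi (fun x => F0 (x, xi)).
  apply: (etrans e1).
  apply: eq_integral => z _ /=.
  by rewrite /F /G/= scale1r scaleNr [_ + z]addrC subrK.
have wB z : ~ B z -> w z = 0.
  by move=> /negP; rewrite /eball/= subr0 -leNgt => /wout.
have pt1 y : ((w y * psi y * omega)%:E <= \int[lam]_x F (y, x))%E.
  have [ys|ys] := leP (enorm y + s) 1; last first.
    have p0 : psi y = 0 by apply: psiout; rewrite ltrBlDr.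
    by rewrite p0 mulr0 mul0r; apply: integral_ge0 => x _; exact: F0.
  have -> : (\int[lam]_x F (y, x) = \int[lam]_(x in B) ((psi y)%:E * (w (y + s *: x))%:E))%E.
    rewrite (indE (fun x => w (y + s *: x) * psi y)).
    by apply: eq_integral => x _; rewrite -EFinM mulrC.
  have mwy : measurable_fun B (fun x : 'rV[R]_n => (w (y + s *: x))%:E).
    apply/measurable_EFinP/measurable_funTS; apply: (measurableT_comp mw).
    exact: measurable_affine.
  rewrite (@ge0_integralZl _ _ _ lam B mB _ mwy); last 2 first.
    - by move=> x _; rewrite lee_fin.
    - by rewrite lee_fin.
  have -> : w y * psi y * omega = psi y * (w y * omega) by ring.
  rewrite EFinM; apply: lee_wpmul2l; first by rewrite lee_fin.
  exact: wsub.
have b0 z : B z -> 0 <= b z.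
  by move=> Bz; apply: le_trans (psib _ Bz); apply: Rintegral_ge0.
have pt2 z : (\int[lam]_x G (z, x) <= (w z * b z * \1_B z)%:E)%E.
  have [Bz|Bz] := pselect (B z); last first.
    rewrite (wB _ Bz) !mul0r integral0_eq; first by rewrite lexx.
    by move=> x _; rewrite /G/= (wB _ Bz) !mul0r.
  have e1 : \1_B z = 1 :> R by rewrite indicE mem_set.
  rewrite e1 mulr1.
  have -> : (\int[lam]_x G (z, x))%E =
     integral lam B (fun x : 'rV[R]_n => ((w z)%:E * (psi (z - s *: x)%R)%:E)%E).
    exact: (indE (fun x => w z * psi (z - s *: x))).
  have mp : measurable_fun setT (fun x : 'rV[R]_n => psi (z - s *: x)).
    by apply: (measurableT_comp mpsi); under eq_fun do rewrite -scaleNr; exact: measurable_affine.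
  have ip : lam.-integrable B (EFin \o (fun x : 'rV[R]_n => psi (z - s *: x))).
    apply: (@integrable_ball _ _ (fun x : 'rV[R]_n => psi (z - s *: x)) K mp).
    by move=> x _; rewrite (ger0_norm (psi0 _)); have /andP[] := psiK (z - s *: x).
  have mp' : measurable_fun B (fun x : 'rV[R]_n => (psi (z - s *: x))%:E).
    exact/measurable_EFinP/measurable_funTS.
  rewrite (@ge0_integralZl _ _ _ lam B mB _ mp'); last 2 first.
    - by move=> x _; rewrite lee_fin.
    - by rewrite lee_fin.
  rewrite (RintegralE mB ip) -EFinM lee_fin; apply: ler_wpM2l; first exact: w0.
  exact: psib.
have key : (\int[lam]_y (w y * psi y * omega)%:E <= \int[lam]_z (w z * b z * \1_B z)%:E)%E.
  apply: (@le_trans _ _ (\int[lS]_y \int[lS]_x F (y, x))%E).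
    apply: (@ge0_le_integral _ _ _ lS).
    - exact: measurableT.
    - by move=> y _; rewrite lee_fin !mulr_ge0.
    - apply/measurable_EFinP; apply: measurable_funM; last exact: measurable_cst.
      exact: measurable_funM.
    - exact: (@measurable_fun_fubini_tonelli_F _ _ _ _ _ lS F mF F0).
    - by move=> y _; exact: pt1.
  rewrite tF FG -tG.
  apply: (@ge0_le_integral _ _ _ lS).
  - exact: measurableT.
  - by move=> y _; apply: integral_ge0 => x _; exact: G0.
  - exact: (@measurable_fun_fubini_tonelli_F _ _ _ _ _ lS G mG G0).
  - apply/measurable_EFinP; apply: measurable_funM; last exact: measurable_indic.
    exact: measurable_funM.
  - by move=> z _; exact: pt2.
move: key; rewrite indE.
have -> : (\int[lam]_y (w y * psi y * omega)%:E = \int[lam]_(y in B) (omega * (w y * psi y))%:E)%E.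
  rewrite -indE; apply: eq_integral => y _; rewrite indicE.
  have [By|/wB ->] := pselect (B y); last by rewrite !mul0r mulr0 mul0r.
  by rewrite (mem_set By) mulr1 mulrC.
have i1 : lam.-integrable B (EFin \o (fun y => w y * psi y)).
  have m1 : measurable_fun setT (fun y => w y * psi y) by exact: measurable_funM.
  apply: (@integrable_ball _ _ _ (C * K) m1) => x _.
  rewrite ger0_norm; last exact: mulr_ge0.
  have /andP[_ wx] := wC x; have /andP[_ px] := psiK x.
  by apply: ler_pM.
have i2 : lam.-integrable B (EFin \o (fun y => w y * b y)).
  have m1 : measurable_fun setT (fun y => w y * b y) by exact: measurable_funM.
  apply: (@integrable_ball _ _ _ (C * Kb) m1) => x /bK bx.
  have /andP[_ wx] := wC x.
  rewrite normrM (ger0_norm (w0 x)).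
  by apply: ler_pM; [exact: w0|exact: normr_ge0|exact: wx|exact: bx].
rewrite (RintegralE mB i2).
under eq_integral do rewrite EFinM.
by rewrite (integralZl mB i1) (RintegralE mB i1) -EFinM lee_fin.
Qed.

End submean.

(** * Integrals over the unit ball and its moments *)
Section ball_integral.
Context {R : realType} {n : nat}.
Local Notation lam := (@lebesgue_rV R n).
Local Notation B := (@eball R n 0 1).
Local Notation omega := (@omega R n).
Implicit Types (f g : 'rV[R]_n -> R).

Definition ball_bounded f :=
  measurable_fun setT f /\ exists K : R, forall x, B x -> `|f x| <= K.

Definition ball_int f : R := \int[lam]_(x in B) f x.

Lemma ball_bounded_integrable f : ball_bounded f -> lam.-integrable B (EFin \o f).
Proof. by move=> [mf [K fK]]; exact: integrable_ball fK. Qed.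

Lemma ball_bounded_cst (c : R) : ball_bounded (fun=> c).
Proof. by split; [exact: measurable_cst|exists `|c| => x _]. Qed.

Lemma ball_boundedD f g : ball_bounded f -> ball_bounded g ->
  ball_bounded (fun x => f x + g x).
Proof.
move=> [mf [K fK]] [mg [L gL]]; split; first exact: measurable_funD.
exists (K + L) => x Bx; rewrite (le_trans (ler_normD _ _))//.
exact: lerD (fK _ Bx) (gL _ Bx).
Qed.

Lemma ball_boundedM f g : ball_bounded f -> ball_bounded g ->
  ball_bounded (fun x => f x * g x).
Proof.
move=> [mf [K fK]] [mg [L gL]]; split; first exact: measurable_funM.
exists (K * L) => x Bx; rewrite normrM.
by apply: ler_pM; [exact: normr_ge0|exact: normr_ge0|exact: fK|exact: gL].
Qed.

Lemma ball_boundedZ (c : R) f : ball_bounded f -> ball_bounded (fun x => c * f x).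
Proof. by move=> bf; apply: ball_boundedM => //; exact: ball_bounded_cst. Qed.

Lemma ball_bounded_sum (I : Type) (s : seq I) (F : I -> 'rV[R]_n -> R) :
  (forall i, ball_bounded (F i)) -> ball_bounded (fun x => \sum_(i <- s) F i x).
Proof.
move=> bF; elim: s => [|i s IH].
  by under eq_fun do rewrite big_nil; exact: ball_bounded_cst.
by under eq_fun do rewrite big_cons; exact: ball_boundedD.
Qed.

Lemma ball_bounded_coord i : ball_bounded (fun x => x 0 i).
Proof.
split; first exact: measurable_coord_rV.
exists 1 => x; rewrite /eball/= subr0 => x1.
exact: le_trans (le_coord_enorm _ _) (ltW x1).
Qed.

Lemma ball_intD f g : ball_bounded f -> ball_bounded g ->
  ball_int (fun x => f x + g x) = ball_int f + ball_int g.
Proof.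
by move=> bf bg; rewrite /ball_int RintegralD//;
  [exact: measurable_eball|exact: ball_bounded_integrable|exact: ball_bounded_integrable].
Qed.

Lemma ball_intZ (c : R) f : ball_bounded f ->
  ball_int (fun x => c * f x) = c * ball_int f.
Proof.
by move=> bf; rewrite /ball_int RintegralZl//;
  [exact: measurable_eball|exact: ball_bounded_integrable].
Qed.

Lemma ball_int_cst (c : R) : ball_int (fun=> c) = c * omega.
Proof. by rewrite /ball_int Rintegral_cst//; exact: measurable_eball. Qed.

Lemma ball_int_sum (I : Type) (s : seq I) (F : I -> 'rV[R]_n -> R) :
  (forall i, ball_bounded (F i)) ->
  ball_int (fun x => \sum_(i <- s) F i x) = \sum_(i <- s) ball_int (F i).
Proof.
move=> bF; elim: s => [|i s IH].
  by under eq_fun do rewrite big_nil; rewrite ball_int_cst mul0r big_nil.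
under eq_fun do rewrite big_cons.
by rewrite big_cons ball_intD// ?IH//; exact: ball_bounded_sum.
Qed.

Lemma le_ball_int f g : ball_bounded f -> ball_bounded g ->
  (forall x, B x -> f x <= g x) -> ball_int f <= ball_int g.
Proof.
move=> bf bg fg; apply: le_Rintegral fg; first exact: measurable_eball.
  exact: ball_bounded_integrable.
exact: ball_bounded_integrable.
Qed.

Lemma eq_ball_int f g : (forall x, B x -> f x = g x) -> ball_int f = ball_int g.
Proof. by move=> fg; apply: eq_Rintegral => x; rewrite inE => /fg. Qed.

(** Signed bounded functions inherit an invariance known for nonnegative
    ones: add a constant. *)
Lemma ball_int_invariant (T : 'rV[R]_n -> 'rV[R]_n) f :
  (forall x, enorm (T x) = enorm x) ->
  (forall g, measurable_fun B g -> (forall x, B x -> 0 <= g x) ->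
    (\int[lam]_(x in B) (g x)%:E = \int[lam]_(x in T @^-1` B) (g (T x))%:E)%E) ->
  ball_bounded f -> ball_bounded (fun x => f (T x)) ->
  ball_int (fun x => f (T x)) = ball_int f.
Proof.
move=> eT iT bf bfT; have [mf [K fK]] := bf.
have TB : T @^-1` B = B.
  by apply/seteqP; split => x; rewrite /eball/= !subr0 eT.
have /= E := iT (fun x => f x + K).
apply: (addIr (ball_int (fun=> K))).
rewrite -ball_intD//; last exact: ball_bounded_cst.
rewrite -ball_intD//; last exact: ball_bounded_cst.
rewrite /ball_int /Rintegral; congr fine.
rewrite E ?TB//.
  by apply: measurable_funD; [exact: measurable_funTS|exact: measurable_cst].
by move=> x /fK; rewrite ler_norml => /andP[]; lra.
Qed.

Lemma ball_bounded_flip i f : ball_bounded f -> ball_bounded (fun x => f (flip i x)).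
Proof.
move=> [mf [K fK]]; split.
  apply: (measurableT_comp mf); apply: measurable_fun_rV => j.
  under eq_fun do rewrite mxE; case: (j == i); last exact: measurable_coord_rV.
  by apply: measurable_funN; exact: measurable_coord_rV.
by exists K => x Bx; apply: fK; move: Bx; rewrite /eball/= !subr0 enorm_flip.
Qed.

Lemma ball_bounded_swap i k f : ball_bounded f -> ball_bounded (fun x => f (swap i k x)).
Proof.
move=> [mf [K fK]]; split.
  apply: (measurableT_comp mf); apply: measurable_fun_rV => j.
  by under eq_fun do rewrite mxE; exact: measurable_coord_rV.
by exists K => x Bx; apply: fK; move: Bx; rewrite /eball/= !subr0 enorm_swap.
Qed.

Lemma ball_int_flip i f : ball_bounded f ->
  ball_int (fun x => f (flip i x)) = ball_int f.
Proof.
move=> bf; apply: ball_int_invariant => //.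
- exact: enorm_flip.
- move=> g mg g0; apply: (ge0_integral_flip i (f := EFin \o g)).
  + exact: measurable_eball.
  + exact/measurable_EFinP.
  + by move=> x /g0; rewrite lee_fin.
- exact: ball_bounded_flip.
Qed.

Lemma ball_int_swap i k f : ball_bounded f ->
  ball_int (fun x => f (swap i k x)) = ball_int f.
Proof.
move=> bf; apply: ball_int_invariant => //.
- exact: enorm_swap.
- move=> g mg g0; apply: (ge0_integral_swap i k (f := EFin \o g)).
  + exact: measurable_eball.
  + exact/measurable_EFinP.
  + by move=> x /g0; rewrite lee_fin.
- exact: ball_bounded_swap.
Qed.

Lemma ball_int_coord i : ball_int (fun x => x 0 i) = 0.
Proof.
have := ball_int_flip i (ball_bounded_coord i).
under eq_fun do rewrite mxE eqxx -mulN1r.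
rewrite ball_intZ; last exact: ball_bounded_coord.
lra.
Qed.

Lemma ball_int_coordM i j : i != j -> ball_int (fun x => x 0 i * x 0 j) = 0.
Proof.
move=> ij; have bij := ball_boundedM (ball_bounded_coord i) (ball_bounded_coord j).
have := ball_int_flip i bij.
under eq_fun do rewrite !mxE eqxx eq_sym (negbTE ij) mulNr -mulN1r.
rewrite ball_intZ//; lra.
Qed.

Lemma ball_int_coord_sqr i j :
  ball_int (fun x => x 0 i ^+ 2) = ball_int (fun x => x 0 j ^+ 2).
Proof.
have bj := ball_boundedM (ball_bounded_coord j) (ball_bounded_coord j).
rewrite -(ball_int_swap i j (f := fun x => x 0 j ^+ 2))//.
by apply: eq_ball_int => x _; rewrite mxE tpermR.
Qed.

(** The normalised second moment: the average of [x i ^+ 2] over the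
    coordinates, so that no particular coordinate has to be chosen. *)
Definition moment2 : R := ball_int (fun x => enorm x ^+ 2) / n%:R.

Lemma ball_bounded_enorm2 : ball_bounded (fun x => enorm x ^+ 2).
Proof.
under eq_fun do rewrite enorm_sqr.
apply: (@ball_bounded_sum _ _ (fun i x => x 0 i ^+ 2)) => i.
exact: ball_boundedM (ball_bounded_coord i) (ball_bounded_coord i).
Qed.

Lemma ball_bounded_dot z : ball_bounded (dot z).
Proof.
apply: (@ball_bounded_sum _ _ (fun i x => z 0 i * x 0 i)) => i.
exact/ball_boundedZ/ball_bounded_coord.
Qed.

Hypothesis n0 : (0 < n)%N.

Lemma ball_int_enorm2 : ball_int (fun x => enorm x ^+ 2) = n%:R * moment2.
Proof. by rewrite mulrC divfK// pnatr_eq0 -lt0n. Qed.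

Lemma ball_int_coord2 i : ball_int (fun x => x 0 i ^+ 2) = moment2.
Proof.
have bc j : ball_bounded (fun x => x 0 j ^+ 2).
  exact: ball_boundedM (ball_bounded_coord j) (ball_bounded_coord j).
have := ball_int_enorm2; under eq_fun do rewrite enorm_sqr.
rewrite ball_int_sum//; under eq_bigr do rewrite (ball_int_coord_sqr _ i).
rewrite sumr_const card_ord -[ball_int _ *+ n]mulr_natl => /mulfI; apply.
by rewrite pnatr_eq0 -lt0n.
Qed.

Lemma moment2_gt0 : 0 < moment2.
Proof.
apply: divr_gt0; last by rewrite ltr0n.
pose r : R := 2^-1.
have r0 : 0 < r by rewrite invr_gt0.
pose A := B `\` eball 0 r.
have mA : measurable A by apply: measurableD; exact: measurable_eball.
have AD : lam A = (lam B - lam (eball 0 r))%E.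
  rewrite measureD; [|exact: measurable_eball|exact: measurable_eball|exact: lebesgue_eball_lty].
  rewrite setIidr => [//|x]; rewrite /eball/= subr0 /r => /lt_trans; apply.
  by rewrite invf_lt1 ?ltr1n.
have Ar : fine (lam A) = omega - omega * r ^+ n by rewrite AD omegaE lebesgue_eball.
have A0 : 0 < fine (lam A).
  rewrite Ar subr_gt0 gtr_pMr; last exact: omega_gt0.
  by rewrite exprn_ilt1 ?invf_lt1 ?ltr1n// ?ltW// -lt0n.
apply: lt_le_trans (_ : r ^+ 2 * fine (lam A) <= _); first by rewrite mulr_gt0// exprn_gt0.
rewrite -Rintegral_cst// (_ : A = B `&` A); last by rewrite setIDA setIid.
rewrite Rintegral_mkcondr; apply: le_ball_int; last first.
- move=> x Bx; rewrite patchE; case: ifPn => [|_]; last by rewrite sqr_ge0.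
  rewrite inE => -[_]; rewrite /eball/= subr0 => /negP; rewrite -leNgt => rx.
  by rewrite ler_pXn2r// nnegrE ?enorm_ge0// ltW.
- exact: ball_bounded_enorm2.
- split; last first.
    exists (r ^+ 2) => x _; rewrite patchE; case: ifP => _; rewrite ?normr0 ?sqr_ge0//.
    by rewrite ger0_norm// sqr_ge0.
  exact: (measurable_restrictT _ mA).1 (measurable_cst _).
Qed.

Lemma ball_int_dot z : ball_int (dot z) = 0.
Proof.
rewrite ball_int_sum => [|i]; last exact/ball_boundedZ/ball_bounded_coord.
rewrite big1// => i _; rewrite ball_intZ; last exact: ball_bounded_coord.
by rewrite ball_int_coord mulr0.
Qed.

Lemma ball_int_dot2 z : ball_int (fun x => dot z x ^+ 2) = enorm z ^+ 2 * moment2.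
Proof.
have bz i : ball_bounded (fun x => z 0 i * x 0 i) by exact/ball_boundedZ/ball_bounded_coord.
rewrite (_ : (fun x => dot z x ^+ 2) = (fun x =>
   \sum_(i < n) (\sum_(j < n) (z 0 i * x 0 i) * (z 0 j * x 0 j)))); last first.
  apply/funext => x; rewrite expr2 /dot mulr_suml.
  by apply: eq_bigr => i _; rewrite mulr_sumr.
rewrite ball_int_sum => [|i]; last by apply: ball_bounded_sum => j; exact: ball_boundedM.
rewrite enorm_sqr mulr_suml; apply: eq_bigr => i _.
rewrite ball_int_sum => [|j]; last exact: ball_boundedM.
have E j : ball_int (fun x => z 0 i * x 0 i * (z 0 j * x 0 j)) =
    z 0 i * z 0 j * ball_int (fun x => x 0 i * x 0 j).
  rewrite -ball_intZ; last exact: ball_boundedM (ball_bounded_coord i) (ball_bounded_coord j).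
  by apply: eq_ball_int => x _; ring.
rewrite (bigD1 i)//= big1 ?addr0; last first.
  by move=> j ji; rewrite E ball_int_coordM ?mulr0// eq_sym.
by rewrite E -(ball_int_coord2 i); congr (_ * _).
Qed.

End ball_integral.

(** * Radial test functions and the Laplacian *)
Section radial_test.
Context {R : realType} {n : nat}.
Hypothesis n0 : (0 < n)%N.
Local Notation B := (@eball R n 0 1).
Local Notation omega := (@omega R n).
Local Notation m2 := (@moment2 R n).
Implicit Types (w : 'rV[R]_n -> R).

Lemma ball_bounded_radial (f : R -> R) : continuous f ->
  ball_bounded (fun z : 'rV[R]_n => f (enorm z ^+ 2)).
Proof.
move=> cf; split.
  apply: measurable_continuous_rV => x.
  apply: (@continuous_comp _ _ _ (fun z : 'rV[R]_n => enorm z ^+ 2) f); last exact: cf.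
  apply: (@continuous_comp _ _ _ (@enorm R n) (fun t => t ^+ 2)); first exact: continuous_enorm.
  exact: exprn_continuous.
have [K _ H] := @continuous_bounded_itv R f 0 1 cf.
exists K => x; rewrite /eball/= subr0 => x1; apply: H.
by rewrite sqr_ge0 expr_le1// ?enorm_ge0// ltW.
Qed.

Lemma submean_ball_bounded w C : submean_ball w C -> ball_bounded w.
Proof.
move=> [mw wC _ _]; split => //; exists C => x _.
by have /andP[w0 w1] := wC x; rewrite ger0_norm.
Qed.

(** Test functions [Phi (|z|^2)]: the average of [Phi (|z - s xi|^2)] over
    [xi] in the ball exceeds [Phi (|z|^2)] by [s^2] times a multiple of the
    Laplacian, up to an error uniform in [z]. *)
Lemma radial_convolution_le (Phi Phi1 Phi2 : R -> R) (e : R) : 0 < e ->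
  (forall t : R, is_derive t 1 Phi (Phi1 t)) ->
  (forall t : R, is_derive t 1 Phi1 (Phi2 t)) -> continuous Phi2 ->
  exists2 s0 : R, 0 < s0 & forall s, 0 < s <= s0 -> forall z, B z ->
    ball_int (fun x => Phi (enorm (z - s *: x) ^+ 2)) <=
    omega * Phi (enorm z ^+ 2) + s ^+ 2 * (m2 * (n%:R * Phi1 (enorm z ^+ 2)
      + 2 * enorm z ^+ 2 * Phi2 (enorm z ^+ 2)) + e).
Proof.
move=> e0 d1 d2 c2.
have om0 := @omega_gt0 R n n0.
have cP : continuous Phi by move=> t; exact: is_derive_continuous (d1 t).
(* [12] absorbs the two error terms below, with factors [5 / 2] and [9] *)
pose e1 := e / (12 * omega).
have e10 : 0 < e1 by rewrite divr_gt0// mulr_gt0.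
have [d d0 Hd] := continuous_uniform_itv 0 1 e10 c2.
have [K K0 HK] := continuous_bounded_itv 0 1 c2.
(* [d / 3] because the increment of [enorm z ^+ 2] is at most [3 * s] *)
pose s0 := Num.min 1 (Num.min (d / 3) (e1 / (K + 1))).
have K10 : 0 < K + 1 by lra.
have s00 : 0 < s0.
  by rewrite !lt_min ltr01 (divr_gt0 d0 (ltr0n _ 3)) (divr_gt0 e10 K10).
exists s0; first exact: s00.
move=> s /andP[sp ss]; move: ss; rewrite /s0 !le_min => /and3P[s1 sd sK] z Bz.
have z1 : enorm z <= 1 by move: Bz; rewrite /eball/= subr0; exact: ltW.
have {Bz} z0 := enorm_ge0 z.
set t := enorm z ^+ 2.
have t01 : 0 <= t <= 1 by rewrite sqr_ge0 expr_le1.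
pose q x := Phi t + Phi1 t * (- 2 * s * dot z x + s ^+ 2 * enorm x ^+ 2)
   + 2 * Phi2 t * s ^+ 2 * dot z x ^+ 2 + s ^+ 2 * (12 * e1).
have bd := ball_bounded_dot z.
have bn := @ball_bounded_enorm2 R n.
have bc := @ball_bounded_cst R n.
have bd2 := ball_boundedM bd bd.
have b1 : ball_bounded (fun x => - 2 * s * dot z x + s ^+ 2 * enorm x ^+ 2).
  by apply: ball_boundedD; exact: ball_boundedZ.
have b2 : ball_bounded (fun x => Phi t + Phi1 t * (- 2 * s * dot z x + s ^+ 2 * enorm x ^+ 2)).
  by apply: ball_boundedD => //; exact: ball_boundedZ.
have b3 : ball_bounded (fun x => Phi t + Phi1 t * (- 2 * s * dot z x + s ^+ 2 * enorm x ^+ 2)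
   + 2 * Phi2 t * s ^+ 2 * dot z x ^+ 2).
  by apply: ball_boundedD => //; exact: ball_boundedZ.
have bq : ball_bounded q by exact: ball_boundedD.
have bphi : ball_bounded (fun x => Phi (enorm (z - s *: x) ^+ 2)).
  have [mP _] := ball_bounded_radial cP.
  split.
    apply: (measurableT_comp mP); under eq_fun do rewrite -scaleNr.
    exact: measurable_affine.
  have [L _ HL] := @continuous_bounded_itv R Phi 0 4 cP.
  exists L => x; rewrite /eball/= subr0 => x1; apply: HL.
  rewrite sqr_ge0/=.
  have : enorm (z - s *: x) <= 2.
    rewrite (le_trans (enormD _ _))// enormN enormZ gtr0_norm// (_ : 2 = 1 + 1)// lerD//.
    by rewrite -[leRHS]mulr1 ler_pM ?enorm_ge0// ltW.
  move=> h; rewrite (_ : 4 = 2 ^+ 2); last by ring.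
  by rewrite ler_pXn2r// nnegrE ?enorm_ge0.
apply: le_trans (_ : ball_int q <= _).
  apply: le_ball_int => // x; rewrite /eball/= subr0 => /ltW x1.
  have x0 := enorm_ge0 x.
  pose h := - 2 * s * dot z x + s ^+ 2 * enorm x ^+ 2.
  have -> : enorm (z - s *: x) ^+ 2 = t + h.
    rewrite enormD_sqr -scaleNr dotZr enormZ normrN (gtr0_norm sp) /h /t; ring.
  have dzx : `|dot z x| <= 1.
    by rewrite (le_trans (dot_abs_le _ _))// -[leRHS]mulr1 ler_pM.
  have xx : 0 <= enorm x ^+ 2 <= 1 by rewrite sqr_ge0 expr_le1.
  move: dzx; rewrite ler_norml => /andP[dz1 dz2].
  have s2 : s ^+ 2 <= s by rewrite expr2; clear -sp s1; nra.
  have h3 : `|h| <= 3 * s.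
    rewrite ler_norml /h; move: xx => /andP[xx0 xx1].
    by apply/andP; split; clear -sp s2 dz1 dz2 xx0 xx1; nra.
  have hd : forall k, `|k| <= `|h| -> `|Phi2 (t + k) - Phi2 t| <= e1.
    move=> k kh; apply: Hd => //; rewrite (le_trans kh)// (le_trans h3)//.
    by rewrite mulrC -ler_pdivlMr.
  have := @taylor2 R Phi Phi1 Phi2 (t - `|h| - 1) (t + `|h| + 1) t h e1
    (fun z _ => d1 z) (fun z _ => d2 z).
  move=> /(_ _ _ hd) T.
  have h0 := normr_ge0 h; have hl := ler_norm h; have hl' := lerNnormlW (lexx `|h|).
  have {}T : `|Phi (t + h) - Phi t - Phi1 t * h - 2^-1 * Phi2 t * h ^+ 2| <= e1 * h ^+ 2.
    by apply: T; clear -h0 hl hl'; lra.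
  have {}T := le_trans (ler_norm _) T.
  have hh : h ^+ 2 <= 9 * s ^+ 2.
    by rewrite -[h ^+ 2]real_normK ?num_real//; clear -sp h0 h3; nra.
  have hq : `|h ^+ 2 - 4 * s ^+ 2 * dot z x ^+ 2| <= 5 * s ^+ 3.
    have -> : h ^+ 2 - 4 * s ^+ 2 * dot z x ^+ 2 =
      s ^+ 3 * (- 4 * (dot z x * enorm x ^+ 2) + s * (enorm x ^+ 2) ^+ 2) by rewrite /h; ring.
    rewrite normrM [5 * _]mulrC (gtr0_norm (exprn_gt0 _ sp)).
    apply: ler_wpM2l; first by rewrite exprn_ge0// ltW.
    move: xx => /andP[]; set X := enorm x ^+ 2 => X0 X1.
    have a1 : - 1 <= dot z x * X <= 1 by clear -dz1 dz2 X0 X1; apply/andP; split; nra.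
    have a2 : 0 <= s * X ^+ 2 <= 1.
      rewrite mulr_ge0 ?sqr_ge0 ?(ltW sp)//= -[leRHS]mulr1.
      by rewrite ler_pM ?sqr_ge0 ?(ltW sp)// expr_le1.
    by rewrite ler_norml; clear -a1 a2; lra.
  have P2 := HK _ t01.
  have Ks : K * s <= e1.
    have : s * (K + 1) <= e1 by rewrite -ler_pdivlMr.
    by clear -sp; lra.
  have m1 : 2^-1 * Phi2 t * (h ^+ 2 - 4 * s ^+ 2 * dot z x ^+ 2) <= 5 / 2 * (s ^+ 2 * e1).
    rewrite (le_trans (ler_norm _))// normrM.
    apply: le_trans (_ : (2^-1 * K) * (5 * s ^+ 3) <= _).
      by rewrite ler_pM// normrM gtr0_norm ?invr_gt0// ler_wpM2l// invr_ge0.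
    have : s ^+ 2 * (K * s) <= s ^+ 2 * e1 by rewrite ler_wpM2l// sqr_ge0.
    by rewrite exprS; clear; lra.
  have m3 : e1 * h ^+ 2 <= 9 * (s ^+ 2 * e1).
    by have := ler_wpM2l (ltW e10) hh; clear; lra.
  have s2e : 0 <= s ^+ 2 * e1 by rewrite mulr_ge0 ?sqr_ge0 ?(ltW e10).
  by rewrite /q -/h; clear -T m1 m3 s2e; lra.
have b4 := ball_boundedZ (2 * Phi2 t * s ^+ 2) bd2.
have -> : ball_int q = omega * Phi t + Phi1 t * (s ^+ 2 * (n%:R * m2))
   + 2 * Phi2 t * s ^+ 2 * (enorm z ^+ 2 * m2) + s ^+ 2 * e.
  rewrite (ball_intD b3 (bc _)) (ball_intD b2 b4).
  rewrite (ball_intD (bc _) (ball_boundedZ (Phi1 t) b1)) (ball_intZ (Phi1 t) b1).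
  rewrite (ball_intD (ball_boundedZ (- 2 * s) bd) (ball_boundedZ (s ^+ 2) bn)).
  rewrite (ball_intZ _ bd) (ball_intZ _ bn) (ball_intZ _ bd2) !ball_int_cst.
  rewrite ball_int_dot ball_int_enorm2// ball_int_dot2// /e1.
  field; exact: lt0r_neq0.
by rewrite /t le_eqVlt; apply/orP; left; apply/eqP; ring.
Qed.

End radial_test.

Section laplacian_test.
Context {R : realType} {n : nat}.
Hypothesis n0 : (0 < n)%N.
Local Notation B := (@eball R n 0 1).
Local Notation omega := (@omega R n).
Local Notation m2 := (@moment2 R n).
Implicit Types (w : 'rV[R]_n -> R).

(** Subtract the two sides of the smoothed inequality for small [s] and divide by
[s ^+ 2]: the zeroth order terms cancel. The integrand is half the Laplacian of
[Phi (enorm z ^+ 2)]. *)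
Lemma laplacian_test w C (Phi Phi1 Phi2 : R -> R) (c : R) : submean_ball w C ->
  (forall t : R, is_derive t 1 Phi (Phi1 t)) ->
  (forall t : R, is_derive t 1 Phi1 (Phi2 t)) -> continuous Phi2 ->
  (forall t, 0 <= Phi t) -> c < 1 -> (forall t, c <= t -> Phi t = 0) ->
  0 <= ball_int (fun z => w z * (n%:R * Phi1 (enorm z ^+ 2)
      + 2 * enorm z ^+ 2 * Phi2 (enorm z ^+ 2))).
Proof.
move=> sw d1 d2 c2 P0 c1 Pc.
have om0 := @omega_gt0 R n n0.
have m20 := @moment2_gt0 R n n0.
have bw := submean_ball_bounded sw.
have cP : continuous Phi by move=> t; exact: is_derive_continuous (d1 t).
have cP1 : continuous Phi1 by move=> t; exact: is_derive_continuous (d2 t).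
have bP := ball_bounded_radial (n := n) cP.
have bP1 := ball_bounded_radial (n := n) cP1.
have bP2 := ball_bounded_radial (n := n) c2.
have bn := @ball_bounded_enorm2 R n.
have bc := @ball_bounded_cst R n.
pose D (z : 'rV[R]_n) := n%:R * Phi1 (enorm z ^+ 2) + 2 * enorm z ^+ 2 * Phi2 (enorm z ^+ 2).
have bD : ball_bounded D.
  apply: ball_boundedD; first exact: ball_boundedZ.
  by apply: ball_boundedM => //; exact: ball_boundedZ.
have bwD := ball_boundedM bw bD.
have bwP := ball_boundedM bw bP.
have [K K0 HK] := continuous_bounded_itv 0 1 cP.
have PK t : 0 <= t -> 0 <= Phi t <= K.
  move=> t0; rewrite P0/=; have [t1|t1] := leP t 1.
    by apply: le_trans (ler_norm _) (HK _ _); rewrite t0.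
  by rewrite Pc// (le_trans (ltW c1))// ltW.
rewrite -[ball_int _]/(ball_int (fun z => w z * D z)).
have ciw : 0 <= ball_int w.
  by case: sw => _ wC _ _; apply: Rintegral_ge0 => x _; have /andP[] := wC x.
apply/ler_addgt0Pr => e e0.
pose e' := e * m2 / (ball_int w + 1).
have w10 : 0 < ball_int w + 1 by lra.
have e'0 : 0 < e' by rewrite divr_gt0// mulr_gt0.
have [s0 s00 Hs] := radial_convolution_le n0 e'0 d1 d2 c2.
pose s := Num.min s0 ((1 - c) / 2).
have sp : 0 < s by rewrite lt_min s00 divr_gt0// subr_gt0.
have ss0 : 0 < s <= s0 by rewrite sp ge_min lexx.
have sc : s <= (1 - c) / 2 by rewrite ge_min lexx orbT.
pose b' (z : 'rV[R]_n) := omega * Phi (enorm z ^+ 2) + s ^+ 2 * (m2 * D z + e').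
have bmD := ball_boundedD (ball_boundedZ m2 bD) (bc e').
have bb' : ball_bounded b'.
  by apply: ball_boundedD; exact: ball_boundedZ.
have [mb' [Kb HKb]] := bb'.
have [mP _] := bP.
have H := @submean_convolution R n w C (fun z => Phi (enorm z ^+ 2)) K s b' Kb
   sw mP _ sp _ mb' HKb _.
have {}H : omega * ball_int (fun z => w z * Phi (enorm z ^+ 2)) <= ball_int (fun z => w z * b' z).
  apply: H.
  - by move=> x; apply: PK; rewrite sqr_ge0.
  - by move=> x xs; apply: Pc; nra.
  - by move=> z Bz; exact: Hs.
have E : ball_int (fun z => w z * b' z) =
   omega * ball_int (fun z => w z * Phi (enorm z ^+ 2)) +
   s ^+ 2 * (m2 * ball_int (fun z => w z * D z) + e' * ball_int w).
  transitivity (ball_int (fun z => omega * (w z * Phi (enorm z ^+ 2)) +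
      s ^+ 2 * (m2 * (w z * D z) + e' * w z))).
    by apply: eq_ball_int => z _; rewrite /b'; ring.
  have h1 := ball_boundedZ m2 bwD; have h2 := ball_boundedZ e' bw.
  have h3 := ball_boundedD h1 h2.
  rewrite (ball_intD (ball_boundedZ omega bwP) (ball_boundedZ (s ^+ 2) h3)).
  by rewrite (ball_intZ _ bwP) (ball_intZ _ h3) (ball_intD h1 h2) (ball_intZ _ bwD) (ball_intZ _ bw).
move: H; rewrite E lerDl pmulr_rge0 ?exprn_gt0// => H.
rewrite -(pmulr_rge0 _ m20) mulrDr; apply: le_trans H _; rewrite lerD2l.
rewrite /e' mulrAC ler_pdivrMr// [m2 * e]mulrC ler_wpM2l; first by [].
  by rewrite mulr_ge0 ?ltW.
by rewrite lerDl.
Qed.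

(** The radial test function whose derivative with respect to [t = enorm z ^+ 2]
is [- P t]. In the coordinate [v = t `^ k = enorm z ^+ n], the expression
[n * Phi' + 2 * t * Phi''] collapses to [- n * g v]: up to a constant, [t `^ (- k)]
is the derivative of the fundamental solution, so the test function is
harmonic wherever [G] is constant. As [G] vanishes near the origin, [P] is smooth
there, and as it vanishes near [1] the test function has compact support. *)
Section radial_potential.
Variables (G g : R -> R) (a b : R).
Hypotheses (a0 : 0 < a) (ab : a <= b) (b1 : b < 1).
Hypothesis dG : forall v : R, is_derive v 1 G (g v).
Hypothesis cg : continuous g.
Hypothesis G0 : forall v, 0 <= G v.
Hypothesis Ga : forall v, v <= a -> G v = 0 /\ g v = 0.
Hypothesis Gb : forall v, b <= v -> G v = 0 /\ g v = 0.

Let k : R := n%:R / 2.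
Let k0 : 0 < k. Proof. by rewrite divr_gt0// ltr0n. Qed.
Let P t := t `^ (- k) * G (t `^ k).
Let P1 t := k * t^-1 * (g (t `^ k) - P t).
Let a' := a `^ k^-1.
Let b' := b `^ k^-1.

Let a'0 : 0 < a'. Proof. exact: powR_gt0. Qed.

Let a'k : a' `^ k = a.
Proof. by rewrite /a' -powRrM mulVf ?gt_eqF// powRr1// ltW. Qed.

Let lt_a' t : t < a' -> G (t `^ k) = 0 /\ g (t `^ k) = 0.
Proof.
move=> ta; have [t0|t0|->] := ltgtP t 0.
- by rewrite lt0_powR1//; apply: Gb; exact: ltW.
- apply: Ga; rewrite -a'k; apply: ge0_ler_powR; [exact: ltW| | |exact: ltW].
    by rewrite nnegrE ltW.
  by rewrite nnegrE ltW.
- by rewrite powR0 ?gt_eqF//; apply: Ga; exact: ltW.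
Qed.

Let near_a' t : t < a' -> \forall s \near t, s < a'.
Proof. by move=> ta; exact: lt_nbhsl. Qed.

Let P_a' t : t < a' -> P t = 0.
Proof. by move=> /lt_a'[Gt _]; rewrite /P Gt mulr0. Qed.

Let P1_a' t : t < a' -> P1 t = 0.
Proof. by move=> ta; have [Gt gt] := lt_a' ta; rewrite /P1 gt P_a'// subr0 mulr0. Qed.

Let cov t : t < a' \/ 0 < t.
Proof. by have [t0|t0] := leP t 0; [left; exact: le_lt_trans a'0|right]. Qed.

Let dP (t : R) : is_derive t 1 P (P1 t).
Proof.
have [ta|t0] := cov t.
  rewrite P1_a'//; apply: (@near_eq_is_derive _ _ _ (cst 0)).
    by near=> s; rewrite /= P_a'//; near: s; exact: near_a'.
have d1 := is_derive1_powR (- k) t0.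
have d2 := is_derive1_powR k t0.
have d3 : is_derive t 1 (G \o (@powR R ^~ k)) (g (t `^ k) * (k * t `^ (k - 1))).
  exact: is_derive1_comp.
have d4 := is_deriveM d1 d3.
apply: is_derive_eq; rewrite !scaleRE /=.
have t0' : t != 0 by rewrite gt_eqF.
have e1 : t `^ (- k - 1) = t `^ (- k) * t^-1.
  by rewrite powRD ?t0' ?implybT// powR_inv1// ltW.
have e2 : t `^ (k - 1) = t `^ k * t^-1.
  by rewrite powRD ?t0' ?implybT// powR_inv1// ltW.
have e3 : t `^ (- k) * t `^ k = 1.
  by rewrite powRN mulVf// gt_eqF// powR_gt0.
rewrite e1 e2 /P1 /P.
transitivity (k / t * (t `^ (- k) * t `^ k * g (t `^ k) - t `^ (- k) * G (t `^ k))).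
  by ring.
by rewrite e3 mul1r.
Unshelve. all: by end_near. Qed.

Let cP1 : continuous P1.
Proof.
move=> t; have [ta|t0] := cov t.
  apply: (@near_cst_continuous _ _ 0).
  by near=> s; rewrite /= P1_a'//; near: s; exact: near_a'.
have cpow : {for t, continuous (fun s => s `^ k)}.
  exact: is_derive_continuous (is_derive1_powR k t0).
have cPt : {for t, continuous P} by exact: is_derive_continuous (dP t).
have c1 : {for t, continuous (fun s : R => k * s^-1)}.
  apply: (@continuousM _ _ (cst k) (fun s : R => s^-1)); first exact: cst_continuous.
  by apply: (@continuousV _ _ id); [rewrite gt_eqF|].
have c2 : {for t, continuous (fun s => g (s `^ k))}.
  by apply: continuous_comp; [exact: cpow|exact: cg].
have c3 : {for t, continuous (fun s => g (s `^ k) - P s)}.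
  exact: (@continuousB _ _ _ (fun s => g (s `^ k)) P).
exact: (@continuousM _ _ _ _ t c1 c3).
Unshelve. all: by end_near. Qed.

Lemma radial_potential_test w C : submean_ball w C ->
  ball_int (fun z => w z * g (enorm z ^+ n)) <= 0.
Proof.
move=> sw.
have cP : continuous P by move=> t; exact: is_derive_continuous (dP t).
have [F dF] := continuous_antiderivative cP.
pose Phi t := F 1 - F t.
have dPhi (t : R) : is_derive t 1 Phi (- P t).
  rewrite -[X in is_derive _ _ _ X]sub0r.
  exact: (@is_deriveB _ _ _ (cst (F 1)) F).
have dPhi1 (t : R) : is_derive t 1 (fun s => - P s) (- P1 t).
  exact: (@is_deriveN _ _ _ P).
have cPhi2 : continuous (fun s => - P1 s).
  by move=> t; apply: continuousN; exact: cP1.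
have P0 t : 0 <= P t by rewrite mulr_ge0 ?powR_ge0.
have b0 : 0 < b by exact: lt_le_trans ab.
have b'k : b' `^ k = b by rewrite /b' -powRrM mulVf ?gt_eqF// powRr1// ltW.
have b'0 : 0 < b' by exact: powR_gt0.
have b'1 : b' < 1.
  rewrite ltNge; apply/negP => b'1; move: b1; rewrite ltNge -b'k => /negP; apply.
  have <- : 1 `^ k = 1 :> R by rewrite powR1.
  by apply: ge0_ler_powR => //; [exact: ltW|rewrite nnegrE|rewrite nnegrE ltW].
have Pb t : b' <= t -> P t = 0.
  move=> bt; rewrite /P (Gb _).1 ?mulr0// -b'k.
  have t0 : 0 <= t by rewrite ltW// (lt_le_trans b'0).
  by apply: ge0_ler_powR => //; rewrite ?nnegrE ltW.
have Phib t : b' <= t -> Phi t = 0.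
  move=> bt; have [c /andP[c1 _] E] := mvt t 1 dF.
  rewrite /Phi E Pb ?mul0r// (le_trans _ c1)// le_min bt.
  exact: ltW.
have Phi0 t : 0 <= Phi t.
  have [t1|t1] := leP t 1; last by rewrite Phib// ltW// (lt_trans b'1).
  have [c _ E] := mvt t 1 dF.
  by rewrite /Phi E mulr_ge0// subr_ge0.
have bg : ball_bounded (fun z : 'rV[R]_n => g (enorm z ^+ n)).
  have cgn : continuous (fun z : 'rV[R]_n => g (enorm z ^+ n)).
    move=> x.
    apply: (@continuous_comp _ _ _ (fun z : 'rV[R]_n => enorm z ^+ n) g); last exact: cg.
    apply: (@continuous_comp _ _ _ (@enorm R n) (fun t => t ^+ n)); first exact: continuous_enorm.
    exact: exprn_continuous.
  split; first exact: measurable_continuous_rV.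
  have [K _ H] := continuous_bounded_itv 0 1 cg.
  exists K => x; rewrite /eball/= subr0 => x1; apply: H.
  by rewrite exprn_ge0 ?expr_le1// ?enorm_ge0// ltW.
have := laplacian_test sw dPhi dPhi1 cPhi2 Phi0 b'1 Phib.
rewrite (@eq_ball_int _ _ _ (fun z => - n%:R * (w z * g (enorm z ^+ n)))).
  rewrite ball_intZ; first by rewrite mulNr oppr_ge0 pmulr_rle0// ltr0n.
  by apply: ball_boundedM; [exact: submean_ball_bounded sw|].
move=> z _.
have Ek : (enorm z ^+ 2) `^ k = enorm z ^+ n.
  by rewrite -[enorm z ^+ 2]powR_mulrn ?enorm_ge0// -powRrM /k mulrC divfK ?pnatr_eq0// powR_mulrn ?enorm_ge0.
rewrite (_ : _ + _ = - n%:R * g (enorm z ^+ n)); first by ring.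
rewrite /P1 Ek.
have [->|z0] := eqVneq (enorm z) 0.
  rewrite !expr0n/= (gtn_eqF n0)/= (Ga (ltW a0)).2 P_a'//.
  by rewrite !(mulr0, mul0r, oppr0, addr0).
by rewrite /k; field.
Qed.

End radial_potential.

End laplacian_test.

(** * Averages over annuli *)
Section annuli.
Context {R : realType} {n : nat}.
Hypothesis n0 : (0 < n)%N.
Local Notation B := (@eball R n 0 1).
Local Notation omega := (@omega R n).
Local Notation lam := (@lebesgue_rV R n).
Implicit Types (w : 'rV[R]_n -> R).

(** The continuous step from 0 to 1 on the unit interval. Differences of steep
ramps are continuous approximations of indicators, and the closed formula makes
the function continuous without a case analysis. *)
Definition ramp (t : R) : R := (`|t| - `|t - 1| + 1) / 2.

Lemma ramp_le0 t : t <= 0 -> ramp t = 0.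
Proof. by move=> t0; rewrite /ramp !ler0_norm; lra. Qed.

Lemma ramp_ge1 t : 1 <= t -> ramp t = 1.
Proof. by move=> t0; rewrite /ramp !ger0_norm; lra. Qed.

Lemma ramp_homo s t : s <= t -> ramp s <= ramp t.
Proof.
rewrite /ramp => st.
by case: (ger0P s); case: (ger0P t); case: (ger0P (s - 1)); case: (ger0P (t - 1)); lra.
Qed.

Lemma ramp_itv t : 0 <= ramp t <= 1.
Proof.
rewrite /ramp.
by case: (ger0P t); case: (ger0P (t - 1)); lra.
Qed.

Lemma continuous_subc (c : R) : continuous (fun v : R => v - c).
Proof.
move=> t; have ci : {for t, continuous (@id R)} by exact: cvg_id.
exact: continuousB ci (@cst_continuous R R c t).
Qed.

Lemma continuous_ramp : continuous ramp.
Proof.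
move=> t; rewrite /ramp.
have c1 : {for t, continuous (fun t : R => `|t|)} by exact: norm_continuous.
have c2 : {for t, continuous (fun t : R => `|t - 1|)}.
  apply: (@continuous_comp _ _ _ (fun t : R => t - 1) (fun t : R => `|t|)); last exact: norm_continuous.
  exact: continuous_subc.
have c3 := continuousB c1 c2.
have c4 := continuousD c3 (@cst_continuous R R 1 t).
exact: continuousM c4 (@cst_continuous R R 2^-1 t).
Qed.

(** The profile is a positive trapezoid over [c1, c2] and a negative one over
[c3, c4], with weights that make the total mass zero; as the positive part comes
first, the primitive [G] is nonnegative and vanishes on both sides. *)
Lemma trapezoid_test w C (k c1 c2 c3 c4 : R) : submean_ball w C ->
  0 < k -> 0 < c1 -> c1 < c2 -> c2 <= c3 -> c3 < c4 -> c4 + k^-1 < 1 ->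
  ball_int (fun z => w z *
    ((c4 - c3) * (ramp (k * (enorm z ^+ n - c1)) - ramp (k * (enorm z ^+ n - c2)))
     - (c2 - c1) * (ramp (k * (enorm z ^+ n - c3)) - ramp (k * (enorm z ^+ n - c4))))) <= 0.
Proof.
move=> sw k0 c10 c12 c23 c34 c41.
have [Sg dS] := continuous_antiderivative continuous_ramp.
pose g v := (c4 - c3) * (ramp (k * (v - c1)) - ramp (k * (v - c2)))
     - (c2 - c1) * (ramp (k * (v - c3)) - ramp (k * (v - c4))).
pose G v := (c4 - c3) / k * (Sg (k * (v - c1)) - Sg (k * (v - c2)))
     - (c2 - c1) / k * (Sg (k * (v - c3)) - Sg (k * (v - c4))).
have cr c : continuous (fun v : R => ramp (k * (v - c))).
  move=> v; apply: (@continuous_comp _ _ _ (fun v : R => k * (v - c)) ramp); last exact: continuous_ramp.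
  apply: (@continuousM _ _ (cst k) (fun v => v - c)); first exact: cst_continuous.
  exact: continuous_subc.
have cg : continuous g.
  move=> v.
  have h1 := continuousB (cr c1 v) (cr c2 v).
  have h2 := continuousB (cr c3 v) (cr c4 v).
  have h3 := continuousM (@cst_continuous R R (c4 - c3) v) h1.
  have h4 := continuousM (@cst_continuous R R (c2 - c1) v) h2.
  exact: continuousB h3 h4.
have dSc c (v : R) : is_derive v 1 (fun v => Sg (k * (v - c))) (ramp (k * (v - c)) * k).
  have dl : is_derive v 1 (fun v : R => k * (v - c)) k.
    by apply: is_derive_eq; rewrite /= !scaleRE; ring.
  exact: (@is_derive1_comp _ Sg (fun v => k * (v - c))).
have dG (v : R) : is_derive v 1 G (g v).
  have := dSc c1 v; have := dSc c2 v; have := dSc c3 v; have := dSc c4 v => D4 D3 D2 D1.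
  apply: is_derive_eq; rewrite /g !scaleRE.
  by field; rewrite gt_eqF.
have Sle x : x <= 0 -> Sg x = Sg 0.
  move=> x0; have [c /andP[_ c_] E] := mvt 0 x dS.
  apply/eqP; rewrite -subr_eq0 E ramp_le0 ?mul0r//.
  by rewrite (le_trans c_)// ge_max lexx x0.
have Sge x y : 1 <= x -> 1 <= y -> Sg x - Sg y = x - y.
  move=> x1 y1; have [c /andP[c_ _] E] := mvt y x dS.
  by rewrite E ramp_ge1 ?mul1r// (le_trans _ c_)// le_min x1 y1.
have kV0 : 0 < k^-1 by rewrite invr_gt0.
have kV : k * k^-1 = 1 by rewrite divff// gt_eqF.
have neg c v : v <= c -> k * (v - c) <= 0 by move=> vc; rewrite pmulr_rle0// subr_le0.
have big c v : c + k^-1 <= v -> 1 <= k * (v - c).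
  by move=> cv; rewrite -kV ler_pM2l//; lra.
apply: (@radial_potential_test _ _ n0 G g c1 (c4 + k^-1)) sw => //.
- lra.
- move=> v.
  have [x /andP[x_ _] Ex] := mvt (k * (v - c2)) (k * (v - c1)) dS.
  have [y /andP[_ y_] Ey] := mvt (k * (v - c4)) (k * (v - c3)) dS.
  rewrite min_l in x_; last by rewrite ler_pM2l//; lra.
  rewrite max_r in y_; last by rewrite ler_pM2l//; lra.
  have yx : y <= x.
    by apply: le_trans y_ _; apply: le_trans x_; rewrite ler_pM2l//; lra.
  have -> : G v = (c4 - c3) * (c2 - c1) * (ramp x - ramp y).
    by rewrite /G Ex Ey; field; rewrite gt_eqF.
  by rewrite !mulr_ge0// subr_ge0 ?ramp_homo// ltW.
- move=> v vc1; have vc2 : v <= c2 by lra.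
  have vc3 : v <= c3 by lra.
  have vc4 : v <= c4 by lra.
  rewrite /G /g !Sle ?ramp_le0//; try exact: neg.
  by split; ring.
- move=> v cv; have vc1 : c1 + k^-1 <= v by lra.
  have vc2 : c2 + k^-1 <= v by lra.
  have vc3 : c3 + k^-1 <= v by lra.
  rewrite /G /g (Sge (k * (v - c1)) (k * (v - c2))) ?(Sge (k * (v - c3)) (k * (v - c4))); try exact: big.
  rewrite !ramp_ge1; try exact: big.
  by split; [field; rewrite gt_eqF|ring].
Qed.

Lemma ball_int_cvg (f_ : nat -> 'rV[R]_n -> R) (f : 'rV[R]_n -> R) (K : R) :
  (forall k, measurable_fun setT (f_ k)) -> measurable_fun setT f ->
  (forall k x, `|f_ k x| <= K) ->
  (forall x, f_ ^~ x @ \oo --> f x) ->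
  (fun k => ball_int (f_ k)) @ \oo --> ball_int f.
Proof.
move=> mf_ mf fK ff.
have mB : measurable B by exact: measurable_eball.
have := @dominated_convergence _ _ _ lam B mB (fun k x => (f_ k x)%:E) (EFin \o f) (cst K%:E).
case.
- by move=> k; apply/measurable_EFinP/measurable_funTS.
- by apply/measurable_EFinP/measurable_funTS.
- by apply: aeW => x _; apply: cvg_EFin; [exact: nearW|exact: ff].
- exact: ball_bounded_integrable (ball_bounded_cst K).
- by apply: aeW => x k _; rewrite /= lee_fin.
move=> fi _ cv.
rewrite /ball_int /Rintegral.
apply: fine_cvg; rewrite fineK; last exact: integrable_fin_num.
exact: cv.
Qed.

(** Tail functions of the distribution of [w] in the volume coordinate. Both are
needed because the limits of the ramps are a strict indicator on one side and a
weak one on the other. *)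
Definition mass_gt w (c : R) := ball_int (fun z => w z * (c < enorm z ^+ n)%R%:R).
Definition mass_ge w (c : R) := ball_int (fun z => w z * (c <= enorm z ^+ n)%R%:R).


Lemma ball_bounded_vol_bool (p : R -> bool) : measurable_fun setT p ->
  ball_bounded (fun z : 'rV[R]_n => (p (enorm z ^+ n))%:R).
Proof.
move=> mp; split; last by exists 1 => x _; case: (p _); rewrite ?normr1 ?normr0.
have mE : measurable_fun setT (fun z : 'rV[R]_n => enorm z ^+ n).
  by apply: measurable_funX; exact: measurable_enorm.
have := measurableT_comp mp mE => mc.
rewrite (_ : (fun _ => _) = (fun z : 'rV[R]_n => if p (enorm z ^+ n) then 1 else 0)).
  by apply: measurable_fun_ifT.
by apply/funext => z; case: (p _).
Qed.

(** With respect to volume, the average of [w] over [v1 < v <= v2] is at most its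
average over [v3 < v < v4]. It is the limit of the trapezoid inequality for
slopes tending to infinity; the outer ends [v1] and [v4] are moved inwards by the
width of the ramps so that the test function stays supported in the punctured
open ball. *)
Lemma annulus_mean_le w C (v1 v2 v3 v4 : R) : submean_ball w C ->
  0 <= v1 -> v1 < v2 -> v2 <= v3 -> v3 < v4 -> v4 <= 1 ->
  (v4 - v3) * (mass_gt w v1 - mass_gt w v2) <= (v2 - v1) * (mass_gt w v3 - mass_ge w v4).
Proof.
move=> sw v10 v12 v23 v34 v41.
have [mw wC _ _] := sw.
pose h (N : nat) : R := N.+1%:R^-1.
pose T1 N (z : 'rV[R]_n) := w z * ramp (N.+1%:R * (enorm z ^+ n - (v1 + h N))).
pose T2 N (z : 'rV[R]_n) := w z * ramp (N.+1%:R * (enorm z ^+ n - v2)).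
pose T3 N (z : 'rV[R]_n) := w z * ramp (N.+1%:R * (enorm z ^+ n - v3)).
pose T4 N (z : 'rV[R]_n) := w z * ramp (N.+1%:R * (enorm z ^+ n - (v4 - 2 * h N))).
have mT c N : measurable_fun setT (fun z : 'rV[R]_n => w z * ramp (N.+1%:R * (enorm z ^+ n - c))).
  apply: measurable_funM => //; apply: measurableT_comp.
    exact: continuous_measurable_fun continuous_ramp.
  apply: measurable_funM; first exact: measurable_cst.
  apply: measurable_funB; last exact: measurable_cst.
  by apply: measurable_funX; exact: measurable_enorm.
have bT c N (z : 'rV[R]_n) : `|w z * ramp (N.+1%:R * (enorm z ^+ n - c))| <= C.
  have /andP[w0 w1] := wC z; have /andP[r0 r1] := ramp_itv (N.+1%:R * (enorm z ^+ n - c)).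
  rewrite ger0_norm; last exact: mulr_ge0.
  by rewrite -[C]mulr1; apply: ler_pM.
have hc : h @ \oo --> (0 : R) by exact: cvg_harmonic.
have mp c : measurable_fun setT (fun z : 'rV[R]_n => w z * (c < enorm z ^+ n)%R%:R).
  by apply: measurable_funM => //; apply: (ball_bounded_vol_bool (p := fun v => c < v) _).1;
    exact: measurable_fun_ltr.
have mpe c : measurable_fun setT (fun z : 'rV[R]_n => w z * (c <= enorm z ^+ n)%R%:R).
  by apply: measurable_funM => //; apply: (ball_bounded_vol_bool (p := fun v => c <= v) _).1;
    exact: measurable_fun_ler.
(* beyond a fixed distance from [c], the ramps of slope [N] are constant *)
have far (e : R) : 0 < e -> \forall N \near \oo, 2 <= N.+1%:R * e.
  move=> e0; exists (Num.truncn (2 / e)) => //= N /= tN.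
  by rewrite -ler_pdivrMr// ltW// (lt_le_trans (truncnS_gt _))// ler_nat.
have evt (z : 'rV[R]_n) (r : nat -> R) (l : R) : (\forall N \near \oo, r N = l) ->
    (fun N => w z * r N) @ \oo --> w z * l.
  by move=> H; apply: cvg_near_cst; apply: filterS H => k ->.
have l1 : (fun N => ball_int (T1 N)) @ \oo --> mass_gt w v1.
  apply: (@ball_int_cvg _ _ C) => [k||k z|z]; [exact: mT|exact: mp|exact: bT|].
  apply: (evt z _ (v1 < enorm z ^+ n)%R%:R); have [vz|zv] := ltP v1 (enorm z ^+ n).
    near=> k; apply: ramp_ge1.
    rewrite opprD addrA mulrBr /h mulfV// lerBrDr (_ : 1 + 1 = 2)//.
    near: k; apply: far; rewrite subr_gt0//.
  near=> k; apply: ramp_le0; rewrite pmulr_rle0// subr_le0.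
  by rewrite (le_trans zv)// lerDl invr_ge0.
have l2 v : (fun N => ball_int (fun z => w z * ramp (N.+1%:R * (enorm z ^+ n - v)))) @ \oo --> mass_gt w v.
  apply: (@ball_int_cvg _ _ C) => [k||k z|z]; [exact: mT|exact: mp|exact: bT|].
  apply: (evt z _ (v < enorm z ^+ n)%R%:R); have [vz|zv] := ltP v (enorm z ^+ n).
    near=> k; apply: ramp_ge1; apply: (@le_trans _ _ 2); first by rewrite ler1n.
    near: k; apply: far; rewrite subr_gt0//.
  near=> k; apply: ramp_le0; rewrite pmulr_rle0// subr_le0//.
have l4 : (fun N => ball_int (T4 N)) @ \oo --> mass_ge w v4.
  apply: (@ball_int_cvg _ _ C) => [k||k z|z]; [exact: mT|exact: mpe|exact: bT|].
  apply: (evt z _ (v4 <= enorm z ^+ n)%R%:R); have [vz|zv] := leP v4 (enorm z ^+ n).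
    near=> k; apply: ramp_ge1.
    rewrite opprB addrCA mulrDr /h mulrCA mulfV// mulr1.
    apply: (@le_trans _ _ (2 + 0)); first by rewrite addr0 ler1n.
    by rewrite lerD2l mulr_ge0// subr_ge0.
  near=> k; apply: ramp_le0.
  rewrite opprB addrCA mulrDr /h mulrCA mulfV// mulr1.
  rewrite -opprB mulrN subr_le0; near: k; apply: far; rewrite subr_gt0//.
have lim1 : (fun N => (v4 - 2 * h N - v3) * (ball_int (T1 N) - ball_int (T2 N))) @ \oo -->
    (v4 - 2 * 0 - v3) * (mass_gt w v1 - mass_gt w v2).
  apply: cvgM; last exact: (cvgB l1 (l2 v2)).
  apply: cvgB; last exact: cvg_cst.
  apply: cvgB; first exact: cvg_cst.
  by apply: cvgM; [exact: cvg_cst|].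
have lim2 : (fun N => (v2 - (v1 + h N)) * (ball_int (T3 N) - ball_int (T4 N))) @ \oo -->
    (v2 - (v1 + 0)) * (mass_gt w v3 - mass_ge w v4).
  apply: cvgM; last exact: (cvgB (l2 v3) l4).
  apply: cvgB; first exact: cvg_cst.
  by apply: cvgD; [exact: cvg_cst|].
move: lim1 lim2; rewrite mulr0 subr0 addr0 => lim1 lim2.
apply: (ler_cvg_to lim1 lim2).
near=> N.
have N0 : 0 < N.+1%:R :> R by rewrite ltr0n.
have h0 : 0 < h N by rewrite invr_gt0.
have hN (e : R) : 2 <= N.+1%:R * e -> 2 * h N <= e by rewrite mulrC -ler_pdivrMr.
have e1 : 2 * h N <= v2 - v1 by apply: hN; near: N; apply: far; rewrite subr_gt0.
have e2 : 4 * h N <= v4 - v3.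
  have : 2 * h N <= (v4 - v3) / 2.
    by apply: hN; near: N; apply: far; rewrite divr_gt0// subr_gt0.
  lra.
have bb c : ball_bounded (fun z : 'rV[R]_n => w z * ramp (N.+1%:R * (enorm z ^+ n - c))).
  by split; [exact: mT|exists C => x _; exact: bT].
have := @trapezoid_test w C N.+1%:R (v1 + h N) v2 v3 (v4 - 2 * h N) sw N0.
have -> : ball_int (fun z => w z *
    ((v4 - 2 * h N - v3) * (ramp (N.+1%:R * (enorm z ^+ n - (v1 + h N))) - ramp (N.+1%:R * (enorm z ^+ n - v2)))
     - (v2 - (v1 + h N)) * (ramp (N.+1%:R * (enorm z ^+ n - v3)) - ramp (N.+1%:R * (enorm z ^+ n - (v4 - 2 * h N))))))
  = (v4 - 2 * h N - v3) * (ball_int (T1 N) - ball_int (T2 N)) -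
    (v2 - (v1 + h N)) * (ball_int (T3 N) - ball_int (T4 N)).
  have bB (f g : 'rV[R]_n -> R) (a b : R) : ball_bounded f -> ball_bounded g -> ball_int (fun z => a * f z + b * g z) = a * ball_int f + b * ball_int g.
    by move=> bf bg; rewrite ball_intD ?ball_intZ//; exact: ball_boundedZ.
  have bZ (a b : R) (f g : 'rV[R]_n -> R) : ball_bounded f -> ball_bounded g -> ball_bounded (fun z => a * f z + b * g z).
    by move=> bf bg; apply: ball_boundedD; exact: ball_boundedZ.
  pose a1 := v4 - 2 * h N - v3; pose a2 := v2 - (v1 + h N).
  transitivity (ball_int (fun z => 1 * (a1 * T1 N z + (- a1) * T2 N z) + 1 * (- a2 * T3 N z + a2 * T4 N z))).
    by apply: eq_ball_int => z _; rewrite /T1 /T2 /T3 /T4 /a1 /a2; ring.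
  rewrite (bB _ _ 1 1 (bZ _ _ _ _ (bb _) (bb _)) (bZ _ _ _ _ (bb _) (bb _))).
  rewrite (bB _ _ _ _ (bb _) (bb _)) (bB _ _ _ _ (bb _) (bb _)).
  by rewrite -/(T1 N) -/(T2 N) -/(T3 N) -/(T4 N) /a1 /a2; ring.
have hE : N.+1%:R^-1 = h N by [].
by rewrite subr_le0; apply; rewrite ?hE; clear -v10 v12 v23 v34 v41 h0 e1 e2; lra.
Unshelve. all: by end_near. Qed.

End annuli.

Lemma lebesgue_stieltjes_itv (R : realType) (f : cumulative R R) (a b : R) :
  a <= b -> lebesgue_stieltjes_measure f `]a, b]%classic = (f b - f a)%:E.
Proof.
move=> ab; rewrite /lebesgue_stieltjes_measure /measure_extension/=.
rewrite measurable_mu_extE/=; last exact: is_ocitv.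
by rewrite wlength_itv_bnd.
Qed.

(** * Radial distribution of the mass *)
Section radial_sets.
Context {R : realType} {n : nat}.
Local Notation B := (@eball R n 0 1).
Local Notation omega := (@omega R n).
Local Notation lam := (@lebesgue_rV R n).
Implicit Types (f w : 'rV[R]_n -> R).

(** Proportional to the volume of the centred ball through [z]: in this
coordinate Lebesgue measure is uniform. *)
Definition vol (z : 'rV[R]_n) : R := enorm z ^+ n.

Lemma measurable_vol : measurable_fun setT vol.
Proof. by apply: measurable_funX; exact: measurable_enorm. Qed.

Lemma ball_bounded_vol_indic (E : set R) : measurable E ->
  ball_bounded (fun z : 'rV[R]_n => \1_E (vol z)).
Proof.
move=> mE; split; last first.
  by exists 1 => x _; rewrite indicE; case: (_ \in _); rewrite ?normr1 ?normr0.
by apply: (measurableT_comp (measurable_indic mE)); exact: measurable_vol.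
Qed.

Lemma radial_mass_measure f : ball_bounded f -> (forall z, 0 <= f z) ->
  exists m : {measure set (measurableTypeR R) -> \bar R},
    forall E, measurable E -> m E = (ball_int (fun z => f z * \1_E (vol z)))%:E.
Proof.
move=> bf f0; have [mf _] := bf.
have mB : measurable B by exact: measurable_eball.
pose mu (E : set (measurableTypeR R)) := (\int[lam]_(z in B `&` vol @^-1` E) (f z)%:E)%E.
have mI E : measurable E -> measurable (B `&` vol @^-1` E).
  move=> mE; apply: measurableI => //; rewrite -[X in measurable X]setTI.
  exact: measurable_vol.
have mu0 : mu set0 = 0%E by rewrite /mu preimage_set0 setI0 integral_set0.
have mu_ge0 E : (0 <= mu E)%E by apply: integral_ge0 => z _; rewrite lee_fin.
have mu_sigma : semi_sigma_additive mu.
  move=> F mF tF mUF; rewrite /mu preimage_bigcup setI_bigcupr.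
  rewrite ge0_integral_bigcup//=.
  - by apply: is_cvg_nneseries => k _ _; exact: mu_ge0.
  - by move=> k; apply: mI; exact: mF.
  - exact/measurable_EFinP/measurable_funTS.
  - by move=> z _; rewrite lee_fin.
  - apply/trivIsetP => i j _ _ ij; rewrite setIACA setIid -preimage_setI.
    by move/trivIsetP : tF => /(_ _ _ Logic.I Logic.I ij) ->; rewrite preimage_set0 setI0.
pose mm := isMeasure.Build _ _ _ mu mu0 mu_ge0 mu_sigma.
pose m : {measure set (measurableTypeR R) -> \bar R} := HB.pack mu mm.
exists m => E mE; rewrite -[m E]/(mu E) /mu.
have bE : ball_bounded (fun z => f z * \1_E (vol z)).
  by apply: ball_boundedM => //; exact: ball_bounded_vol_indic.
rewrite -(RintegralE mB (ball_bounded_integrable bE)).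
rewrite integral_mkcondr; apply: eq_integral => z _.
rewrite patchE indicE; case: ifPn => zE.
  by rewrite mem_set ?mulr1//; move: zE; rewrite inE.
by rewrite memNset ?mulr0// => zE'; move/negP : zE; apply; rewrite inE.
Qed.

Lemma mass_gt_right_continuous f (C : R) : measurable_fun setT f ->
  (forall z, 0 <= f z <= C) -> right_continuous (mass_gt f).
Proof.
move=> mf fC r; apply/cvg_at_rightP => u [ur uc].
have mI c : measurable_fun setT (fun z : 'rV[R]_n => f z * (c < enorm z ^+ n)%R%:R).
  apply: measurable_funM => //; apply: (ball_bounded_vol_bool (p := fun v => c < v) _).1.
  exact: measurable_fun_ltr.
apply: (@ball_int_cvg _ _ _ _ C) => [k||k z|z]; [exact: mI|exact: mI| |].
  have /andP[f0 f1] := fC z; rewrite ger0_norm; last by rewrite mulr_ge0.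
  by case: (u k < _) => /=; rewrite ?mulr1 ?mulr0//; exact: le_trans f1.
apply: cvg_near_cst; have [rz|zr] := ltP r (enorm z ^+ n); last first.
  by near=> k; rewrite ltNge (le_trans zr)//= ltW.
have e0 : 0 < enorm z ^+ n - r by rewrite subr_gt0.
near=> k; rewrite (_ : (u k < _) = true)//.
have : `|r - u k| < enorm z ^+ n - r.
  by near: k; move/cvgrPdist_lt : uc => /(_ _ e0).
by rewrite ltr_norml => /andP[]; lra.
Unshelve. all: by end_near. Qed.

Lemma mass_gtB f (a b : R) : ball_bounded f -> a <= b ->
  mass_gt f a - mass_gt f b = ball_int (fun z => f z * \1_(`]a, b]%classic) (vol z)).
Proof.
move=> bf ab.
have bI c : ball_bounded (fun z : 'rV[R]_n => f z * (c < enorm z ^+ n)%R%:R).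
  by apply: ball_boundedM => //; apply: (ball_bounded_vol_bool (p := fun v => c < v)); exact: measurable_fun_ltr.
have bE : ball_bounded (fun z => f z * \1_(`]a, b]%classic) (vol z)).
  by apply: ball_boundedM => //; exact: ball_bounded_vol_indic.
rewrite /mass_gt; apply/eqP; rewrite subr_eq -ball_intD//; apply/eqP.
apply: eq_ball_int => z _; rewrite -mulrDr indicE; congr (_ * _).
have [az|za] := ltP a (vol z).
  have [zb|bz] := leP (vol z) b.
    by rewrite mem_set ?addr0//= in_itv/= az zb.
  by rewrite memNset ?add0r//= in_itv/= az leNgt bz.
rewrite memNset ?add0r; last by rewrite /= in_itv/= ltNge za.
by rewrite ltNge (le_trans za ab).
Qed.

(** The difference of the two tail functions is nondecreasing and right
continuous, hence the distribution function of a Lebesgue-Stieltjes measure;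
by uniqueness the second distribution is the sum of the first one and
of this measure, so the comparison passes from intervals to Borel sets. *)
Lemma ball_int_radial_le f1 f2 (C : R) :
  measurable_fun setT f1 -> measurable_fun setT f2 ->
  (forall z, 0 <= f1 z <= C) -> (forall z, 0 <= f2 z <= C) ->
  (forall a b : R, a <= b -> mass_gt f1 a - mass_gt f1 b <= mass_gt f2 a - mass_gt f2 b) ->
  forall E, measurable E ->
    ball_int (fun z => f1 z * \1_E (vol z)) <= ball_int (fun z => f2 z * \1_E (vol z)).
Proof.
move=> mf1 mf2 f1C f2C f12 E mE.
have bf1 : ball_bounded f1.
  by split => //; exists C => z _; have /andP[? ?] := f1C z; rewrite ger0_norm.
have bf2 : ball_bounded f2.
  by split => //; exists C => z _; have /andP[? ?] := f2C z; rewrite ger0_norm.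
have [m1 m1E] : exists m : {measure set (measurableTypeR R) -> \bar R},
    forall E, measurable E -> m E = (ball_int (fun z => f1 z * \1_E (vol z)))%:E.
  by apply: radial_mass_measure => // z; have /andP[] := f1C z.
have [m2 m2E] : exists m : {measure set (measurableTypeR R) -> \bar R},
    forall E, measurable E -> m E = (ball_int (fun z => f2 z * \1_E (vol z)))%:E.
  by apply: radial_mass_measure => // z; have /andP[] := f2C z.
pose F r := mass_gt f1 r - mass_gt f2 r.
have ndF : nondecreasing F by move=> a b ab; have := f12 a b ab; rewrite /F; lra.
have rcF : right_continuous F.
  by move=> r; apply: cvgB; [exact: mass_gt_right_continuous f1C r|exact: mass_gt_right_continuous f2C r].
pose mixF := isCumulative.Build R _ R F ndF rcF.
pose cF : cumulative R R := HB.pack F mixF.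
pose ls : {measure set (measurableTypeR R) -> \bar R} := lebesgue_stieltjes_measure cF.
have H : m2 E = measure_add m1 ls E.
  pose g (k : nat) : set (measurableTypeR R) := `](- k%:R), k%:R]%classic.
  pose ms : {measure set (measurableTypeR R) -> \bar R} := measure_add m1 ls.
  have := @measure_unique _ R (measurableTypeR R) (@ocitv R) g _ _ _ _ m2 ms.
  apply => //.
  - exact: ocitvI.
  - by move=> k; exact: is_ocitv.
  - apply/seteqP; split => // x _; exists (Num.truncn `|x|).+1 => //=.
    rewrite /g/= in_itv/=; have := truncnS_gt `|x|; rewrite ltr_norml => /andP[-> /ltW ->].
    by [].
  - move=> _ [[a b] _ <-] /=.
    have mI : measurable (`]a, b]%classic : set (measurableTypeR R)) by exact: measurable_itv.
    have [ab|ba] := leP a b; last by rewrite set_itv_ge ?measure0// bnd_simp -leNgt ltW.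
    rewrite -[ms _]/(measure_add m1 ls _) measure_addE m1E// m2E// -!mass_gtB//.
    have -> : ls `]a, b]%classic = (F b - F a)%:E.
      exact: (lebesgue_stieltjes_itv cF ab).
    by rewrite -EFinD /F; congr (_%:E); ring.
  - move=> k; rewrite m2E; last exact: measurable_itv.
    by rewrite ltry.
by rewrite -lee_fin -m1E// -m2E// H measure_addE leeDl.
Qed.

End radial_sets.

Section radial_functions.
Context {R : realType} {n : nat}.
Local Notation B := (@eball R n 0 1).
Local Notation omega := (@omega R n).
Local Notation lam := (@lebesgue_rV R n).
Implicit Types (f w : 'rV[R]_n -> R) (h : R -> R).

Lemma ball_bounded_vol h (M : R) : measurable_fun setT h -> (forall v, 0 <= h v <= M) ->
  ball_bounded (fun z : 'rV[R]_n => h (vol z)).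
Proof.
move=> mh hM; split; first exact: (measurableT_comp mh measurable_vol).
by exists M => x _; have /andP[? ?] := hM (vol x); rewrite ger0_norm.
Qed.

Lemma ball_int_ge0 f : (forall z, 0 <= f z) -> 0 <= ball_int f.
Proof. by move=> f0; apply: Rintegral_ge0 => z _. Qed.

(** The layer-cake formula for integers. *)
Lemma sum_levels (K t : nat) : (t <= K)%N -> \sum_(j < K) (j < t)%N%:R = t%:R :> R.
Proof.
elim: K t => [|K IH] t tK; first by move: tK; rewrite leqn0 => /eqP ->; rewrite big_ord0.
rewrite big_ord_recr/=; move: tK; rewrite leq_eqVlt => /orP[/eqP ->|]; last first.
  by rewrite ltnS => tK; rewrite IH// ltnNge tK addr0.
rewrite ltnSn -natr1; congr (_ + _); rewrite -[RHS](IH K (leqnn K)).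
by apply: eq_bigr => j _; rewrite ltnS ltnW//= ltn_ord.
Qed.

(** Approximate [h] uniformly by the staircase with steps of height [1 / N],
a combination of indicators of level sets. *)
Lemma radial_function_ge0 f h (M : R) : ball_bounded f ->
  measurable_fun setT h -> (forall v, 0 <= h v <= M) ->
  (forall E, measurable E -> 0 <= ball_int (fun z => f z * \1_E (vol z))) ->
  0 <= ball_int (fun z => f z * h (vol z)).
Proof.
move=> bf mh hM fE; have [mf [K fK]] := bf.
have bh := ball_bounded_vol mh hM.
have bfh := ball_boundedM bf bh.
have om0 : 0 <= omega by rewrite fine_ge0.
apply/ler_addgt0Pr => e e0.
have [N Ne] : exists N : nat, `|K| * omega / N.+1%:R <= e.
  exists (Num.truncn (e^-1 * (`|K| * omega))).
  rewrite ler_pdivrMr ?ltr0n// -ler_pdivrMl//.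
  by rewrite ltW// truncnS_gt.
have N0 : 0 < N.+1%:R :> R by rewrite ltr0n.
pose J := Num.truncn (N.+1%:R * M).
pose E (j : nat) : set R := [set v | j.+1%:R <= N.+1%:R * h v].
have mE j : measurable (E j).
  have mNh : measurable_fun setT (fun v : R => N.+1%:R * h v).
    by apply: measurable_funM => //; exact: measurable_cst.
  have mj : measurable_fun setT (fun v : R => j.+1%:R : R) by exact: measurable_cst.
  have := measurable_fun_ler mj mNh.
  have m1 : measurable ([set true] : set bool) by [].
  move=> /(_ measurableT _ m1); rewrite setTI.
  by congr measurable; apply/seteqP; split => v /=.
pose hN (v : R) : R := N.+1%:R^-1 * \sum_(j < J) \1_(E j) v.
have hNE v : hN v = N.+1%:R^-1 * (Num.truncn (N.+1%:R * h v))%:R.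
  rewrite /hN -(@sum_levels J (Num.truncn (N.+1%:R * h v))); last first.
    by rewrite /J le_truncn// ler_pM2l//; have /andP[] := hM v.
  congr (_ * _); apply: eq_bigr => j _; rewrite indicE truncn_gt_nat.
  by congr ((_ : bool)%:R); apply/idP/idP; rewrite inE.
have hNle v : `|h v - hN v| <= N.+1%:R^-1.
  have h0 : 0 <= N.+1%:R * h v by rewrite mulr_ge0//; have /andP[] := hM v.
  have /andP[t1 t2] := truncn_itv h0.
  have -> : h v - hN v = N.+1%:R^-1 * (N.+1%:R * h v - (Num.truncn (N.+1%:R * h v))%:R).
    by rewrite hNE mulrBr mulKf// gt_eqF.
  rewrite normrM gtr0_norm ?invr_gt0// -[leRHS]mulr1 ler_wpM2l ?invr_ge0//.
  by rewrite ger0_norm ?subr_ge0// lerBlDl natr1 ltW.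
have bE j : ball_bounded (fun z : 'rV[R]_n => f z * \1_(E j) (vol z)).
  by apply: ball_boundedM => //; exact: ball_bounded_vol_indic.
have bhN : ball_bounded (fun z : 'rV[R]_n => hN (vol z)).
  apply: ball_boundedZ; apply: (@ball_bounded_sum _ _ _ _ (fun j z => \1_(E (nat_of_ord j)) (vol z))) => j.
  exact: ball_bounded_vol_indic.
have bfN := ball_boundedM bf bhN.
have fN0 : 0 <= ball_int (fun z => f z * hN (vol z)).
  have -> : ball_int (fun z => f z * hN (vol z)) =
      ball_int (fun z => N.+1%:R^-1 * \sum_(j < J) f z * \1_(E j) (vol z)).
    by apply: eq_ball_int => z _; rewrite /hN -mulr_sumr mulrCA.
  rewrite ball_intZ; last exact: (@ball_bounded_sum _ _ _ _ (fun j z => f z * \1_(E (nat_of_ord j)) (vol z))).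
  rewrite (@ball_int_sum _ _ _ _ (fun j z => f z * \1_(E (nat_of_ord j)) (vol z)))//.
  by rewrite mulr_ge0 ?invr_ge0// sumr_ge0// => j _; exact: fE.
apply: le_trans fN0 _; apply: le_trans (_ : _ <= ball_int (fun z => f z * h (vol z) + `|K| / N.+1%:R)) _.
  apply: le_ball_int => //; first exact: ball_boundedD bfh (ball_bounded_cst _).
  move=> z /fK fz; rewrite -lerBlDl -mulrBr (le_trans (ler_norm _))// normrM.
  by rewrite ler_pM// ?(le_trans fz (ler_norm _))// distrC.
rewrite ball_intD//; last exact: ball_bounded_cst.
by rewrite ball_int_cst lerD2l mulrAC.
Qed.

End radial_functions.

Section radial_mean.
Context {R : realType} {n : nat}.
Hypothesis n0 : (0 < n)%N.
Local Notation B := (@eball R n 0 1).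
Local Notation omega := (@omega R n).
Local Notation lam := (@lebesgue_rV R n).
Implicit Types (f w : 'rV[R]_n -> R) (h : R -> R).

Let one : 'rV[R]_n -> R := fun=> 1.

Let om0 : 0 < omega. Proof. exact: omega_gt0. Qed.

Lemma vol_lt1 z : B z -> vol z < 1.
Proof.
by rewrite /eball/= subr0 => z1; rewrite /vol exprn_ilt1 ?enorm_ge0// -lt0n.
Qed.

Lemma ball_bounded_vol_gt (c : R) : ball_bounded (fun z : 'rV[R]_n => (c < enorm z ^+ n)%R%:R).
Proof. by apply: (ball_bounded_vol_bool (p := fun v => c < v)); exact: measurable_fun_ltr. Qed.

Lemma ball_bounded_vol_ge (c : R) : ball_bounded (fun z : 'rV[R]_n => (c <= enorm z ^+ n)%R%:R).
Proof. by apply: (ball_bounded_vol_bool (p := fun v => c <= v)); exact: measurable_fun_ler. Qed.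

Lemma mass_gt_out f (c : R) : 1 <= c -> mass_gt f c = 0.
Proof.
move=> c1; rewrite /mass_gt (@eq_ball_int _ _ _ (fun=> 0)) ?ball_int_cst ?mul0r// => z /vol_lt1 z1.
by rewrite ltNge (le_trans (ltW z1) c1) mulr0.
Qed.

Lemma mass_ge_out f (c : R) : 1 <= c -> mass_ge f c = 0.
Proof.
move=> c1; rewrite /mass_ge (@eq_ball_int _ _ _ (fun=> 0)) ?ball_int_cst ?mul0r// => z /vol_lt1 z1.
by rewrite leNgt (lt_le_trans z1 c1) mulr0.
Qed.

(** The complement is the open ball of radius [s]. *)
Lemma mass_ge_expn s : 0 < s <= 1 -> mass_ge one (s ^+ n) = omega * (1 - s ^+ n).
Proof.
move=> /andP[s0 s1].
have E : ball_int (fun z : 'rV[R]_n => 1 - (s ^+ n <= enorm z ^+ n)%R%:R) = omega * s ^+ n.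
  transitivity (\int[lam]_(z in B `&` eball 0 s) (1 : R)).
    rewrite Rintegral_mkcondr -[RHS]/(ball_int _); apply: eq_ball_int => z _; rewrite patchE.
    have -> : (z \in eball 0 s) = (enorm z < s).
      by apply/idP/idP; rewrite inE /eball/= subr0.
    rewrite ler_pXn2r// ?nnegrE ?enorm_ge0 ?(ltW s0)//.
    by rewrite ltNge; case: (s <= _); rewrite /= ?subrr ?subr0.
  rewrite setIidr; last by move=> z; rewrite /eball/= => /lt_le_trans; apply.
  rewrite Rintegral_cst; last exact: measurable_eball.
  by rewrite mul1r lebesgue_eball.
move: E; have b1 := @ball_bounded_cst R n 1.
have -> : ball_int (fun z : 'rV[R]_n => 1 - (s ^+ n <= enorm z ^+ n)%R%:R) =
   ball_int (fun z : 'rV[R]_n => 1 + - 1 * (s ^+ n <= enorm z ^+ n)%R%:R).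
  by apply: eq_ball_int => z _; rewrite mulN1r.
rewrite ball_intD//; last by apply: ball_boundedZ; exact: ball_bounded_vol_ge.
rewrite ball_int_cst ball_intZ; last exact: ball_bounded_vol_ge.
rewrite /mass_ge /one.
have -> : ball_int (fun z : 'rV[R]_n => 1 * (s ^+ n <= enorm z ^+ n)%R%:R) =
  ball_int (fun z : 'rV[R]_n => (s ^+ n <= enorm z ^+ n)%R%:R).
  by apply: eq_ball_int => z _; rewrite mul1r.
lra.
Qed.

Lemma root_itv (c : R) : 0 < c <= 1 -> exists2 s, 0 < s <= 1 & s ^+ n = c.
Proof.
move=> /andP[c0 c1]; exists (c `^ n%:R^-1).
  rewrite powR_gt0//= -[leRHS](_ : 1 `^ n%:R^-1 = 1); last by rewrite powR1.
  by apply: ge0_ler_powR; rewrite ?invr_ge0// ?nnegrE// ltW.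
rewrite -powR_mulrn ?powR_ge0// -powRrM mulVf ?pnatr_eq0 -?lt0n//.
by rewrite powRr1// ltW.
Qed.

Lemma mass_ge_one (c : R) : 0 < c <= 1 -> mass_ge one c = omega * (1 - c).
Proof. by move=> /root_itv[s s01 <-]; exact: mass_ge_expn. Qed.

(** The centred spheres are negligible, seen by comparison with the weak tail at
slightly larger levels. *)
Lemma mass_gt_one (c : R) : 0 <= c <= 1 -> mass_gt one c = omega * (1 - c).
Proof.
move=> /andP[c0 c1].
have b1 := @ball_bounded_cst R n 1.
have bg d : ball_bounded (fun z => one z * (d < enorm z ^+ n)%R%:R).
  by apply: ball_boundedM => //; exact: ball_bounded_vol_gt.
have be d : ball_bounded (fun z => one z * (d <= enorm z ^+ n)%R%:R).
  by apply: ball_boundedM => //; exact: ball_bounded_vol_ge.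
apply/eqP; rewrite eq_le; apply/andP; split.
  have [->|cn0] := eqVneq c 0; last first.
    have {}c0 : 0 < c by rewrite lt_neqAle eq_sym cn0.
    rewrite -mass_ge_one ?c0//; apply: le_ball_int => // z _.
    by rewrite ler_wpM2l// ler_nat; case: ltgtP.
  rewrite subr0 mulr1 -[leRHS]mul1r -ball_int_cst; apply: le_ball_int => // z _.
  by rewrite /one mul1r lern1 leq_b1.
apply/ler_addgt0Pr => e e0.
pose c' := Num.min 1 (c + e / omega).
have [c1'|c1'] := ltP c 1; last first.
  rewrite (_ : c = 1) ?subrr ?mulr0; last by apply/eqP; rewrite eq_le c1 c1'.
  by rewrite addr_ge0 ?(ltW e0)// ball_int_ge0// => z; rewrite mulr_ge0.
have cc' : c < c' by rewrite lt_min c1' ltrDl divr_gt0.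
have c'1 : c' <= 1 by rewrite ge_min lexx.
have H : mass_ge one c' <= mass_gt one c.
  apply: le_ball_int => // z _; rewrite ler_wpM2l// ler_nat.
  by have [|//] := leP c' (enorm z ^+ n); move/(lt_le_trans cc') => ->.
rewrite mass_ge_one in H; last by rewrite (le_lt_trans c0 cc').
have : omega * (c' - c) <= e.
  by rewrite mulrC -ler_pdivlMr// lerBlDl ge_min lexx orbT.
lra.
Qed.

(** The integral over the ball of radius [s] and the mass of [0 < v <= s ^+ n]
differ at the origin and on a sphere; the origin has no mass because the tail of
the constant function at level 0 is the whole volume. *)
Lemma small_ball_mass w C s : submean_ball w C -> 0 < s <= 1 ->
  s ^+ n * ball_int (fun x => w (s *: x)) <= mass_gt w 0 - mass_gt w (s ^+ n).
Proof.
move=> sw /andP[s0 s1]; have [mw wC _ _] := sw.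
have bw := submean_ball_bounded sw.
have w0 x : 0 <= w x by have /andP[] := wC x.
have mB : measurable B by exact: measurable_eball.
have sn1 : 0 < s ^+ n <= 1 by rewrite exprn_gt0//= expr_le1// ltW.
have bws : ball_bounded (fun x => w (s *: x)).
  split; last by exists C => x _; rewrite ger0_norm//; have /andP[] := wC (s *: x).
  apply: (measurableT_comp mw).
  have := measurable_affine (0 : 'rV[R]_n) s.
  by under eq_fun do rewrite add0r.
have blt : ball_bounded (fun z : 'rV[R]_n => (enorm z < s)%R%:R).
  split; last by exists 1 => x _; case: (_ < _); rewrite ?normr1 ?normr0.
  rewrite (_ : (fun _ => _) = (fun z : 'rV[R]_n => if enorm z < s then 1 else 0)).
    apply: measurable_fun_ifT => //.
    by apply: measurable_fun_ltr => //; exact: measurable_enorm.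
  by apply/funext => z; case: (_ < _).
have E : s ^+ n * ball_int (fun x => w (s *: x)) = ball_int (fun z => w z * (enorm z < s)%R%:R).
  rewrite /ball_int; apply: EFin_inj.
  rewrite EFinM -(RintegralE mB (ball_bounded_integrable bws)).
  rewrite -(RintegralE mB (ball_bounded_integrable (ball_boundedM bw blt))).
  have ms : measurable (eball (0 : 'rV[R]_n) s) by exact: measurable_eball.
  have mws : measurable_fun (eball (0 : 'rV[R]_n) s) (EFin \o w).
    exact/measurable_EFinP/measurable_funTS.
  have := @ge0_integral_affine R n 0 s (EFin \o w) _ s0 ms mws.
  move=> H; transitivity (\int[lam]_(z in eball (0 : 'rV[R]_n) s) (EFin \o w) z)%E.
    rewrite H; last by move=> x _; rewrite lee_fin.
    congr (_ * _)%E; under [RHS]eq_integral do rewrite /= add0r.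
    congr (integral _ _ _); apply/seteqP; split => x; rewrite /eball/= add0r !subr0 enormZ gtr0_norm//.
      by move=> x1; rewrite gtr_pMr.
    by rewrite gtr_pMr.
  have -> : eball (0 : 'rV[R]_n) s = B `&` eball 0 s.
    by rewrite setIidr// => z; rewrite /eball/= => /lt_le_trans; apply.
  rewrite integral_mkcondr; apply: eq_integral => z _; rewrite patchE.
  have -> : (z \in eball 0 s) = (enorm z < s).
    by apply/idP/idP; rewrite inE /eball/= subr0.
  by case: (_ < _); rewrite ?mulr1 ?mulr0.
rewrite E (mass_gtB bw); last by case/andP : sn1 => /ltW.
have bI : ball_bounded (fun z => w z * \1_(`]0%R, s ^+ n]%classic) (vol z)).
  by apply: ball_boundedM => //; exact: ball_bounded_vol_indic.
have bg := @ball_bounded_vol_gt 0.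
have bC : ball_bounded (fun z : 'rV[R]_n => C + - C * (0 < enorm z ^+ n)%R%:R).
  by apply: ball_boundedD; [exact: ball_bounded_cst|exact: ball_boundedZ].
have Z : ball_int (fun z : 'rV[R]_n => C + - C * (0 < enorm z ^+ n)%R%:R) = 0.
  rewrite ball_intD; [|exact: ball_bounded_cst|exact: ball_boundedZ].
  rewrite ball_int_cst ball_intZ//.
  have := @mass_gt_one 0; rewrite lexx ler01 subr0 mulr1 => /(_ isT).
  rewrite /mass_gt /one.
  have -> : ball_int (fun z : 'rV[R]_n => 1 * (0 < enorm z ^+ n)%R%:R) =
    ball_int (fun z : 'rV[R]_n => (0 < enorm z ^+ n)%R%:R).
    by apply: eq_ball_int => z _; rewrite mul1r.
  by move=> ->; rewrite mulNr subrr.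
rewrite -[leRHS]addr0 -[X in _ <= _ + X]Z -(ball_intD bI bC).
apply: le_ball_int; [exact: ball_boundedM|exact: ball_boundedD|move=> z _].
have /andP[wz0 wzC] := wC z.
have [zs|zs] := ltP (enorm z) s; last first.
  rewrite mulr0 addr_ge0//.
    by rewrite indicE mulr_ge0.
  by case: (0 < _); rewrite ?mulr1 ?mulr0 ?subrr ?addr0//; exact: le_trans wzC.
rewrite mulr1 indicE; have [z0|z0] := ltP 0 (enorm z ^+ n).
  rewrite mem_set ?mulr1 ?subrr ?addr0//= in_itv/= z0/=.
  by rewrite ler_pXn2r ?nnegrE ?enorm_ge0 ?(ltW s0)// ltW.
by rewrite mulr0 addr0 (le_trans wzC)// lerDr mulr_ge0.
Qed.

(** Beyond the ball of radius [s], the mass of [w] in any annulus is at least that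
of the constant equal to the average of [w] over this ball. The annulus
inequality leaves the outer sphere out, and letting the outer level decrease to
[b] recovers it. *)
Lemma mean_mass_le w C s (a b : R) : submean_ball w C -> 0 < s <= 1 ->
  s ^+ n <= a -> a <= b ->
  ball_int (fun x => w (s *: x)) / omega * (mass_gt one a - mass_gt one b) <= mass_gt w a - mass_gt w b.
Proof.
move=> sw s01 sa ab; have [mw wC _ _] := sw.
have bw := submean_ball_bounded sw.
have w0 x : 0 <= w x by have /andP[] := wC x.
have /andP[s0 s1] := s01.
have sn0 : 0 < s ^+ n by rewrite exprn_gt0.
set m := ball_int (fun x => w (s *: x)).
have m0 : 0 <= m by exact: ball_int_ge0.
have C0 : 0 <= C by have /andP[/le_trans] := wC 0; apply.
have H b' : a < b' <= 1 -> (b' - a) * m <= mass_gt w a - mass_ge w b'.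
  move=> /andP[ab' b'1].
  have := annulus_mean_le n0 sw (lexx 0) sn0 sa ab' b'1; rewrite subr0 => H.
  rewrite -(ler_pM2l sn0); apply: le_trans H.
  rewrite mulrCA ler_wpM2l// ?subr_ge0 ?(ltW ab')//.
  exact: small_ball_mass sw s01.
have [a1|a1] := leP 1 a.
  by rewrite !mass_gt_out// ?(le_trans a1)// !subrr mulr0.
have a0 : 0 < a by exact: lt_le_trans sa.
have aE : mass_gt one a = omega * (1 - a) by rewrite mass_gt_one// !ltW.
have mE x : m / omega * (omega * x) = x * m by field; rewrite gt_eqF.
have [b1|b1] := leP 1 b.
  rewrite !(mass_gt_out _ b1) !subr0 aE mE.
  have := H 1; rewrite a1 lexx => /(_ isT).
  by rewrite mass_ge_out// subr0.
have bE : mass_gt one b = omega * (1 - b) by rewrite mass_gt_one// !ltW// (lt_le_trans a0).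
rewrite aE bE -mulrBr mE (_ : 1 - a - (1 - b) = b - a); last by ring.
have [->|anb] := eqVneq a b; first by rewrite !subrr mul0r.
have {anb}ab : a < b by rewrite lt_neqAle anb.
apply/ler_addgt0Pr => e e0.
pose b' := Num.min 1 (b + e / (C * omega + 1)).
have Cp : 0 < C * omega + 1 by rewrite ltr_wpDl// mulr_ge0// ltW.
have bb' : b < b' by rewrite lt_min b1 ltrDl divr_gt0.
have b'1 : b' <= 1 by rewrite ge_min lexx.
have ab' : a < b' by exact: lt_trans bb'.
have := H b'; rewrite ab' b'1 => /(_ isT) {}H.
have H2 : mass_gt w b - mass_ge w b' <= C * (mass_gt one b - mass_ge one b').
  have bgt f c : ball_bounded f -> ball_bounded (fun z => f z * (c < enorm z ^+ n)%R%:R).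
    by move=> bf; apply: ball_boundedM => //; exact: ball_bounded_vol_gt.
  have bge f c : ball_bounded f -> ball_bounded (fun z => f z * (c <= enorm z ^+ n)%R%:R).
    by move=> bf; apply: ball_boundedM => //; exact: ball_bounded_vol_ge.
  have b1' := @ball_bounded_cst R n 1.
  have g1 := bgt _ b bw; have g2 := bgt _ b b1'.
  have g3 := bge _ b' bw; have g4 := bge _ b' b1'.
  suff : ball_int (fun z => w z * (b < enorm z ^+ n)%R%:R + C * (one z * (b' <= enorm z ^+ n)%R%:R))
     <= ball_int (fun z => C * (one z * (b < enorm z ^+ n)%R%:R) + w z * (b' <= enorm z ^+ n)%R%:R).
    rewrite (ball_intD g1 (ball_boundedZ C g4)) (ball_intD (ball_boundedZ C g2) g3).
    by rewrite (ball_intZ C g4) (ball_intZ C g2) /mass_gt /mass_ge; clear; lra.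
  apply: le_ball_int.
  - exact: ball_boundedD g1 (ball_boundedZ C g4).
  - exact: ball_boundedD (ball_boundedZ C g2) g3.
  move=> z _; have /andP[wz0 wzC] := wC z; rewrite /one.
  have [bz|zb] := ltP b (enorm z ^+ n); have [b'z|zb'] := leP b' (enorm z ^+ n);
    rewrite ?mulr1 ?mulr0 ?addr0//.
  - by rewrite addrC.
  - by have := lt_le_trans bb' (le_trans b'z zb); rewrite ltxx.
have bE' : mass_ge one b' = omega * (1 - b') by rewrite mass_ge_one// b'1 (lt_trans a0).
have : C * (mass_gt one b - mass_ge one b') <= e.
  rewrite bE bE' -mulrBr (_ : 1 - b - (1 - b') = b' - b); last by ring.
  have d : b' - b <= e / (C * omega + 1) by rewrite lerBlDl ge_min lexx orbT.
  rewrite mulrA; apply: le_trans (_ : C * omega * (e / (C * omega + 1)) <= _).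
    by rewrite ler_wpM2l// mulr_ge0// ltW.
  by rewrite mulrA ler_pdivrMr// mulrC ler_wpM2l ?(ltW e0)// lerDl.
have : (b - a) * m <= (b' - a) * m by rewrite ler_wpM2r// lerD2r ltW.
lra.
Qed.

End radial_mean.

(** * Averages against radial kernels *)
Section radial_kernels.
Context {R : realType} {n : nat}.
Hypothesis n0 : (0 < n)%N.
Local Notation B := (@eball R n 0 1).
Local Notation omega := (@omega R n).
Local Notation lam := (@lebesgue_rV R n).
Implicit Types (f w rho : 'rV[R]_n -> R) (h : R -> R).

Let one : 'rV[R]_n -> R := fun=> 1.

Let om0 : 0 < omega. Proof. exact: omega_gt0. Qed.

Definition mean_ball w (s : R) := ball_int (fun x => w (s *: x)) / omega.

Let cut (c : R) (z : 'rV[R]_n) : R := (c < enorm z ^+ n)%R%:R.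

Let cut01 c z : 0 <= cut c z <= 1.
Proof. by rewrite /cut; case: (_ < _); rewrite !lexx ?ler01. Qed.

Let mass_gt_cut f (c a : R) : mass_gt (fun z => f z * cut c z) a = mass_gt f (Num.max a c).
Proof.
apply: eq_ball_int => z _; rewrite /cut -mulrA -natrM mulnb gt_max andbC.
by [].
Qed.

(** The comparison of the two radial distributions on all Borel sets of radii
integrates against any nonnegative bounded profile [h]. *)
Lemma mean_ball_radial_le w C s h (M : R) : submean_ball w C -> 0 < s <= 1 ->
  measurable_fun setT h -> (forall v, 0 <= h v <= M) ->
  mean_ball w s * ball_int (fun z => cut (s ^+ n) z * h (vol z)) <=
  ball_int (fun z => w z * (cut (s ^+ n) z * h (vol z))).
Proof.
move=> sw s01 mh hM; have [mw wC _ _] := sw.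
have bw := submean_ball_bounded sw.
have bcut := @ball_bounded_vol_gt R n (s ^+ n).
have bh := ball_bounded_vol (n := n) mh hM.
set m := mean_ball w s.
have m0 : 0 <= m.
  apply: divr_ge0; last exact: ltW.
  by apply: ball_int_ge0 => z; have /andP[] := wC (s *: z).
pose f1 z := m * cut (s ^+ n) z.
pose f2 z := w z * cut (s ^+ n) z.
have b1 : ball_bounded f1 by exact: ball_boundedZ.
have b2 : ball_bounded f2 by exact: ball_boundedM.
have [mf1 _] := b1; have [mf2 _] := b2.
have K E : measurable E -> ball_int (fun z => f1 z * \1_E (vol z)) <= ball_int (fun z => f2 z * \1_E (vol z)).
  apply: (@ball_int_radial_le R n f1 f2 (C + m)) => //.
  - move=> z; have /andP[c0 c1] := cut01 (s ^+ n) z; have /andP[w0 w1] := wC z.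
    by rewrite mulr_ge0//= /f1; nra.
  - move=> z; have /andP[c0 c1] := cut01 (s ^+ n) z; have /andP[w0 w1] := wC z.
    by rewrite mulr_ge0//= /f2; nra.
  - move=> a b ab.
    have -> : mass_gt f1 a = m * mass_gt one (Num.max a (s ^+ n)).
      rewrite -(mass_gt_cut one) /mass_gt -ball_intZ; last first.
        apply: ball_boundedM; last exact: ball_bounded_vol_gt.
        by apply: ball_boundedM => //; exact: ball_bounded_cst.
      by apply: eq_ball_int => z _; rewrite /f1 /one; ring.
    have -> : mass_gt f1 b = m * mass_gt one (Num.max b (s ^+ n)).
      rewrite -(mass_gt_cut one) /mass_gt -ball_intZ; last first.
        apply: ball_boundedM; last exact: ball_bounded_vol_gt.
        by apply: ball_boundedM => //; exact: ball_bounded_cst.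
      by apply: eq_ball_int => z _; rewrite /f1 /one; ring.
    rewrite !mass_gt_cut -mulrBr; apply: (mean_mass_le n0 sw s01).
      by rewrite le_max lexx orbT.
    by rewrite ge_max !le_max ab lexx !orbT.
have b21 : ball_bounded (fun z => f2 z + - 1 * f1 z).
  by apply: ball_boundedD => //; exact: ball_boundedZ.
have : 0 <= ball_int (fun z => (f2 z + - 1 * f1 z) * h (vol z)).
  apply: (radial_function_ge0 b21 mh hM) => E mE.
  have bE := @ball_bounded_vol_indic R n E mE.
  have -> : ball_int (fun z => (f2 z + - 1 * f1 z) * \1_E (vol z)) =
    ball_int (fun z => f2 z * \1_E (vol z) + - 1 * (f1 z * \1_E (vol z))).
    by apply: eq_ball_int => z _; ring.
  have c1 := ball_boundedM b1 bE; have c2 := ball_boundedM b2 bE.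
  rewrite (ball_intD c2 (ball_boundedZ _ c1)) (ball_intZ _ c1) mulN1r subr_ge0.
  exact: K.
have ch := ball_boundedM bcut bh.
have -> : ball_int (fun z => (f2 z + - 1 * f1 z) * h (vol z)) =
    ball_int (fun z => w z * (cut (s ^+ n) z * h (vol z)) + - m * (cut (s ^+ n) z * h (vol z))).
  by apply: eq_ball_int => z _; rewrite /f1 /f2; ring.
rewrite (ball_intD (ball_boundedM bw ch) (ball_boundedZ _ ch)) (ball_intZ _ ch).
by rewrite mulNr subr_ge0.
Qed.

Lemma submean_center w C s : submean_ball w C -> 0 < s <= 1 -> w 0 <= mean_ball w s.
Proof.
move=> [mw wC _ wsub] /andP[s0 s1].
rewrite ler_pdivlMr// -lee_fin.
have bws : ball_bounded (fun x => w (s *: x)).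
  split; last by exists C => x _; rewrite ger0_norm//; have /andP[] := wC (s *: x).
  apply: (measurableT_comp mw).
  have := measurable_affine (0 : 'rV[R]_n) s.
  by under eq_fun do rewrite add0r.
have mB : measurable B by exact: measurable_eball.
rewrite -(RintegralE mB (ball_bounded_integrable bws)).
apply: le_trans (wsub 0 s s0 _) _; first by rewrite enorm0 add0r.
by under eq_integral do rewrite add0r.
Qed.

Lemma kernel_mass_small_ball h (M s : R) : measurable_fun setT h -> (forall v, 0 <= h v <= M) ->
  0 < s <= 1 ->
  ball_int (fun z : 'rV[R]_n => h (vol z)) - ball_int (fun z => cut (s ^+ n) z * h (vol z))
    <= M * (omega * s ^+ n).
Proof.
move=> mh hM /andP[s0 s1].
have bh := ball_bounded_vol (n := n) mh hM.
have bcut := @ball_bounded_vol_gt R n (s ^+ n).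
have ch := ball_boundedM bcut bh.
have b1 := @ball_bounded_cst R n M.
have bo := @ball_bounded_cst R n 1.
have -> : M * (omega * s ^+ n) = ball_int (fun z : 'rV[R]_n => M + - M * cut (s ^+ n) z).
  rewrite (ball_intD b1 (ball_boundedZ _ bcut)) (ball_intZ _ bcut) ball_int_cst.
  have := @mass_gt_one R n n0 (s ^+ n).
  rewrite exprn_ge0 ?(ltW s0)//= expr_le1 ?(ltW s0)// => /(_ s1).
  rewrite /mass_gt; have -> : ball_int (fun z : 'rV[R]_n => 1 * (s ^+ n < enorm z ^+ n)%R%:R) = ball_int (cut (s ^+ n)).
    by apply: eq_ball_int => z _; rewrite mul1r.
  by move=> ->; ring.
rewrite lerBlDr -(ball_intD (ball_boundedD b1 (ball_boundedZ _ bcut)) ch).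
apply: le_ball_int => //; first exact: ball_boundedD (ball_boundedD b1 (ball_boundedZ _ bcut)) ch.
move=> z _; have /andP[h0 h1] := hM (vol z).
by rewrite /cut; case: (_ < _); rewrite ?mulr1 ?mulr0 ?mul1r ?mul0r ?subrr ?addr0 ?add0r.
Qed.

(** The value at the centre is at most the average over a tiny ball, which
is compared with the kernel outside that ball; the mass of the kernel inside is
negligible. *)
Lemma center_radial_le w C h (M : R) : submean_ball w C ->
  measurable_fun setT h -> (forall v, 0 <= h v <= M) ->
  w 0 * ball_int (fun z : 'rV[R]_n => h (vol z)) <= ball_int (fun z => w z * h (vol z)).
Proof.
move=> sw mh hM; have [mw wC _ _] := sw.
have /andP[w00 _] := wC 0.
have bw := submean_ball_bounded sw.
have bh := ball_bounded_vol (n := n) mh hM.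
have M0 : 0 <= M by have /andP[/le_trans] := hM 0; apply.
apply/ler_addgt0Pr => e e0.
pose d := w 0 * M * omega + 1.
have d0 : 0 < d by rewrite ltr_wpDl// !mulr_ge0// ltW.
pose s := Num.min 1 (e / d).
have s0 : 0 < s by rewrite lt_min ltr01 divr_gt0.
have s1 : s <= 1 by rewrite ge_min lexx.
have s01 : 0 < s <= 1 by rewrite s0.
have bcut := @ball_bounded_vol_gt R n (s ^+ n).
have ch := ball_boundedM bcut bh.
have H1 := mean_ball_radial_le sw s01 mh hM.
have H2 := submean_center sw s01.
have H3 := kernel_mass_small_ball mh hM s01.
have c0 : 0 <= ball_int (fun z => cut (s ^+ n) z * h (vol z)).
  apply: ball_int_ge0 => z; have /andP[h0 _] := hM (vol z).
  by have /andP[c0 _] := cut01 (s ^+ n) z; exact: mulr_ge0.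
have H4 : ball_int (fun z => w z * (cut (s ^+ n) z * h (vol z))) <= ball_int (fun z => w z * h (vol z)).
  apply: le_ball_int; [exact: ball_boundedM|exact: ball_boundedM|move=> z _].
  have /andP[wz0 _] := wC z; have /andP[_ c1] := cut01 (s ^+ n) z; have /andP[h0 _] := hM (vol z).
  by rewrite ler_wpM2l// -[leRHS]mul1r ler_wpM2r.
have H5 : w 0 * ball_int (fun z => cut (s ^+ n) z * h (vol z)) <=
    mean_ball w s * ball_int (fun z => cut (s ^+ n) z * h (vol z)) by rewrite ler_wpM2r.
have H6 := ler_wpM2l w00 H3.
have sns : s ^+ n <= s.
  by rewrite -{1}(prednK n0) exprS ger_pMr//; apply: exprn_ile1 => //; exact: ltW.
have H7 : w 0 * (M * (omega * s ^+ n)) <= e.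
  rewrite !mulrA; apply: le_trans (_ : w 0 * M * omega * s <= _).
    by rewrite ler_wpM2l// !mulr_ge0// ltW.
  apply: le_trans (_ : d * s <= _); first by rewrite ler_wpM2r ?(ltW s0)// lerDl.
  by rewrite mulrC -ler_pdivlMr// ge_min lexx orbT.
lra.
Qed.

(** A fixed proportion of the mass of the kernel sits outside a small ball,
    where the spherical averages of [w] dominate its average over the small
    ball; the rest of the mass does not bring the average below [w 0]. *)
Lemma radial_average_ge h (M : R) : measurable_fun setT h -> (forall v, 0 <= h v <= M) ->
  ball_int (fun z : 'rV[R]_n => h (vol z)) = 1 ->
  exists2 s : R, 0 < s <= 2^-1 & forall w C, submean_ball w C ->
    2^-1 * (mean_ball w s - w 0) <= ball_int (fun z => w z * h (vol z)) - w 0.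
Proof.
move=> mh hM h1.
have bh := ball_bounded_vol (n := n) mh hM.
have M0 : 0 <= M by have /andP[/le_trans] := hM 0; apply.
(* small enough for the ball of radius [s] to carry at most half of the mass *)
pose s : R := (2 * (M * omega + 1))^-1.
have d0 : 0 < M * omega + 1 by rewrite ltr_wpDl// mulr_ge0// ltW.
have s0 : 0 < s by rewrite invr_gt0 mulr_gt0.
have s2 : s <= 2^-1 by rewrite lef_pV2 ?posrE ?mulr_gt0// ler_pMr// lerDr mulr_ge0// ltW.
have s1 : s <= 1 by apply: le_trans s2 _; rewrite invf_le1// ler1n.
have s01 : 0 < s <= 1 by rewrite s0.
exists s; first by rewrite s0.
move=> w C sw; have [mw wC _ _] := sw.
have bw := submean_ball_bounded sw.
have bcut := @ball_bounded_vol_gt R n (s ^+ n).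
have ch := ball_boundedM bcut bh.
set a := ball_int (fun z => cut (s ^+ n) z * h (vol z)).
have a2 : 2^-1 <= a.
  have := kernel_mass_small_ball mh hM s01; rewrite h1 -/a.
  have sns : s ^+ n <= s.
    by rewrite -{1}(prednK n0) exprS ger_pMr//; apply: exprn_ile1 => //; exact: ltW.
  have : M * (omega * s ^+ n) <= 2^-1.
    apply: le_trans (_ : M * omega * s <= _); first by rewrite mulrA ler_wpM2l// mulr_ge0// ltW.
    rewrite /s invfM mulrCA -[leRHS]mulr1 ler_wpM2l ?invr_ge0//.
    by rewrite ler_pdivrMr// mul1r lerDl.
  lra.
have H1 := mean_ball_radial_le sw s01 mh hM; rewrite -/a in H1.
have H2 := submean_center sw s01.
(* the part of the kernel inside the small ball, to be compared with [w 0] *)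
pose h' v := h v * (v <= s ^+ n)%R%:R.
have mh' : measurable_fun setT h'.
  apply: measurable_funM => //.
  rewrite (_ : (fun _ => _) = (fun v : R => if v <= s ^+ n then 1 else 0)).
    apply: measurable_fun_ifT => //; exact: measurable_fun_ler.
  by apply/funext => z; case: (_ <= _).
have h'M v : 0 <= h' v <= M.
  have /andP[h0 hm] := hM v.
  by rewrite /h'; case: (v <= s ^+ n); rewrite ?mulr1 ?mulr0 ?h0 ?lexx.
have H3 := center_radial_le sw mh' h'M.
have bh' := ball_bounded_vol (n := n) mh' h'M.
have E1 : ball_int (fun z : 'rV[R]_n => h' (vol z)) = 1 - a.
  rewrite -h1 /a; apply/eqP; rewrite eq_sym subr_eq -ball_intD//; apply/eqP.
  apply: eq_ball_int => z _; rewrite /h' /cut /vol.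
  by case: leP; rewrite !(mulr1, mulr0, mul0r, mul1r, addr0, add0r).
have E2 : ball_int (fun z : 'rV[R]_n => w z * h (vol z)) =
    ball_int (fun z => w z * h' (vol z)) + ball_int (fun z => w z * (cut (s ^+ n) z * h (vol z))).
  rewrite -ball_intD; [|exact: ball_boundedM|exact: ball_boundedM].
  apply: eq_ball_int => z _; rewrite /h' /cut /vol.
  by case: leP; rewrite !(mulr1, mulr0, mul0r, mul1r, addr0, add0r).
rewrite E1 in H3; rewrite E2.
have : 2^-1 * (mean_ball w s - w 0) <= a * (mean_ball w s - w 0).
  by rewrite ler_wpM2r// subr_ge0.
lra.
Qed.

Lemma radial_kernel_ge rho : radial_kernel rho ->
  exists2 s : R, 0 < s <= 2^-1 & forall w C, submean_ball w C ->
    2^-1 * (mean_ball w s - w 0) <= ball_int (fun z => w z * rho z) - w 0.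
Proof.
move=> [[mrho rho0] [M rhoM] rad _ irho].
pose e : 'rV[R]_n := delta_mx 0 (Ordinal n0).
have e1 : enorm e = 1.
  rewrite /enorm (bigD1 (Ordinal n0))//= big1 => [|i i0].
    by rewrite mxE !eqxx addr0 expr1n sqrtr1.
  by rewrite mxE eqxx (negbTE i0) expr0n.
(* the profile of the kernel in the volume coordinate, read along a fixed axis *)
pose h v := rho (v `^ n%:R^-1 *: e).
have hE z : h (vol z) = rho z.
  apply: rad; rewrite enormZ e1 mulr1 ger0_norm ?powR_ge0//.
  rewrite /vol -powR_mulrn ?enorm_ge0// -powRrM mulfV ?pnatr_eq0 -?lt0n//.
  by rewrite powRr1// enorm_ge0.
have mh : measurable_fun setT h.
  apply: (measurableT_comp mrho); apply: measurable_fun_rV => j.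
  under eq_fun do rewrite mxE.
  by apply: measurable_funM; [exact: measurable_powR|exact: measurable_cst].
have hM v : 0 <= h v <= M by rewrite /h rho0 rhoM.
have h1 : ball_int (fun z : 'rV[R]_n => h (vol z)) = 1.
  by rewrite -irho; apply: eq_ball_int => z _; exact: hE.
have [s s0 H] := radial_average_ge mh hM h1.
exists s => // w C sw; apply: le_trans (H w C sw) _.
by rewrite (@eq_ball_int _ _ _ (fun z => w z * rho z))// => z _; rewrite hE.
Qed.

End radial_kernels.

(** * Points at a given distance from the boundary *)
Section domain_geometry.
Context {R : realType} {n : nat}.
Variable Omega : set 'rV[R]_n.
Hypothesis openO : open Omega.
Implicit Types (x y z : 'rV[R]_n).

(** A segment from a point of the open set that avoids the boundary meets
the set in a subset that is both relatively open and relatively closed. *)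
Lemma ecball_subset x (r : R) : Omega x ->
  (forall z, boundary Omega z -> r < enorm (x - z)) -> ecball x r `<=` Omega.
Proof.
move=> Ox far y xy.
pose g (t : R) := x + t *: (y - x).
have cg : continuous g.
  move=> t; apply: cvgD; first exact: cvg_cst.
  by apply: cvgZr_tmp; exact: cvg_id.
pose S := g @` `[0, 1]%classic.
have cS : connected S.
  apply: connected_continuous_connected; first exact: segment_connected.
  by apply: continuous_subspaceT => t; exact: cg.
have SO : S `&` Omega = S `&` closure Omega.
  apply/seteqP; split => z [Sz Oz]; split => //; first exact: subset_closure.
  apply: contrapT => nOz.
  have /far : boundary Omega z.
    by split => //; move=> /interior_subset.
  have [t] := Sz; rewrite /= in_itv/= => /andP[t0 t1] <-.
  rewrite /g opprD addNKr enormN enormZ ger0_norm// ltNge => /negP; apply.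
  by rewrite -[leRHS]mul1r ler_pM ?enorm_ge0.
have Sx : S x.
  by exists 0; [rewrite /= in_itv/= lexx ler01|rewrite /g scale0r addr0].
have Sy : S y.
  by exists 1; [rewrite /= in_itv/= ler01 lexx|rewrite /g scale1r addrCA subrr addr0].
have E := cS (S `&` Omega).
have : S `&` Omega = S.
  apply: E.
  - by exists x.
  - by exists Omega.
  - by exists (closure Omega) => //; exact: closed_closure.
move=> SE; suff [] : (S `&` Omega) y by [].
by rewrite SE.
Qed.

(** An explicit [d > r] replaces the infimum, whose value is infinite when the
boundary is empty. *)
Lemma innerP x (r : R) : inner Omega r x <->
  Omega x /\ exists2 d : R, r < d & forall z, boundary Omega z -> d <= enorm (x - z).
Proof.
rewrite /inner /=; split => -[Ox].
  move=> rd; split => //.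
  have le z : boundary Omega z ->
     (Defs.edist x (boundary Omega) <= (enorm (x - z))%:E)%E.
    by move=> bz; apply: ereal_inf_lbound; exists z.
  move: rd le; case: (Defs.edist x _) => [d| |] //.
    rewrite lte_fin => rd le; exists d => // z /le; by rewrite lee_fin.
  by move=> _ le; exists (r + 1); [rewrite ltrDl|move=> z /le].
move=> [d rd dle]; split => //; apply: (@lt_le_trans _ _ d%:E); first by rewrite lte_fin.
by apply: le_ereal_inf_tmp => _ [z bz <-]; rewrite lee_fin dle.
Qed.

Lemma inner_ecball x (r : R) : inner Omega r x -> ecball x r `<=` Omega.
Proof.
move=> /innerP[Ox [d rd dle]]; apply: ecball_subset => // z /dle.
exact: lt_le_trans.
Qed.

(** The distance to the boundary is an infimum, hence the slack [e]. *)
Lemma not_inner_boundary x (r e : R) : Omega x -> 0 < e -> ~ inner Omega r x ->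
  exists2 z, boundary Omega z & enorm (x - z) <= r + e.
Proof.
move=> Ox e0 nr; apply: contrapT => H; apply: nr; apply/innerP; split => //.
exists (r + e); first by rewrite ltrDl.
move=> z bz; rewrite leNgt; apply/negP => ze; apply: H.
by exists z => //; exact: ltW.
Qed.

Lemma inner_shift x y (r d : R) : inner Omega r x -> enorm (x - y) <= d -> d <= r ->
  inner Omega (r - d) y.
Proof.
move=> ix xy dr; have /innerP[Ox [d' rd dle]] := ix.
apply/innerP; split.
  by apply: (inner_ecball ix); rewrite /ecball/= enormB (le_trans xy).
exists (d' - d); first by rewrite ltrD2r.
move=> z /dle; have := enorm_dist x y z; lra.
Qed.

Lemma inner_le x (r s : R) : inner Omega r x -> s <= r -> inner Omega s x.
Proof.
move=> /innerP[Ox [d rd dle]] sr; apply/innerP; split => //.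
by exists d => //; exact: le_lt_trans rd.
Qed.

End domain_geometry.

(** * Solid means of bounded subharmonic functions *)
Section subharmonic_means.
Context {R : realType} {n : nat}.
Hypothesis n0 : (0 < n)%N.
Variable Omega : set 'rV[R]_n.
Hypothesis openO : open Omega.
Variables (u : 'rV[R]_n -> R) (C : R).
Hypothesis uC : forall x, Omega x -> `|u x| <= C.
Hypothesis shu : subharmonic Omega u.
Local Notation B := (@eball R n 0 1).
Local Notation omega := (@omega R n).
Local Notation lam := (@lebesgue_rV R n).
Implicit Types (x y z : 'rV[R]_n).

Let om0 : 0 < omega. Proof. exact: omega_gt0. Qed.

Let mO : measurable Omega. Proof. exact: open_measurable_rV. Qed.

(** Upper semicontinuity makes the strict sublevel sets open. *)
Lemma usc_measurable : measurable_fun Omega u.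
Proof.
apply: (measurability (@RGenInftyO.G R)); first exact: RGenInftyO.measurableE.
move=> _ [_ [a ->] <-]; apply: open_measurable_rV.
have opE (S : set 'rV[R]_n) : S `<=` S° -> open S by rewrite openE.
apply: opE => x /= [Ox]; rewrite in_itv/= => ua.
have [usc _] := shu.
have H1 := usc x Ox a ua.
have H2 : nbhs x Omega by exact: open_nbhs_nbhs.
apply: filterS2 H1 H2 => y yO Oy; split => //=.
by rewrite in_itv/=; exact: yO.
Qed.

Lemma shift_sub x (d : R) : 0 < d -> ecball x d `<=` Omega ->
  forall z, B z -> Omega (x + d *: z).
Proof.
move=> d0 xd z; rewrite /eball/= subr0 => z1; apply: xd.
by rewrite /ecball/= addrC addKr enormZ gtr0_norm// ger_pMr// ltW.
Qed.

Lemma shift_measurable x (d : R) : 0 < d -> ecball x d `<=` Omega ->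
  measurable_fun B (fun z => u (x + d *: z)).
Proof.
move=> d0 xd; apply: (@measurable_comp _ _ _ _ _ _ Omega) => //.
- by move=> _ [z Bz <-]; exact: shift_sub.
- exact: usc_measurable.
- by apply: measurable_funTS; exact: measurable_affine.
Qed.

(** The ball of centre [x] and radius [d] brought to the unit ball, in the form
required by [submean_ball]. *)
Definition rescale x (d : R) : 'rV[R]_n -> R := (fun z => u (x + d *: z) + C) \_ B.

Lemma rescaleE x d z : B z -> rescale x d z = u (x + d *: z) + C.
Proof. by move=> Bz; rewrite /rescale patchE mem_set. Qed.

Lemma rescale_out x d z : ~ B z -> rescale x d z = 0.
Proof. by move=> Bz; rewrite /rescale patchE memNset. Qed.

Lemma shift_bounded x (r : R) : 0 < r -> ecball x r `<=` Omega ->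
  ball_bounded ((fun z => u (x + r *: z)) \_ B).
Proof.
move=> r0 xr; split.
  apply: (measurable_restrictT _ (measurable_eball _ _)).1.
  exact: shift_measurable.
exists C => z Bz; rewrite patchE mem_set//.
by apply: uC; exact: shift_sub Bz.
Qed.

Lemma ball_int_shiftD x (r k : R) : 0 < r -> ecball x r `<=` Omega ->
  ball_int (fun z => u (x + r *: z) + k) = ball_int (fun z => u (x + r *: z)) + k * omega.
Proof.
move=> r0 xr; have bu := shift_bounded r0 xr.
have E : ball_int (fun z => u (x + r *: z)) = ball_int ((fun z => u (x + r *: z)) \_ B).
  by apply: eq_ball_int => z Bz; rewrite patchE mem_set.
rewrite E -ball_int_cst -(ball_intD bu (ball_bounded_cst _)).
by apply: eq_ball_int => z Bz; rewrite patchE mem_set.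
Qed.

Lemma eball_integrable x (r : R) : ecball x r `<=` Omega ->
  lam.-integrable (eball x r) (EFin \o u).
Proof.
move=> xr; have bO : eball x r `<=` Omega by move=> y yr; apply: xr; exact: ltW yr.
apply: (bounded_integrable (K := C)).
- exact: measurable_eball.
- exact: lebesgue_eball_lty.
- exact: measurable_funS usc_measurable.
- by move=> y /bO; exact: uC.
Qed.

Lemma eball_int x (r : R) : 0 < r -> ecball x r `<=` Omega ->
  \int[lam]_(y in eball x r) u y = r ^+ n * ball_int (fun z => u (x + r *: z)).
Proof.
move=> r0 xr.
have mb : measurable (eball x r) by exact: measurable_eball.
have bO : eball x r `<=` Omega by move=> y yr; apply: xr; exact: ltW yr.
have mu : measurable_fun (eball x r) u by exact: measurable_funS usc_measurable.
have iu := eball_integrable xr.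
have iC : lam.-integrable (eball x r) (EFin \o (fun=> C)).
  apply: (bounded_integrable (K := `|C|)) => //; first exact: lebesgue_eball_lty.
have muC : measurable_fun (eball x r) (fun y => (u y + C)%:E).
  by apply/measurable_EFinP; apply: measurable_funD => //; exact: measurable_cst.
have u0 y : eball x r y -> (0 <= (u y + C)%:E)%E.
  by move=> /bO /uC; rewrite ler_norml lee_fin => /andP[]; lra.
have rn0 : 0 < r ^+ n by rewrite exprn_gt0.
have E := ge0_integral_affine x r0 mb muC u0.
have S : [set z | eball x r (x + r *: z)%R] = B.
  apply/seteqP; split => z; rewrite /eball/= [x + _]addrC addrK subr0 enormZ gtr0_norm//.
    by rewrite gtr_pMr.
  by rewrite gtr_pMr.
rewrite S in E.
have {}E : \int[lam]_(y in eball x r) (u y + C) = r ^+ n * ball_int (fun z => u (x + r *: z) + C).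
  rewrite /Rintegral E; have : ((r ^+ n)%:E \is a fin_num)%E by [].
  move=> /fineM ->//.
  rewrite (_ : integral _ _ _ = integral lam B (EFin \o ((fun z => u (x + r *: z) + C) \_ B))); last first.
    by apply: eq_integral => z; rewrite inE => Bz /=; rewrite patchE mem_set.
  apply: (integrable_fin_num (measurable_eball _ _)).
  apply: ball_bounded_integrable.
  have := ball_boundedD (shift_bounded r0 xr) (ball_bounded_cst C).
  move=> [m1 [K HK]]; split.
    apply: (measurable_restrictT _ (measurable_eball _ _)).1.
    by apply: measurable_funD; [exact: shift_measurable|exact: measurable_cst].
  by exists K => z Bz; move: (HK z Bz); rewrite !patchE mem_set.
move: E; rewrite (RintegralD mb iu iC) Rintegral_cst// lebesgue_eball//=.
by rewrite ball_int_shiftD//; lra.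
Qed.

Lemma mean_value x (r : R) : 0 < r -> ecball x r `<=` Omega ->
  u x * omega <= ball_int (fun z => u (x + r *: z)).
Proof.
move=> r0 xr; have [_ /(_ x r r0 xr)] := shu.
rewrite (RintegralE (measurable_eball _ _) (eball_integrable xr)) eball_int//.
rewrite lebesgue_eball// -EFinM lee_fin => H.
have rn0 : 0 < r ^+ n by rewrite exprn_gt0.
by rewrite -(ler_pM2l rn0); move: H; rewrite mulrA mulrC.
Qed.

Lemma rescale_submean x (d : R) : 0 < d -> ecball x d `<=` Omega ->
  submean_ball (rescale x d) (2 * C).
Proof.
move=> d0 xd.
have mB : measurable B by exact: measurable_eball.
have ush z : B z -> `|u (x + d *: z)| <= C.
  by move=> Bz; apply: uC; exact: shift_sub Bz.
have C0 : 0 <= C.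
  have /ush : B 0 by rewrite /eball/= subr0 enorm0 ltr01.
  exact: le_trans.
split.
- apply: (measurable_restrictT _ mB).1; apply: measurable_funD; last exact: measurable_cst.
  exact: shift_measurable.
- move=> z; have [Bz|Bz] := pselect (B z).
    by rewrite rescaleE//; have := ush z Bz; rewrite ler_norml => /andP[]; lra.
  by rewrite rescale_out// lexx mulr_ge0.
- by move=> z z1; apply: rescale_out; rewrite /eball/= subr0 => /(le_lt_trans z1); rewrite ltxx.
- move=> y s s0 ys.
  have By : B y by rewrite /eball/= subr0; have := enorm_ge0 y; lra.
  rewrite rescaleE//.
  have ds0 : 0 < d * s by exact: mulr_gt0.
  have sub : ecball (x + d *: y) (d * s) `<=` Omega.
    move=> z; rewrite /ecball/= => zs; apply: xd; rewrite /ecball/=.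
    have := enorm_dist z (x + d *: y) x.
    have -> : enorm (x + d *: y - x) = d * enorm y.
      by rewrite [x + _]addrC addrK enormZ gtr0_norm.
    have : d * (enorm y + s) <= d * 1 by rewrite ler_wpM2l// ltW.
    by rewrite mulr1 mulrDr; lra.
  have ysB z : B z -> B (y + s *: z).
    rewrite /eball/= !subr0 => z1.
    rewrite (le_lt_trans (enormD _ _))// enormZ gtr0_norm//.
    have : s * enorm z < s * 1 by rewrite ltr_pM2l.
    by lra.
  have E z : B z -> rescale x d (y + s *: z) = u (x + d *: y + (d * s) *: z) + C.
    by move=> /ysB Bz; rewrite rescaleE// scalerDr scalerA addrA.
  have -> : (\int[lam]_(z in B) (rescale x d (y + s *: z))%:E =
      \int[lam]_(z in B) (((fun z => u (x + d *: y + (d * s) *: z)) \_ B) z + C)%:E)%E.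
    by apply: eq_integral => z; rewrite inE => Bz; rewrite E// patchE mem_set.
  have bu := ball_boundedD (shift_bounded ds0 sub) (ball_bounded_cst C).
  rewrite (RintegralE mB (ball_bounded_integrable bu)) lee_fin.
  rewrite -[leRHS]/(ball_int _) (@eq_ball_int _ _ _ (fun z => u (x + d *: y + (d * s) *: z) + C)).
    by rewrite ball_int_shiftD// mulrDl lerD2r; exact: mean_value.
  by move=> z Bz; rewrite patchE mem_set.
Qed.

Let bws x d : 0 < d -> ecball x d `<=` Omega -> ball_bounded (rescale x d).
Proof. by move=> d0 xd; exact: submean_ball_bounded (rescale_submean d0 xd). Qed.

Definition solid_mean (r : R) x := ball_int (fun z => u (x + r *: z)) / omega.

Lemma rescale0 x d : rescale x d 0 = u x + C.
Proof. by rewrite rescaleE ?scaler0 ?addr0// /eball/= subr0 enorm0 ltr01. Qed.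

Lemma mean_op_solid_mean_le rho : radial_kernel rho ->
  exists2 s : R, 0 < s <= 2^-1 & forall x d, 0 < d -> ecball x d `<=` Omega ->
    solid_mean (d * s) x - u x <= 2 * (mean_op rho u d x - u x).
Proof.
move=> krho; have [s s01 H] := radial_kernel_ge n0 krho.
have [[mrho rho0] [M rhoM] _ _ irho] := krho.
exists s => // x d d0 xd.
have /andP[s0 s2] := s01.
have s1 : s <= 1 by apply: le_trans s2 _; rewrite invf_le1// ler1n.
have sw := rescale_submean d0 xd.
have := H _ _ sw; rewrite rescale0.
have brho : ball_bounded rho by split=> //; exists M => z _; rewrite ger0_norm.
have bw := bws d0 xd.
have ds0 : 0 < d * s by rewrite mulr_gt0.
have sub : ecball x (d * s) `<=` Omega.
  move=> z zx; apply: xd; apply: (le_trans zx).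
  by rewrite -[leRHS]mulr1 ler_wpM2l// ltW.
have -> : mean_ball (rescale x d) s = solid_mean (d * s) x + C.
  rewrite /mean_ball /solid_mean.
  rewrite (@eq_ball_int _ _ _ (fun z => u (x + (d * s) *: z) + C)).
    by rewrite ball_int_shiftD// mulrDl mulfK// gt_eqF.
  move=> z; rewrite /eball/= subr0 => z1; rewrite rescaleE ?scalerA//.
  rewrite /eball/= subr0 enormZ gtr0_norm// (le_lt_trans _ z1)//.
  by rewrite -[leRHS]mul1r ler_wpM2r// enorm_ge0.
have -> : ball_int (fun z => rescale x d z * rho z) = mean_op rho u d x + C.
  have bwr := ball_boundedM bw brho.
  have -> : mean_op rho u d x = ball_int (fun z => rescale x d z * rho z + - C * rho z).
    by apply: eq_ball_int => z Bz; rewrite rescaleE//; ring.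
  rewrite (ball_intD bwr (ball_boundedZ _ brho)) (ball_intZ _ brho).
  by rewrite -[ball_int rho]/(\int[lam]_(z in B) rho z) irho; ring.
by lra.
Qed.

Lemma bernoulli_pow (q : R) (k : nat) : 0 <= q <= 1 -> 1 - k%:R * q <= (1 - q) ^+ k.
Proof.
move=> /andP[q0 q1]; elim: k => [|k IH]; first by rewrite mul0r subr0 expr0.
rewrite exprS -natr1.
have : (1 - q) * (1 - k%:R * q) <= (1 - q) * (1 - q) ^+ k by rewrite ler_wpM2l// subr_ge0.
have : 0 <= k%:R * (q * q) by rewrite !mulr_ge0.
by lra.
Qed.

(** On the ball of centre [y] and radius [r + d] the function [c - u] is
nonnegative, so its integral there dominates the one over the smaller
ball of centre [x]. The mean value inequality at [y] bounds the former by a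
multiple of [c - u y], and [n * d / r] bounds the relative difference of the
volumes. *)
Lemma subharmonic_gap_le x y (r d c : R) : 0 < r -> 0 < d -> enorm (y - x) <= d ->
  ecball x (r + 2 * d) `<=` Omega ->
  (forall z, ecball x (r + 2 * d) z -> u z <= c) ->
  u y - u x <= n%:R * d / r * (c - u x) + (solid_mean r x - u x).
Proof.
move=> r0 d0 yx xO uc.
have rd0 : 0 < r + d by rewrite addr_gt0.
have yO : ecball y (r + d) `<=` ecball x (r + 2 * d).
  by move=> z; rewrite /ecball/= => zy; have := enorm_dist z y x; lra.
have xyO : eball x r `<=` eball y (r + d).
  by move=> z; rewrite /eball/= => zx; have := enorm_dist z x y; rewrite [enorm (x - y)]enormB; lra.
have xrO : ecball x r `<=` Omega.
  by apply: subset_trans xO => z; rewrite /ecball/=; lra.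
have yrO : ecball y (r + d) `<=` Omega by exact: subset_trans xO.
have ux : u x <= c by apply: uc; rewrite /ecball/= subrr enorm0; lra.
have ic z s : lam.-integrable (eball z s) (EFin \o (fun=> c)).
  apply: (bounded_integrable (K := `|c|)) => //; [exact: measurable_eball|exact: lebesgue_eball_lty].
have iu1 := eball_integrable xrO; have iu2 := eball_integrable yrO.
have mb z s : measurable (eball z s) by exact: measurable_eball.
have I1 : \int[lam]_(z in eball x r) (c - u z) = r ^+ n * (omega * (c - solid_mean r x)).
  rewrite RintegralB// Rintegral_cst// lebesgue_eball//= eball_int// /solid_mean.
  by field; rewrite gt_eqF.
have I2 : \int[lam]_(z in eball y (r + d)) (c - u z) <= (r + d) ^+ n * (omega * (c - u y)).
  rewrite RintegralB// Rintegral_cst// lebesgue_eball//= eball_int//.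
  have := mean_value rd0 yrO => mv.
  have := ler_wpM2l (ltW (exprn_gt0 n rd0)) mv; lra.
have I12 : \int[lam]_(z in eball x r) (c - u z) <= \int[lam]_(z in eball y (r + d)) (c - u z).
  have ib : lam.-integrable (eball y (r + d)) (EFin \o (fun z => c - u z)).
    by have := integrableB (mb _ _) (ic y (r + d)) iu2.
  have ia : lam.-integrable (eball x r) (EFin \o (fun z => c - u z)).
    by have := integrableB (mb _ _) (ic x r) iu1.
  rewrite -lee_fin -(RintegralE (mb _ _) ia) -(RintegralE (mb _ _) ib).
  apply: ge0_subset_integral => //.
    by case/integrableP : ib.
  move=> z zy; rewrite lee_fin subr_ge0; apply: uc; apply: yO; exact: ltW zy.
have K : r ^+ n * (c - solid_mean r x) <= (r + d) ^+ n * (c - u y).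
  have := le_trans I12 I2; rewrite I1.
  by rewrite mulrCA [leRHS]mulrCA ler_pM2l.
pose q := d / (r + d).
have q01 : 0 <= q <= 1.
  apply/andP; split; first by apply: divr_ge0; exact: ltW.
  by rewrite ler_pdivrMr// mul1r lerDr ltW.
pose th := (1 - q) ^+ n.
have thE : r ^+ n = (r + d) ^+ n * th.
  by rewrite -exprMn; congr (_ ^+ _); rewrite /q; field; rewrite gt_eqF.
have {}K : th * (c - solid_mean r x) <= c - u y.
  by move: K; rewrite thE -mulrA ler_pM2l// exprn_gt0.
have th1 : 1 - n%:R * q <= th by exact: bernoulli_pow.
have th2 : th <= 1.
  by have /andP[q0 q1] := q01; rewrite exprn_ile1 ?subr_ge0// lerBlDr lerDl.
have qr : n%:R * q <= n%:R * d / r.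
  rewrite -mulrA ler_wpM2l// /q ler_pM2l// lef_pV2// lerDl; exact: ltW.
have sm : u x <= solid_mean r x.
  by rewrite ler_pdivlMr//; exact: mean_value.
have h1 : (1 - th) * (c - u x) <= n%:R * d / r * (c - u x).
  by rewrite ler_wpM2r ?subr_ge0//; lra.
have h2 : th * (solid_mean r x - u x) <= solid_mean r x - u x.
  by rewrite -[leRHS]mul1r ler_wpM2r// subr_ge0.
by lra.
Qed.

End subharmonic_means.

(** * Moduli of continuity and the growth condition *)
Section moduli.
Context {R : realType}.
Variables (l : R) (kappa : R -> R).
Hypothesis mod_kappa : modulus_of_continuity l kappa.
Implicit Types s t : R.

Lemma modulus0 : kappa 0 = 0.
Proof. by have [_ []] := mod_kappa. Qed.

Lemma le_modulus s t : 0 <= s -> s <= t -> t <= l -> kappa s <= kappa t.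
Proof.
have [_ _ H _ _] := mod_kappa => s0 st tl; apply: H => //.
  by rewrite in_itv/= s0 (le_trans st).
by rewrite in_itv/= tl (le_trans s0).
Qed.

Lemma modulus_gt0 t : 0 < t -> t <= l -> 0 < kappa t.
Proof. by have [_ _ _ H _] := mod_kappa => t0 tl; apply: H; rewrite t0. Qed.

Lemma modulus_natmul (k : nat) t : 0 <= t -> k%:R * t <= l ->
  kappa (k%:R * t) <= k%:R * kappa t.
Proof.
move=> t0; elim: k => [|k IH] kt; first by rewrite !mul0r modulus0.
have E : k.+1%:R * t = k%:R * t + t by rewrite -natr1 mulrDl mul1r.
have k0 : 0 <= k%:R * t by rewrite mulr_ge0.
rewrite E in kt *.
have [_ _ _ _ sub] := mod_kappa.
apply: (le_trans (sub _ _ k0 t0 kt)).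
rewrite -natr1 [leRHS]mulrDl mul1r lerD2r; apply: IH; lra.
Qed.

(** Round [c] up to an integer. *)
Lemma modulus_scale (c t : R) : 0 <= c -> 0 <= t -> (c + 1) * t <= l ->
  kappa (c * t) <= (c + 1) * kappa t.
Proof.
move=> c0 t0 ctl.
have /andP[k1 k2] := Num.Theory.truncn_itv c0.
set k := Num.truncn c in k1 k2.
have k2' : k.+1%:R <= c + 1 by rewrite -natr1 lerD2r.
have ktl : k.+1%:R * t <= l by apply: le_trans ctl; rewrite ler_wpM2r.
have tl : t <= l.
  by apply: le_trans ctl; rewrite -[leLHS]mul1r ler_wpM2r// lerDr.
have kt0 : 0 <= kappa t by rewrite -modulus0; exact: le_modulus.
apply: (@le_trans _ _ (kappa (k.+1%:R * t))).
  by apply: le_modulus => //; [rewrite mulr_ge0|rewrite ler_wpM2r// ltW].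
by apply: (le_trans (modulus_natmul t0 ktl)); rewrite ler_wpM2r.
Qed.

Lemma growth_lt (A n2 : R) : 0 < A ->
  (limf_esup (fun t : R => ((n2 * kappa (A * t)) / (A * kappa t))%:E) 0^'+ < 1)%E ->
  exists2 t0 : R, 0 < t0 <= l &
    forall t, 0 < t -> t < t0 -> n2 * kappa (A * t) < A * kappa t.
Proof.
move=> A0 /ereal_inf_lt[_ [V V0 <-] supV].
have [l0 _ _ _ _] := mod_kappa.
have /nbhs_ballP[e /= e0 eV] := V0.
exists (Num.min e l); first by rewrite lt_min e0 l0 ge_min lexx orbT.
move=> t t0; rewrite lt_min => /andP[te tl].
have Vt : V t by apply: eV => //; rewrite /ball/= sub0r normrN gtr0_norm.
have Akt : 0 < A * kappa t by rewrite mulr_gt0// modulus_gt0// ltW.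
rewrite -[ltRHS]mul1r -ltr_pdivrMr// -lte_fin.
by apply: le_lt_trans supV; apply: ereal_sup_ubound; exists t.
Qed.

(** Since [n >= 1], the growth condition is incompatible with [A <= 1], and by
monotonicity it even forces [A > 2 * n]; iterating it along the powers of [A]
therefore gains an arbitrarily small factor. *)
Lemma modulus_growth (n : nat) : (0 < n)%N ->
  (exists A : R, 0 < A /\
    (limf_esup (fun t : R => ((2 * n%:R * kappa (A * t)) / (A * kappa t))%:E)
      0^'+ < 1)%E) ->
  forall s : R, 0 < s -> exists T d : R,
    [/\ 4 <= T, 0 < d & forall t, 0 < t <= d ->
       T * t <= l /\ 2 * n%:R * kappa (T * t) <= s * T * kappa t].
Proof.
move=> n0 [A [A0 /(growth_lt A0)[t0 /andP[t00 t0l] gA]]] s s0.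
have nR : 1 <= n%:R :> R by rewrite ler1n.
have kge0 t : 0 < t -> t < t0 -> 0 < kappa t.
  by move=> t1 t2; apply: modulus_gt0 => //; lra.
have A1 : 1 < A.
  rewrite ltNge; apply/negP => A1.
  pose t := t0 / (2 * (1 + A)).
  have tp : 0 < t by rewrite divr_gt0// mulr_gt0// addr_gt0.
  have tE : (1 + A) * t = t0 / 2.
    by rewrite /t; field; rewrite gt_eqF// addr_gt0.
  have At : 0 < A * t by exact: mulr_gt0.
  have tt0 : t < t0 by lra.
  have := gA t tp tt0.
  have K : kappa (A^-1 * (A * t)) <= (A^-1 + 1) * kappa (A * t).
    apply: modulus_scale; [by rewrite invr_ge0 ltW|exact: ltW|].
    have -> : (A^-1 + 1) * (A * t) = (1 + A) * t by field; rewrite gt_eqF.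
    by rewrite tE; lra.
  rewrite mulKf ?gt_eqF// in K.
  have {}K : A * kappa t <= (1 + A) * kappa (A * t).
    have -> : (1 + A) * kappa (A * t) = A * ((A^-1 + 1) * kappa (A * t)).
      by field; rewrite gt_eqF.
    by rewrite ler_pM2l.
  have kA : 0 < kappa (A * t) by apply: modulus_gt0 => //; lra.
  rewrite ltNge => /negP; apply; apply: (le_trans K).
  by rewrite ler_wpM2r ?(ltW kA)//; lra.
have A2 : 2 * n%:R < A.
  pose t := t0 / (2 * A).
  have tp : 0 < t by rewrite divr_gt0// mulr_gt0.
  have tE : A * t = t0 / 2 by rewrite /t; field; rewrite gt_eqF.
  have tA : t <= A * t by rewrite ler_peMl// ltW.
  have tt0 : t < t0 by lra.
  have kp := kge0 t tp tt0.
  rewrite -(ltr_pM2r kp); apply: le_lt_trans (gA t tp tt0).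
  rewrite ler_wpM2l ?mulr_ge0//; apply: le_modulus; lra.
have it k t : 0 < t -> A ^+ k * t < t0 ->
    (2 * n%:R) ^+ k * kappa (A ^+ k * t) <= A ^+ k * kappa t.
  move=> tp; elim: k => [|k IH] kt; first by rewrite !expr0 !mul1r.
  have Ak : 0 < A ^+ k * t by rewrite mulr_gt0// exprn_gt0.
  have Ak1 : A ^+ k * t < t0.
    by apply: le_lt_trans kt; rewrite exprS -mulrA ler_peMl// ltW.
  have := gA _ Ak Ak1; rewrite mulrA -exprS => /ltW g.
  have nk : 0 <= (2 * n%:R) ^+ k :> R by rewrite exprn_ge0// mulr_ge0.
  have h1 := ler_wpM2l nk g.
  have h2 := ler_wpM2l (ltW A0) (IH Ak1).
  rewrite [in leLHS]exprSr [in leRHS]exprS.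
  by move: h1 h2; lra.
have [k k2 kn] : exists2 k, (2 <= k)%N & 2 * n%:R <= s * (2 * n%:R) ^+ k.
  pose m := (Num.truncn s^-1).+1; exists m.+2 => //.
  have ms : 1 <= s * (2 * n%:R) ^+ m.+1.
    rewrite -ler_pdivrMl// mulr1.
    apply: (@le_trans _ _ m%:R); first by rewrite ltW// truncnS_gt.
    apply: (@le_trans _ _ (2 ^+ m.+1)).
      rewrite -natrX ler_nat; apply: (@leq_trans (2 ^ m)%N); last by rewrite leq_exp2l.
      exact: ltnW (ltn_expl _ _).
    by apply: lerXn2r; rewrite ?nnegrE ?mulr_ge0//; lra.
  by rewrite exprS [s * _]mulrCA ler_peMr// mulr_ge0.
have Ak4 : 4 <= A ^+ k.
  rewrite -(subnK k2) exprD.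
  have h1 : 1 <= A ^+ (k - 2) by rewrite exprn_ege1// ltW.
  have h2 : 4 <= A ^+ 2 by rewrite expr2; nra.
  by nra.
exists (A ^+ k), (t0 / (2 * A ^+ k)).
have Ak0 : 0 < A ^+ k by lra.
split => //; first by rewrite divr_gt0// mulr_gt0.
move=> t /andP[tp td].
have tA : A ^+ k * t <= t0 / 2.
  apply: (le_trans (ler_wpM2l (ltW Ak0) td)).
  by rewrite le_eqVlt; apply/orP; left; apply/eqP; field; rewrite gt_eqF.
split; first lra.
have tA' : A ^+ k * t < t0 by lra.
have h1 := it k t tp tA'.
have kAk : 0 <= kappa (A ^+ k * t).
  by apply: ltW; apply: kge0 => //; exact: mulr_gt0.
have h2 := ler_wpM2r kAk kn.
have h3 := ler_wpM2l (ltW s0) h1.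
by move: h2 h3; lra.
Qed.

End moduli.

(** * Control near the boundary *)
Section boundary_control.
Context {R : realType} {n : nat}.
Variable Omega : set 'rV[R]_n.
Hypothesis openO : open Omega.
Variables (l : R) (kappa : R -> R).
Hypothesis mod_kappa : modulus_of_continuity l kappa.
Variables (u : 'rV[R]_n -> R) (eps0 : R).
Hypothesis eps0l : eps0 <= l.
Hypothesis ku : forall zeta z, boundary Omega zeta -> Omega z ->
  enorm (z - zeta) <= eps0 -> `|u z - u zeta| <= kappa (enorm (z - zeta)).
Implicit Types (x y z : 'rV[R]_n) (t d : R).

Lemma closure_boundary x : closure Omega x -> Omega x \/ boundary Omega x.
Proof.
move=> cx; have [Ox|nOx] := pselect (Omega x); [by left|right].
by split => // /interior_subset.
Qed.

Lemma near_boundary_le zeta z (a : R) : boundary Omega zeta -> Omega z ->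
  enorm (z - zeta) <= a -> a <= eps0 -> `|u z - u zeta| <= kappa a.
Proof.
move=> bz Oz za ae; apply: (le_trans (ku bz Oz (le_trans za ae))).
apply: (le_modulus mod_kappa) => //; first exact: enorm_ge0.
exact: le_trans eps0l.
Qed.

(** A boundary point lies within [2 * c * t] of [x], hence within
[(2 * c + 1) * t] of [y]; compare both values with the one there. *)
Lemma not_inner_le x y t (c : R) : 0 < t -> 1 <= c -> (2 * c + 2) * t <= eps0 ->
  Omega x -> Omega y -> enorm (x - y) <= t -> ~ inner Omega (c * t) x ->
  `|u x - u y| <= (4 * c + 3) * kappa t.
Proof.
move=> t0 c1 cte Ox Oy xy ni.
have el : eps0 <= l by [].
have ct0 : 0 < c * t by rewrite mulr_gt0//; lra.
have [z bz xz] := not_inner_boundary Ox ct0 ni.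
have yz : enorm (y - z) <= (2 * c + 1) * t.
  by have := enorm_dist y x z; rewrite [enorm (y - x)]enormB; lra.
have xz' : enorm (x - z) <= (2 * c) * t by lra.
have h1 : `|u x - u z| <= kappa (2 * c * t).
  by apply: (near_boundary_le bz Ox xz'); lra.
have h2 : `|u y - u z| <= kappa ((2 * c + 1) * t).
  by apply: (near_boundary_le bz Oy yz); lra.
have k1 : kappa ((2 * c) * t) <= (2 * c + 1) * kappa t.
  by apply: (modulus_scale mod_kappa); lra.
have k2 : kappa ((2 * c + 1) * t) <= (2 * c + 1 + 1) * kappa t.
  by apply: (modulus_scale mod_kappa); lra.
have := ler_distD (u z) (u x) (u y); rewrite [`|u z - u y|]distrC; lra.
Qed.

End boundary_control.

(** * From averages to continuity *)
Section characterization.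
Context {R : realType} {n : nat}.
Hypothesis n0 : (0 < n)%N.
Variable Omega : set 'rV[R]_n.
Hypothesis openO : open Omega.
Variables (l : R) (kappa : R -> R).
Hypothesis mod_kappa : modulus_of_continuity l kappa.
Variables (u : 'rV[R]_n -> R) (eps0 C : R).
Hypothesis eps0_gt0 : 0 < eps0.
Hypothesis eps0l : eps0 <= l.
Hypothesis ku : forall zeta z, boundary Omega zeta -> Omega z ->
  enorm (z - zeta) <= eps0 -> `|u z - u zeta| <= kappa (enorm (z - zeta)).
Hypothesis C_ge0 : 0 <= C.
Hypothesis uC : forall x, closure Omega x -> `|u x| <= C.
Hypothesis shu : subharmonic Omega u.
Variable rho : 'rV[R]_n -> R.
Hypothesis krho : radial_kernel rho.
Implicit Types (x y z : 'rV[R]_n) (t d : R).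

Let uO x : Omega x -> `|u x| <= C.
Proof. by move=> Ox; apply: uC; exact: subset_closure. Qed.

Lemma mean_op_max_op x d : 0 < d -> ecball x d `<=` Omega ->
  mean_op rho u d x <= max_op u d x.
Proof.
move=> d0 xd; have [[mrho rho0] [M rhoM] _ _ irho] := krho.
have brho : ball_bounded rho by split=> //; exists M => z _; rewrite ger0_norm.
have bu := shift_bounded openO uO shu d0 xd.
have -> : mean_op rho u d x =
    ball_int (fun z => ((fun z => u (x + d *: z)) \_ (@eball R n 0 1)) z * rho z).
  by apply: eq_ball_int => z Bz; rewrite patchE mem_set.
have -> : max_op u d x = ball_int (fun z => max_op u d x * rho z).
  by rewrite ball_intZ// -[ball_int rho]/(\int[lebesgue_rV n]_(z in eball 0 1) rho z) irho mulr1.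
apply: le_ball_int; [exact: ball_boundedM|exact: ball_boundedZ|].
move=> z Bz; rewrite patchE mem_set//; apply: ler_wpM2r => //.
apply: ub_le_sup; last first.
  exists (x + d *: z) => //; rewrite /ecball/= addrC addKr enormZ gtr0_norm//.
  by move: Bz; rewrite /eball/= subr0 => /ltW z1; rewrite ger_pMr.
exists C => _ [y xy <-]; have := uO (xd _ xy); rewrite ler_norml => /andP[_]; exact.
Qed.

(** One-sided, because the gap inequality takes an upper bound of [u] as input and
returns one. *)
Definition upper_osc_le d (H : R) := forall x y, inner Omega d x ->
  enorm (y - x) <= d -> u y - u x <= H * kappa d.

(** If the coarse ball fits in the domain, the gap inequality with
[r = T * d * s] applies: [s <= 1 / 2] and [4 <= T] leave room for the
enlarged ball of radius [r + 2 * d]. Otherwise [x] is within [2 * T * d] of the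
boundary. The two lower bounds on [H] absorb the errors of the two cases. *)
Lemma upper_osc_step (s L T d H : R) : 0 < s <= 2^-1 -> 0 <= L -> 4 <= T -> 0 < d ->
  4 * T * d <= eps0 ->
  (forall x, inner Omega (T * d) x ->
    solid_mean u (T * d * s) x - u x <= L * kappa (T * d)) ->
  2 * n%:R * kappa (T * d) <= s * T * kappa d ->
  4 * T + 3 <= H -> 2 * L * (T + 1) <= H ->
  upper_osc_le (T * d) H -> upper_osc_le d H.
Proof.
move=> /andP[s0 s2] L0 T4 d0 Tde sm gr H1 H2 P x y ix yx.
have el : eps0 <= l by [].
have T0 : 0 < T by lra.
have Td0 : 0 < T * d by exact: mulr_gt0.
have dT : 4 * d <= T * d by rewrite ler_wpM2r// ltW.
have kd : 0 < kappa d by apply: (modulus_gt0 mod_kappa) => //; lra.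
have /innerP[Ox _] := ix.
have [iT|niT] := pselect (inner Omega (T * d) x); last first.
  have Oy : Omega y by apply: (inner_ecball openO ix).
  have xy : enorm (x - y) <= d by rewrite enormB.
  have T1 : 1 <= T by lra.
  have Tde' : (2 * T + 2) * d <= eps0 by lra.
  have := not_inner_le mod_kappa eps0l ku d0 T1 Tde' Ox Oy xy niT.
  have : (4 * T + 3) * kappa d <= H * kappa d by rewrite ler_wpM2r// ltW.
  by rewrite distrC ler_norml => h /andP[_]; lra.
have r0 : 0 < T * d * s by exact: mulr_gt0.
have rT : T * d * s + 2 * d <= T * d.
  have : T * d * s <= T * d * 2^-1 by rewrite ler_wpM2l// ltW.
  by lra.
have sub : ecball x (T * d * s + 2 * d) `<=` ecball x (T * d).
  by move=> z zx; exact: le_trans rT.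
have sub' := subset_trans sub (inner_ecball openO iT).
have bd z : ecball x (T * d * s + 2 * d) z -> u z <= u x + H * kappa (T * d).
  by move=> /sub zx; have := P x z iT zx; lra.
have := subharmonic_gap_le n0 openO uO shu r0 d0 yx sub' bd.
have := sm x iT.
have kT : kappa (T * d) <= (T + 1) * kappa d.
  by apply: (modulus_scale mod_kappa); lra.
have E : n%:R * d / (T * d * s) * kappa (T * d) <= kappa d / 2.
  have -> : n%:R * d / (T * d * s) * kappa (T * d) =
      (2 * n%:R * kappa (T * d)) / (2 * (s * T)).
    by field; rewrite !gt_eqF.
  rewrite ler_pdivrMr; last by rewrite !mulr_gt0.
  by apply: (le_trans gr); rewrite le_eqVlt; apply/orP; left; apply/eqP; field.
have H0 : 0 <= H by lra.
have h1 := ler_wpM2l H0 E.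
have h2 := ler_wpM2l L0 kT.
have h3 := ler_wpM2r (ltW kd) H2.
rewrite [u x + _]addrC addrK.
by move: h1 h2 h3; lra.
Qed.

(** Multiplying a scale by [T] finitely many times brings it to the window
[d1, T * d1], where the bound is known. *)
Lemma upper_osc_descent (T d1 H : R) : 2 <= T -> 0 < d1 ->
  (forall d, d1 <= d <= T * d1 -> upper_osc_le d H) ->
  (forall d, 0 < d <= d1 -> upper_osc_le (T * d) H -> upper_osc_le d H) ->
  forall d, 0 < d <= d1 -> upper_osc_le d H.
Proof.
move=> T2 d10 base step d /andP[d0 dd1].
have el : eps0 <= l by [].
have T0 : 0 < T by lra.
have desc k : forall t, 0 < t <= T * d1 -> d1 <= T ^+ k * t -> upper_osc_le t H.
  elim: k => [|k IH] t /andP[t0 tT] tk.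
    by apply: base; rewrite tT andbT; move: tk; rewrite expr0 mul1r.
  have [td|td] := leP d1 t; first by apply: base; rewrite td.
  apply: step; first by rewrite t0 ltW.
  apply: IH; last by rewrite mulrA -exprSr.
  by rewrite mulr_gt0//= ler_pM2l// ltW.
apply: (desc (Num.truncn (d1 / d)).+1).
  by rewrite d0 (le_trans dd1)// ler_peMl ?ltW//; lra.
rewrite -ler_pdivrMr//; apply: ltW; apply: (lt_le_trans (truncnS_gt _)).
set k := _.+1; apply: (@le_trans _ _ (2 ^+ k)).
  by rewrite -natrX ler_nat ltnW// ltn_expl.
by apply: lerXn2r; rewrite ?nnegrE// ltW.
Qed.

(** The base of the descent is a range of scales bounded away from zero, where
[2 * C / kappa d1] is an admissible constant. *)
Lemma mean_upper_osc (L2 d2 : R) : 0 < L2 -> 0 < d2 ->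
  (exists A : R, 0 < A /\
    (limf_esup (fun t : R => ((2 * n%:R * kappa (A * t)) / (A * kappa t))%:E)
      0^'+ < 1)%E) ->
  (forall d, 0 < d < d2 -> forall x, inner Omega d x ->
    mean_op rho u d x - u x <= L2 * kappa d) ->
  exists H d, [/\ 0 < H, 0 < d & forall t, 0 < t <= d -> upper_osc_le t H].
Proof.
move=> L20 d20 grow mean.
have [s s02 sm] := mean_op_solid_mean_le n0 openO uO shu krho.
have /andP[s0 s2] := s02.
have [T [d3 [T4 d30 gr]]] := modulus_growth mod_kappa n0 grow s0.
have el : eps0 <= l by [].
have T0 : 0 < T by lra.
pose d1 := Num.min d3 (Num.min (d2 / (2 * T)) (eps0 / (4 * T))).
have d10 : 0 < d1 by rewrite !lt_min d30 !divr_gt0// mulr_gt0.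
have d13 : d1 <= d3 by rewrite ge_min lexx.
have d12 : 2 * T * d1 <= d2.
  by rewrite mulrC -ler_pdivlMr ?mulr_gt0// !ge_min lexx orbT.
have d1e : 4 * T * d1 <= eps0.
  by rewrite mulrC -ler_pdivlMr ?mulr_gt0// !ge_min lexx !orbT.
have Td1 : 4 * d1 <= T * d1 by rewrite ler_wpM2r// ltW.
have kd1 : 0 < kappa d1 by apply: (modulus_gt0 mod_kappa) => //; lra.
(* boundary case, error of the means, and base of the descent *)
pose H := (4 * T + 3) + 4 * L2 * (T + 1) + 2 * C / kappa d1.
have h1 : 0 <= 4 * L2 * (T + 1) by rewrite !mulr_ge0//; lra.
have h2 : 0 <= 2 * C / kappa d1 by rewrite divr_ge0 ?mulr_ge0// ltW.
have [H0 HT HL HC] : [/\ 0 < H, 4 * T + 3 <= H, 2 * (2 * L2) * (T + 1) <= H &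
    2 * C / kappa d1 <= H].
  by rewrite /H; split; lra.
move: H H0 HT HL HC => H H0 HT HL HC.
exists H, d1; split => //.
apply: (@upper_osc_descent T) => //; first lra.
  move=> d /andP[dd1 dT] x y ix xy.
  have kd : kappa d1 <= kappa d by apply: (le_modulus mod_kappa); lra.
  have Oy : Omega y by apply: (inner_ecball openO ix).
  have /innerP[Ox _] := ix.
  have := uO Ox; have := uO Oy; rewrite !ler_norml => /andP[_ uy] /andP[ux _].
  have : H * kappa d1 <= H * kappa d by rewrite ler_wpM2l// ltW.
  have : 2 * C <= H * kappa d1.
    by rewrite -ler_pdivrMr.
  by lra.
move=> d /andP[d0 dd1].
have dT : T * d <= T * d1 by rewrite ler_pM2l.
have Td0 : 0 < T * d by exact: mulr_gt0.
apply: (@upper_osc_step s (2 * L2)) => //; rewrite ?mulr_ge0//.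
- exact: ltW.
- by rewrite -mulrA; lra.
- move=> x ix; apply: le_trans (sm x _ Td0 (inner_ecball openO ix)) _.
  have -> : 2 * L2 * kappa (T * d) = 2 * (L2 * kappa (T * d)) by ring.
  by rewrite ler_pM2l//; apply: mean => //; rewrite Td0/=; lra.
- by have [] := gr d ltac:(by rewrite d0 (le_trans dd1)).
Qed.

(** Exchanging the two points turns the one-sided bound into a bound on the
oscillation, at the price of asking that both be far from the boundary: hence
the factor 3. *)
Lemma upper_osc_osc d (H : R) x : 0 < d -> 2 * d <= l -> 0 <= H ->
  upper_osc_le (2 * d) H -> inner Omega (3 * d) x -> osc_op u d x <= 2 * H * kappa d.
Proof.
move=> d0 dl H0 P ix; apply: ge_sup.
  exists `|u x - u x|; exists (x, x) => //=.
  by split; rewrite /eball/= subrr enorm0.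
have k2 : kappa (2 * d) <= 2 * kappa d by exact: (modulus_natmul mod_kappa (k := 2) (ltW d0)).
have one y1 y2 : eball x d y1 -> eball x d y2 -> u y1 - u y2 <= 2 * H * kappa d.
  rewrite /eball/= => y1x y2x.
  have iy : inner Omega (2 * d) y2.
    apply: (@inner_le _ _ _ _ (3 * d - d)); last lra.
    by apply: (inner_shift openO ix); [rewrite enormB ltW|lra].
  have yy : enorm (y1 - y2) <= 2 * d.
    by have := enorm_dist y1 x y2; rewrite [enorm (x - y2)]enormB; lra.
  have := P _ _ iy yy; have := ler_wpM2l H0 k2; lra.
move=> _ [[y1 y2] /= [y1x y2x] <-].
by rewrite ler_norml one// andbT; have := one _ _ y2x y1x; lra.
Qed.

(** Three cases: [x] far from the boundary on the scale of [t = enorm (x - y)],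
where the oscillation over the ball of radius [2 * t] decides;
both points in the domain but close to the boundary; a point on the boundary.
If both are on the boundary, a point of the domain near [x] relays the
comparison. *)
Lemma osc_continuous (B L3 d3 : R) : 1 < B -> 0 < L3 -> 0 < d3 ->
  (forall d, 0 < d < d3 -> forall x, inner Omega (B * d) x ->
     osc_op u d x <= L3 * kappa d) ->
  exists L4 d4, [/\ 0 < L4, 0 < d4 & forall x y, closure Omega x -> closure Omega y ->
    enorm (x - y) <= d4 -> `|u x - u y| <= L4 * kappa (enorm (x - y))].
Proof.
move=> B1 L30 d30 osc.
pose L4 := 2 * L3 + (8 * B + 3) + 3.
pose d4 := Num.min (d3 / 3) (eps0 / (4 * B + 2)).
have el : eps0 <= l by [].
have B0 : 0 < 4 * B + 2 by lra.
have d40 : 0 < d4 by rewrite lt_min !divr_gt0.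
have d43 : 3 * d4 <= d3 by rewrite mulrC -ler_pdivlMr// ge_min lexx.
have d4e : (4 * B + 2) * d4 <= eps0 by rewrite mulrC -ler_pdivlMr// ge_min lexx orbT.
exists L4, d4; split => //; first by rewrite /L4; lra.
move=> x y cx cy xyd; have := enorm_ge0 (x - y).
rewrite le_eqVlt => /predU1P[/esym xy0|t0].
  have -> : x = y by apply/subr0_eq/enorm_eq0.
  by rewrite !subrr normr0 enorm0 (modulus0 mod_kappa) mulr0.
set t := enorm (x - y) in t0 xyd *.
have Bt : B * t <= B * d4 by rewrite ler_pM2l//; lra.
have tB : t <= B * t by rewrite ler_peMl// ltW.
have kt : 0 < kappa t by apply: (modulus_gt0 mod_kappa) => //; lra.
have k2 : kappa (2 * t) <= 2 * kappa t.
  by apply: (modulus_natmul mod_kappa (k := 2) (ltW t0)); lra.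
have c1 : 2 * L3 * kappa t <= L4 * kappa t by rewrite ler_pM2r// /L4; lra.
have c2 : (8 * B + 3) * kappa t <= L4 * kappa t by rewrite ler_pM2r// /L4; lra.
have c3 : 3 * kappa t <= L4 * kappa t by rewrite ler_pM2r// /L4; lra.
have te : t <= eps0 by lra.
have [Ox|bx] := closure_boundary cx; have [Oy|by_] := closure_boundary cy.
- have [i2|ni2] := pselect (inner Omega (2 * B * t) x); last first.
    apply: le_trans c2.
    have -> : 8 * B + 3 = 4 * (2 * B) + 3 by ring.
    by apply: (not_inner_le mod_kappa eps0l ku t0 _ _ Ox Oy) => //; lra.
  apply: le_trans c1.
  have t20 : 0 < 2 * t < d3 by rewrite mulr_gt0//=; lra.
  have i2' : inner Omega (B * (2 * t)) x by rewrite (_ : B * _ = 2 * B * t)//; ring.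
  apply: (@le_trans _ _ (osc_op u (2 * t) x)); last first.
    by apply: (le_trans (osc _ t20 _ i2')); have := ler_wpM2l (ltW L30) k2; lra.
  apply: ub_le_sup.
    exists (2 * C) => _ [[y1 y2] /= [y1x y2x] <-].
    have sub z : eball x (2 * t) z -> Omega z.
      by move=> zx; apply: (inner_ecball openO i2); apply: (le_trans (ltW zx)); lra.
    have := uO (sub _ y1x); have := uO (sub _ y2x); rewrite !ler_norml.
    by move=> /andP[a1 a2] /andP[a3 a4]; apply/andP; split; lra.
  exists (x, y) => //=; split; rewrite /eball/=.
    by rewrite subrr enorm0; lra.
  by rewrite enormB -/t; lra.
- apply: le_trans c3; apply: (@le_trans _ _ (kappa t)); last lra.
  exact: (near_boundary_le mod_kappa eps0l ku by_ Ox).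
- apply: le_trans c3; apply: (@le_trans _ _ (kappa t)); last lra.
  rewrite distrC; apply: (near_boundary_le mod_kappa eps0l ku bx Oy) => //.
  by rewrite enormB.
- have nx : nbhs x (eball x t).
    by apply: open_nbhs_nbhs; split; [exact: open_eball|rewrite /eball/= subrr enorm0].
  have [z [Oz zx]] := cx _ nx.
  have zx' : enorm (z - x) <= t by exact: ltW.
  have zy : enorm (z - y) <= 2 * t by have := enorm_dist z x y; rewrite -/t; lra.
  have h1 := near_boundary_le mod_kappa eps0l ku bx Oz zx' te.
  have h2 : `|u z - u y| <= kappa (2 * t).
    by apply: (near_boundary_le mod_kappa eps0l ku by_ Oz zy); lra.
  have := ler_distD (u z) (u x) (u y); rewrite [`|u x - u z|]distrC; lra.
Qed.

Lemma continuous_max_op (L4 d : R) x : 0 < d -> d <= l -> 0 <= L4 ->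
  (forall x y, closure Omega x -> closure Omega y -> enorm (x - y) <= d ->
    `|u x - u y| <= L4 * kappa (enorm (x - y))) ->
  inner Omega d x -> max_op u d x - u x <= L4 * kappa d.
Proof.
move=> d0 dl L40 H ix; rewrite lerBlDr; apply: ge_sup.
  by exists (u x), x => //; rewrite /ecball/= subrr enorm0 ltW.
move=> _ [y yx <-]; rewrite -lerBlDr.
have Oy := inner_ecball openO ix yx.
have /innerP[Ox _] := ix.
have cx := @subset_closure _ Omega x Ox; have cy := @subset_closure _ Omega y Oy.
have := H _ _ cy cx yx; rewrite ler_norml => /andP[_ h].
apply: (le_trans h); rewrite ler_wpM2l//; apply: (le_modulus mod_kappa) => //.
exact: enorm_ge0.
Qed.

End characterization.

Theorem theorem3p2 (R : realType) (n : nat) (n_gt0 : (0 < n)%N)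
  (rho : 'rV[R]_n -> R) (rho_kernel : radial_kernel rho)
  (Omega : set 'rV[R]_n) (Omega_domain : domain Omega)
  (delta0 : R) (delta0_gt0 : 0 < delta0)
  (inner_delta0 : inner Omega delta0 !=set0)
  (l : R) (kappa : R -> R) (kappa_modulus : modulus_of_continuity l kappa)
  (kappa_growth : exists A : R, 0 < A /\
    (limf_esup (fun t : R => ((2 * n%:R * kappa (A * t)) / (A * kappa t))%:E)
      0^'+ < 1)%E)
  (u : 'rV[R]_n -> R)
  (u_bounded : exists C : R, forall x, closure Omega x -> `|u x| <= C)
  (u_subharmonic : subharmonic Omega u)
  (u_boundary : continuous_near_boundary Omega l kappa u) :
  [<->
    (* (1) *)
    exists L1 delta1 : R, [/\ 0 < L1, 0 < delta1 < delta0, delta1 <= l &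
      forall delta, 0 < delta < delta1 -> forall x, inner Omega delta x ->
        max_op u delta x - u x <= L1 * kappa delta];
    (* (2) *)
    exists L2 delta2 : R, [/\ 0 < L2, 0 < delta2 < delta0, delta2 <= l &
      forall delta, 0 < delta < delta2 -> forall x, inner Omega delta x ->
        mean_op rho u delta x - u x <= L2 * kappa delta];
    (* (3) *)
    exists B L3 delta3 : R,
      [/\ 1 < B, 0 < L3, 0 < delta3 < delta0, delta3 <= l &
      forall delta, 0 < delta < delta3 -> forall x, inner Omega (B * delta) x ->
        osc_op u delta x <= L3 * kappa delta];
    (* (4) *)
    exists L4 delta4 : R, [/\ 0 < L4, 0 < delta4 < delta0, delta4 <= l &
      forall x y, closure Omega x -> closure Omega y ->
        enorm (x - y) <= delta4 ->
        `|u x - u y| <= L4 * kappa (enorm (x - y))]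
  ].
Proof.
have [eps0 [/andP[eps00 eps0l] ku]] := u_boundary.
have [nonempty openO _] := Omega_domain.
have [C uC] := u_bounded.
have C0 : 0 <= C.
  have [x Ox] := nonempty.
  exact: le_trans (normr_ge0 _) (uC x (@subset_closure _ Omega x Ox)).
have uO x : Omega x -> `|u x| <= C.
  by move=> Ox; apply: uC; exact: subset_closure.
have [l0 _ _ _ _] := kappa_modulus.
have half a : 0 < a -> exists d : R, [/\ 0 < d < delta0, d <= l & d <= a].
  move=> a0; exists (Num.min (delta0 / 2) (Num.min l a)).
  rewrite lt_min !ge_min !lt_min l0 a0 divr_gt0//= !lexx !orbT; split => //.
  by rewrite gt_min; apply/orP; left; lra.
tfae.
- move=> [L [d1 [L0 d10 d1l H]]]; exists L, d1; split => // d dd x ix.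
  have /andP[d0 _] := dd.
  apply: le_trans (H d dd x ix); rewrite lerD2r.
  exact: (mean_op_max_op openO uC u_subharmonic rho_kernel d0 (inner_ecball openO ix)).
- move=> [L [d2 [L0 /andP[d20 _] _ H]]].
  have [K [e [K0 e0 osc]]] := mean_upper_osc n_gt0 openO kappa_modulus eps00 eps0l ku C0 uC u_subharmonic rho_kernel L0 d20 kappa_growth H.
  have [|d3 [d30 _ d3e]] := half (e / 2); first by rewrite divr_gt0.
  have [|d4 [d40 d4l d4le]] := half (l / 2); first by rewrite divr_gt0.
  have /andP[d3p d3d] := d30; have /andP[d4p _] := d40.
  exists 3, (2 * K), (Num.min d3 d4); split.
  + by lra.
  + by rewrite mulr_gt0.
  + by rewrite lt_min d3p d4p gt_min d3d.
  + by rewrite ge_min d4l orbT.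
  move=> d /andP[d0]; rewrite lt_min => /andP[dd3 dd4] x ix.
  apply: (upper_osc_osc openO kappa_modulus d0 _ (ltW K0) _ ix); first lra.
  by apply: osc; rewrite mulr_gt0//=; lra.
- move=> [B [L [d3 [B1 L0 /andP[d30 _] _ H]]]].
  have [K [e [K0 e0 cont]]] := osc_continuous openO kappa_modulus eps00 eps0l ku uC B1 L0 d30 H.
  have [d4 [d40 d4l d4e]] := half e e0.
  exists K, d4; split => // x y cx cy xy; apply: cont => //; exact: le_trans d4e.
- move=> [L [d4 [L0 d40 d4l H]]]; exists L, d4; split => // d /andP[d0 dd4] x ix.
  apply: (continuous_max_op openO kappa_modulus d0 _ (ltW L0) _ ix); first lra.
  by move=> y z cy cz yz; apply: H => //; exact: le_trans (ltW dd4).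
Qed.
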